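(* Let $k\geq 2$ be an integer and let $\alpha\in\mathbb{R}$ be irrational. For $j\in\mathbb{N}$ let $$I_j=\begin{cases}\{n\in\mathbb{N}\cap[2^{j},2^{j+1}] \colon \{n^k\alpha\}\in[1/10,2/10]\} & \text{if } j \text{ is even},\\ \{n\in\mathbb{N}\cap[2^{j},2^{j+1}] \colon \{n^k\alpha\}\in[5/10,6/10]\} & \text{if } j \text{ is odd},\end{cases}$$ where $\{a\}$ for a real number $a$ denotes its fractional part, and define $$S'_k=\bigcup_{j=1}^\infty I_j.$$ Then $S'_k$ is a set of $(k-1)$-convergence but not a set of $k$-convergence.
   Context: $\mathbb{N}$ denotes the positive integers. A probability preserving system $(X,\mathcal{X},\mu,T)$ is a probability space $(X,\mathcal{X},\mu)$ with a measurable map $T\colon X\to X$ satisfying $\mu(T^{-1}A)=\mu(A)$ for all $A\in\mathcal{X}$. For a function $f$ on $X$ write $T^nf=f\circ T^n$. For $\ell\in\mathbb{N}$, an infinite set $S=\{a_1<a_2<\ldots\}\subset\mathbb{N}$ is a set of $\ell$-convergence if for every probability preserving system $(X,\mathcal{X},\mu,T)$ and all functions $f_1,\ldots,f_\ell\in L^\infty(\mu)$ (complex-valued), the averages $$\frac{1}{N}\sum_{n=1}^N T^{a_n}f_1\cdot T^{2a_n}f_2\cdot\ldots\cdot T^{\ell a_n}f_\ell$$ converge in $L^2(\mu)$ as $N\to\infty$. *)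

(* Defs.v *)
From HB Require Import structures.
From mathcomp Require Import all_boot all_order all_algebra.
From mathcomp Require Import complex.
From mathcomp Require Import all_classical all_reals all_analysis.

Set Implicit Arguments.
Unset Strict Implicit.
Unset Printing Implicit Defensive.

Import Order.TTheory GRing.Theory Num.Theory.
Import numFieldNormedType.Exports.
Local Open Scope classical_set_scope.
Local Open Scope ring_scope.

(* The norm `|z| of R[i] takes values in R[i]; this modulus takes values in R. *)
Definition cmod (R : realType) (z : R[i]) : R := ComplexField.Normc.normc z.

(* The Borel sigma-algebra of C is that of R^2, so measurability is that of
   the real and imaginary parts. *)
Definition cmeasurable (R : realType) (d : measure_display)
    (X : measurableType d) (f : X -> R[i]) : Prop :=
  measurable_fun [set: X] (fun x => complex.Re (f x)) /\
  measurable_fun [set: X] (fun x => complex.Im (f x)).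

Definition cLnorm (R : realType) (d : measure_display) (X : measurableType d)
    (mu : probability X R) (p : \bar R) (f : X -> R[i]) : \bar R :=
  'N[mu]_p[EFin \o (@cmod R \o f)]%E.

Definition cLfun (R : realType) (d : measure_display) (X : measurableType d)
    (mu : probability X R) (p : \bar R) (f : X -> R[i]) : Prop :=
  cmeasurable f /\ (cLnorm mu p f < +oo)%E.

(* The map is not required to be invertible. *)
Definition measure_preserving (R : realType) (d : measure_display)
    (X : measurableType d) (mu : probability X R) (T : X -> X) : Prop :=
  measurable_fun [set: X] T /\
  forall A : set X, measurable A -> mu (T @^-1` A) = mu A.

(* The indices are shifted by one: [a n] and [f i] stand for a_(n+1) and
   f_(i+1), so the factors are T^((i+1) a_(n+1)) f_(i+1). *)
Definition multiple_average (R : realType) (X : Type) (T : X -> X)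
    (a : nat -> nat) (l : nat) (f : 'I_l -> X -> R[i]) (N : nat) (x : X)
    : R[i] :=
  N%:R^-1 * \sum_(n < N) \prod_(i < l) f i (iter (i.+1 * a n) T x).

Definition converges_in_L2 (R : realType) (d : measure_display)
    (X : measurableType d) (mu : probability X R) (F : nat -> X -> R[i])
    : Prop :=
  exists2 g : X -> R[i], cLfun mu 2%:E g &
    cLnorm mu 2%:E (fun x => F N x - g x) @[N --> \oo] --> 0%E.

Definition increasing_enumeration (S : set nat) (a : nat -> nat) : Prop :=
  {homo a : m n / (m < n)%N} /\ range a = S.

(* An infinite set of naturals has exactly one increasing enumeration. *)
Definition set_of_convergence (R : realType) (l : nat) (S : set nat) : Prop :=
  [/\ infinite_set S, S `<=` [set n | (0 < n)%N] &
   forall a : nat -> nat, increasing_enumeration S a ->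
   forall (d : measure_display) (X : measurableType d) (mu : probability X R)
     (T : X -> X), measure_preserving mu T ->
   forall f : 'I_l -> X -> R[i], (forall i, cLfun mu +oo%E (f i)) ->
   converges_in_L2 mu (multiple_average T a f)].

Definition frac (R : realType) (x : R) : R := x - (Num.floor x)%:~R.

Definition I_set (R : realType) (k : nat) (alpha : R) (j : nat) : set nat :=
  if odd j then
    [set n | (2 ^ j <= n <= 2 ^ j.+1)%N /\
             5 / 10 <= frac (n%:R ^+ k * alpha) <= 6 / 10]
  else
    [set n | (2 ^ j <= n <= 2 ^ j.+1)%N /\
             1 / 10 <= frac (n%:R ^+ k * alpha) <= 2 / 10].

Definition S_set (R : realType) (k : nat) (alpha : R) : set nat :=
  \bigcup_(j in [set j | (1 <= j)%N]) I_set k alpha j.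

(* Main.v *)
(* Positive part.  A subset of density 1/10 is compared with the integers: the
   averages along S differ from the full averages by averages weighted with
   w(n) = 1_S(n) - 1/10.  On each dyadic block 1_S is the indicator of an arc
   evaluated at n^k alpha, which is approximated by trigonometric polynomials, and
   k - 1 applications of van der Corput's inequality reduce the weights
   cos(2 pi c n^k alpha), twisted by k - 1 shifted functions, to linear phases.  The
   full averages converge by a finitary argument in the manner of Walsh and Tao: in
   a finite system a function splits, by energy decrement, into a combination of
   dual functions and a remainder with small averages; dual functions reduce p + 1
   factors to p, and this gives metastability with bounds uniform over all systems.
   A probability preserving system is approximated by finite cyclic ones through
   the patterns of values along orbits of length Q, so both facts transfer to it.

   Negative part.  In an iterated skew product over the circle there is g with k-th
   difference alpha modulo 1 along orbits, so integer coefficients c_i satisfy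
   sum_(i <= k) c_i g(T^(i n) x) = n^k alpha modulo 1.  With f_i = e(c_i g) the
   averages are a unimodular function times the averages of e(n^k alpha) over S.
   The imaginary part of e(n^k alpha) is at least sin(2 pi / 10) on the even blocks
   and nonpositive on the odd ones, and each block is a positive proportion of what
   precedes it, so these averages oscillate. *)
Require Import Defs.
From HB Require Import structures.
From mathcomp Require Import all_boot all_order all_algebra.
From mathcomp Require Import zify ring lra complex.
From mathcomp Require Import all_classical all_reals all_analysis.
From mathcomp Require Import measurable_realfun ess_sup_inf.

Set Implicit Arguments.
Unset Strict Implicit.
Unset Printing Implicit Defensive.

Import Order.TTheory GRing.Theory Num.Theory.
(* [Defs] again: the libraries loaded after it define another [frac]. *)
Import numFieldNormedType.Exports Defs.
Local Open Scope ring_scope.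

(** * Finite measure-preserving systems *)

Section FiniteSystems.
Variable R : realType.

(** Only statements about finitely many times, with bounds independent of the system, survive the
    passage from finite systems to arbitrary ones; hence [metastable] and [wnull] in place of
    convergence. Finite systems remove all questions of measurability and supply the inverse map
    that the adjoint of an average requires, although the given map need not be invertible. The
    alternation of the blocks escapes k - 1 functions because both arcs have length 1/10:
    subtracting 1/10 removes the constant Fourier coefficient in every block, and only phases of
    degree k remain. Differencing costs one degree and, by measure preservation, one function, so k
    - 1 functions are gone when the phase has become linear. With k functions, one of them would
    still face that linear phase, and it may be an eigenfunction that cancels it. Estimates are made
    for real functions bounded by 1; complex ones are clipped and expanded into real and imaginary
    parts at the end. *)

Record finsys := FinSys {
  pt :> finType;
  wt : pt -> R;
  fT : pt -> pt;
  fTi : pt -> pt;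
  wt_ge0 : forall x, 0 <= wt x;
  wt_sum : \sum_x wt x <= 1;
  fTK : cancel fT fTi;
  fTiK : cancel fTi fT;
  wtT : forall x, wt (fT x) = wt x }.

Definition mean (S : finsys) (f : S -> R) : R := \sum_x wt x * f x.

Definition bounded1 (X : Type) (f : nat -> X -> R) := forall i x, `|f i x| <= 1.

(** Functions are indexed by all of [nat], the first [p] of them entering: one family then serves
    both [p] and [p.+1] functions, and shifts such as [fun i => f i.+1] are total. *)
Definition term (X : Type) (T : X -> X) (p : nat) (f : nat -> X -> R) (n : nat)
  (x : X) : R := \prod_(i < p) f i (iter (i.+1 * n) T x).

Definition avg (X : Type) (T : X -> X) (p : nat) (f : nat -> X -> R) (N : nat)
  (x : X) : R := N%:R^-1 * \sum_(n < N) term T p f n x.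

Section mean_theory.
Variable S : finsys.
Implicit Types f g : S -> R.
Local Notation T := (@fT S).
Local Notation Ti := (@fTi S).

Lemma meanD f g : mean (fun x => f x + g x) = mean f + mean g.
Proof. by rewrite /mean -big_split /=; apply: eq_bigr => x _; rewrite mulrDr. Qed.

Lemma meanZ c f : mean (fun x => c * f x) = c * mean f.
Proof. by rewrite /mean mulr_sumr; apply: eq_bigr => x _; rewrite mulrCA. Qed.

Lemma mean_eq f g : f =1 g -> mean f = mean g.
Proof. by move=> fg; apply: eq_bigr => x _; rewrite fg. Qed.

Lemma mean_sum (I : Type) (r : seq I) (P : pred I) (F : I -> S -> R) :
  mean (fun x => \sum_(i <- r | P i) F i x) = \sum_(i <- r | P i) mean (F i).
Proof.
by rewrite /mean exchange_big /=; apply: eq_bigr => x _; rewrite mulr_sumr.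
Qed.

Lemma le_mean f g : (forall x, f x <= g x) -> mean f <= mean g.
Proof. by move=> fg; apply: ler_sum => x _; rewrite ler_wpM2l ?wt_ge0. Qed.

Lemma mean_ge0 f : (forall x, 0 <= f x) -> 0 <= mean f.
Proof. by move=> f0; apply: sumr_ge0 => x _; rewrite mulr_ge0 ?wt_ge0. Qed.

Lemma mean_le c f : 0 <= c -> (forall x, f x <= c) -> mean f <= c.
Proof.
move=> c0 fc; apply: (le_trans (le_mean (g := fun=> c) fc)).
by rewrite /mean -mulr_suml ler_piMl ?wt_sum.
Qed.

Lemma mean_iterT k f : mean (fun x => f (iter k T x)) = mean f.
Proof.
elim: k f => // k IH f; rewrite -[RHS]IH -[RHS]/(mean (fun x => f (iter k T x))).
rewrite [RHS]/mean (reindex T); last first.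
  by exists Ti => x _; [apply: fTK | apply: fTiK].
by apply: eq_bigr => x _; rewrite wtT -iterSr.
Qed.

Lemma iterTiK k : cancel (iter k T) (iter k Ti).
Proof. by elim: k => // k IH x; rewrite iterSr [iter k.+1 T x]iterS fTK IH. Qed.

Lemma iterKTi k : cancel (iter k Ti) (iter k T).
Proof. by elim: k => // k IH x; rewrite iterSr [iter k.+1 Ti x]iterS fTiK IH. Qed.

Lemma iterTi_add k l x : iter k Ti (iter (k + l) T x) = iter l T x.
Proof. by rewrite iterD iterTiK. Qed.

Lemma mean_iterTi k f : mean (fun x => f (iter k Ti x)) = mean f.
Proof.
rewrite -(mean_iterT k (fun x => f (iter k Ti x))).
by apply: mean_eq => x; rewrite iterTiK.
Qed.

Lemma mean_cs f g : mean (fun x => f x * g x) ^+ 2 <=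
  mean (fun x => f x ^+ 2) * mean (fun x => g x ^+ 2).
Proof.
set a := mean (fun x => f x ^+ 2); set b := mean _; set c := mean (fun x => g x ^+ 2).
have H t : 0 <= a - (t *+ 2) * b + t ^+ 2 * c.
  have -> : a - (t *+ 2) * b + t ^+ 2 * c = mean (fun x => (f x - t * g x) ^+ 2).
    rewrite /a /b /c -mulNr -!meanZ -!meanD.
    by apply: mean_eq => x; rewrite mulr2n; ring.
  by apply: mean_ge0 => x; apply: sqr_ge0.
have a0 : 0 <= a by apply: mean_ge0 => x; apply: sqr_ge0.
have c0 : 0 <= c by apply: mean_ge0 => x; apply: sqr_ge0.
have [c00|cn0] := eqVneq c 0.
  have [->|bn0] := eqVneq b 0; first by rewrite expr0n mulr_ge0.
  (* For c = 0 the quadratic form is affine in t, and this t would give it the value -1. *)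
  have := H ((a + 1) / (b *+ 2)); rewrite c00 mulr0 addr0.
  have -> : (a + 1) / (b *+ 2) *+ 2 * b = a + 1.
    rewrite !mulr2n; field; apply/eqP; move/eqP: bn0; lra.
  lra.
have cp : 0 < c by rewrite lt_neqAle eq_sym cn0.
have := H (b / c).
have -> : a - b / c *+ 2 * b + (b / c) ^+ 2 * c = (a * c - b ^+ 2) / c.
  by rewrite mulr2n; field.
by rewrite pmulr_lge0 ?invr_gt0 // subr_ge0.
Qed.

Lemma mean_const_le c : 0 <= c -> mean (fun _ : S => c) <= c.
Proof. by move=> c0; apply: mean_le. Qed.

End mean_theory.

Lemma term_bound (X : Type) (T : X -> X) p f n x :
  bounded1 f -> `|term T p f n x| <= 1.
Proof.
move=> f1; rewrite /term normr_prod; apply: prodr_ile1 => i _.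
by rewrite normr_ge0 f1.
Qed.

Lemma sum_bound (N : nat) (F : nat -> R) (c : R) :
  (forall n, (n < N)%N -> `|F n| <= c) -> `|\sum_(n < N) F n| <= c * N%:R.
Proof.
move=> Fc; apply: (le_trans (ler_norm_sum _ _ _)).
rewrite mulr_natr -[X in _ *+ X]card_ord -sumr_const.
by apply: ler_sum => i _; apply: Fc.
Qed.

Lemma mean_bound (N : nat) (F : nat -> R) (c : R) : 0 <= c ->
  (forall n, (n < N)%N -> `|F n| <= c) -> `|N%:R^-1 * \sum_(n < N) F n| <= c.
Proof.
case: N => [|N] c0 Fc; first by rewrite invr0 mul0r normr0.
rewrite normrM gtr0_norm ?invr_gt0 ?ltr0n // mulrC ler_pdivrMr ?ltr0n //.
exact: sum_bound.
Qed.

Lemma avg_bound (X : Type) (T : X -> X) p f N x :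
  bounded1 f -> `|avg T p f N x| <= 1.
Proof. by move=> f1; apply: (@mean_bound N (fun n => term T p f n x)) => // n _; apply: term_bound. Qed.

(* Uniformity of [K] over all systems replaces norm convergence. *)
Definition metastable (p : nat) := forall eps : R, 0 < eps ->
  forall F : nat -> nat, exists K, forall (S : finsys) (f : nat -> S -> R),
  bounded1 f -> exists2 N, (0 < N <= K)%N &
  forall n n', (N <= n <= F N)%N -> (N <= n' <= F N)%N ->
  mean (fun x => (avg (@fT S) p f n x - avg (@fT S) p f n' x) ^+ 2) <= eps.

Lemma metastable0 : metastable 0.
Proof.
move=> eps e0 F; exists 1%N => S f f1; exists 1%N => // n n' /andP[n0 _] /andP[n0' _].
have H m x : (0 < m)%N -> avg (@fT S) 0 f m x = 1.
  move=> m0; rewrite /avg (eq_bigr (fun=> 1)) => [|i _]; last by rewrite /term big_ord0.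
  by rewrite sumr_const card_ord mulVf // pnatr_eq0 -lt0n.
rewrite (@mean_eq S _ (fun=> 0)); first exact: (le_trans (@mean_const_le S 0 (lexx 0)) (ltW e0)).
by move=> x; rewrite !H // subrr expr0n.
Qed.

Section product_system.
Variables (S : finsys) (I : finType) (v : I -> R).
Hypotheses (v0 : forall i, 0 <= v i) (v1 : \sum_i v i <= 1).

Lemma prodsys_ge0 (z : S * I) : 0 <= wt z.1 * v z.2.
Proof. by rewrite mulr_ge0 ?wt_ge0. Qed.

Lemma prodsys_sum : \sum_(z : S * I) wt z.1 * v z.2 <= 1.
Proof.
rewrite -(pair_bigA _ (fun x i => wt x * v i)) /=.
under eq_bigr do rewrite -mulr_sumr.
rewrite -mulr_suml mulr_ile1 ?wt_sum // sumr_ge0 // => i _; exact: wt_ge0.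
Qed.

Definition prodT (z : S * I) := (fT z.1, z.2).
Definition prodTi (z : S * I) := (fTi z.1, z.2).

Lemma prodTK : cancel prodT prodTi.
Proof. by case=> x i; rewrite /prodTi /= fTK. Qed.
Lemma prodTiK : cancel prodTi prodT.
Proof. by case=> x i; rewrite /prodT /= fTiK. Qed.
Lemma prodwtT z : wt (prodT z).1 * v (prodT z).2 = wt z.1 * v z.2.
Proof. by rewrite /= wtT. Qed.

(** Superpositions with weights [v] become averages on one system, each index carrying its own
    functions. The weights sum to at most 1, which is why [wt_sum] is an inequality. *)
Definition prodsys := FinSys prodsys_ge0 prodsys_sum prodTK prodTiK prodwtT.

Lemma iter_prodT n x i : iter n prodT (x, i) = (iter n (@fT S) x, i).
Proof. by elim: n => //= n ->. Qed.

Lemma avg_prodsys p (f : I -> nat -> S -> R) N x i :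
  avg (@fT prodsys) p (fun j (z : S * I) => f z.2 j z.1) N (x, i) =
  avg (@fT S) p (f i) N x.
Proof.
congr (_ * _); apply: eq_bigr => n _; apply: eq_bigr => j _.
by rewrite iter_prodT.
Qed.

Lemma mean_prodsys (G : S -> I -> R) :
  mean (fun z : prodsys => G z.1 z.2) = mean (fun x : S => \sum_i v i * G x i).
Proof.
rewrite /mean /= -(pair_bigA _ (fun x i => wt x * v i * G x i)) /=.
apply: eq_bigr => x _; rewrite mulr_sumr.
by apply: eq_bigr => i _; rewrite mulrA.
Qed.

End product_system.

(** The weighted second moment about t is nonnegative for every t; t = b / V, the weighted mean,
    gives the bound. *)
Lemma jensen_sq (I : finType) (v a : I -> R) : (forall i, 0 <= v i) ->
  (\sum_i v i * a i) ^+ 2 <= (\sum_i v i) * \sum_i v i * a i ^+ 2.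
Proof.
move=> v0; set V := \sum_i v i; set b := \sum_i v i * a i; set c := \sum_i _.
have V0 : 0 <= V by apply: sumr_ge0.
have H t : 0 <= c - (t *+ 2) * b + t ^+ 2 * V.
  have -> : c - (t *+ 2) * b + t ^+ 2 * V = \sum_i v i * (a i - t) ^+ 2.
    rewrite /c /b /V -mulNr !mulr_sumr -!big_split /=.
    by apply: eq_bigr => x _; rewrite mulr2n; ring.
  by apply: sumr_ge0 => i _; rewrite mulr_ge0 ?sqr_ge0.
have [V00|Vn0] := eqVneq V 0.
  have vz i : v i = 0.
    by apply/eqP; move/eqP: V00; rewrite psumr_eq0 // => /allP /(_ i); rewrite mem_index_enum => /(_ isT).
  have -> : b = 0 by apply: big1 => i _; rewrite vz mul0r.
  by rewrite V00 expr0n mul0r.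
have Vp : 0 < V by rewrite lt_neqAle eq_sym Vn0.
have := H (b / V).
have -> : c - b / V *+ 2 * b + (b / V) ^+ 2 * V = (V * c - b ^+ 2) / V.
  by rewrite mulr2n; field.
by rewrite pmulr_lge0 ?invr_gt0 // subr_ge0.
Qed.

End FiniteSystems.

(** * Metastability of multiple averages *)

Section Greedy.
Variable R : realType.

Lemma harmonic_dyadic m : m%:R / 2 <= \sum_(i < 2 ^ m) (i.+1%:R^-1 : R).
Proof.
elim: m => [|m IH]; first by rewrite mul0r; apply: sumr_ge0 => i _; rewrite invr_ge0.
rewrite expnS mul2n -addnn big_split_ord /= -natr1 mulrDl lerD //.
have -> : (1 / 2 : R) = \sum_(i < 2 ^ m) (2 ^ m.+1)%:R^-1.
  rewrite sumr_const card_ord -mulr_natr expnS natrM; field.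
  by rewrite pnatr_eq0 expn_eq0.
apply: ler_sum => i _; rewrite lef_pV2 ?posrE ?ltr0n ?expn_gt0 // ler_nat.
by have := ltn_ord i; rewrite expnS; lia.
Qed.

(** The radius at stage s bounds both the total weight of the structured part and the sup norm of
    the remainder. A remainder of that size correlates with a normalised dual function by at least
    [e / radius e s], which is therefore the step length. *)
Fixpoint radius (e : R) (s : nat) : R :=
  if s is s'.+1 then radius e s' + e / radius e s' else 1.

Lemma radius_ge1 e s : 0 < e -> 1 <= radius e s.
Proof.
move=> e0; elim: s => //= s IH; have : 0 <= e / radius e s; last lra.
by rewrite divr_ge0 // ltW // (lt_le_trans ltr01).
Qed.

Lemma radius_mono e s t : 0 < e -> (s <= t)%N -> radius e s <= radius e t.
Proof.
move=> e0; elim: t => [|t IH]; first by rewrite leqn0 => /eqP ->.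
rewrite leq_eqVlt => /orP[/eqP -> //|/IH /le_trans]; apply => /=.
rewrite lerDl divr_ge0 ?(ltW e0) // (le_trans ler01) ?radius_ge1 //.
Qed.

(* The squares of the radii grow linearly, so the energy decrements dominate a
   harmonic series. *)
Lemma energy_diverges e : 0 < e ->
  exists s, 1 < \sum_(i < s) (e / radius e i) ^+ 2.
Proof.
(* The square of r + e / r is r^2 + 2 e + (e / r)^2, and r >= 1 bounds its increment by [a]. *)
move=> e0; pose a := 2 * e + e ^+ 2.
have a0 : 0 < a by rewrite /a; nra.
have sq s : radius e s ^+ 2 <= 1 + a * s%:R.
  elim: s => [|s IH]; first by rewrite expr1n mulr0 addr0.
  have r1 := radius_ge1 s e0.
  have q : radius e s * (e / radius e s) = e.
    by field; apply: lt0r_neq0; lra.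
  have qe : e / radius e s <= e by rewrite ler_pdivrMr ?ler_peMr ?(ltW e0) //; lra.
  have q0 : 0 <= e / radius e s by rewrite divr_ge0 ?(ltW e0) //; lra.
  rewrite /= -natr1; move: q qe q0 IH; rewrite /a.
  set u := e / _; set r := radius e s; nra.
have term_ge i : e ^+ 2 / (1 + a) * i.+1%:R^-1 <= (e / radius e i) ^+ 2.
  have r1 := radius_ge1 i e0.
  rewrite expr_div_n -mulrA ler_wpM2l ?sqr_ge0 // -invfM lef_pV2 ?posrE; first last.
  - by rewrite exprn_gt0 //; lra.
  - by rewrite mulr_gt0 ?ltr0n //; lra.
  apply: le_trans (sq i) _; rewrite -natr1.
  have : 0 <= i%:R :> R by []. nra.
pose k := e ^+ 2 / (1 + a).
have k0 : 0 < k by rewrite divr_gt0 ?exprn_gt0 //; lra.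
pose m := (Num.truncn (2 / k)).+1.
exists (2 ^ m)%N.
apply: (@lt_le_trans _ _ (\sum_(i < 2 ^ m) (e ^+ 2 / (1 + a) * i.+1%:R^-1))); last first.
  by apply: ler_sum => i _; apply: term_ge.
rewrite -mulr_sumr -/k; apply: lt_le_trans (ler_wpM2l (ltW k0) (harmonic_dyadic m)).
have : 2 / k < m%:R by rewrite /m truncnS_gt.
rewrite ltr_pdivrMr //; lra.
Qed.

(** The last function is singled out: the average is linear in [r], and [r] is what gets
    decomposed. *)
Definition avg2 (X : Type) (T : X -> X) (p : nat) (f : nat -> X -> R)
  (r : X -> R) (N : nat) (x : X) : R :=
  N%:R^-1 * \sum_(n < N) (term T p f n x * r (iter (p.+1 * n) T x)).

Lemma avg_avg2 (X : Type) (T : X -> X) p f N x :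
  avg T p.+1 f N x = avg2 T p f (f p) N x.
Proof. by congr (_ * _); apply: eq_bigr => n _; rewrite /term big_ord_recr. Qed.

Lemma avg2D (X : Type) (T : X -> X) p f g h N x :
  avg2 T p f (fun y => g y + h y) N x = avg2 T p f g N x + avg2 T p f h N x.
Proof.
rewrite /avg2 -mulrDr -big_split /=; congr (_ * _).
by apply: eq_bigr => n _; rewrite mulrDr.
Qed.

Lemma avg2_bound (X : Type) (T : X -> X) p f r c N x : bounded1 f -> 0 <= c ->
  (forall y, `|r y| <= c) -> `|avg2 T p f r N x| <= c.
Proof.
move=> f1 c0 rc.
apply: (@mean_bound _ N (fun n => term T p f n x * r (iter (p.+1 * n) T x))) => // n _.
by rewrite normrM -[leRHS]mul1r ler_pM // term_bound.
Qed.

(** * Dual functions and their reducibility *)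

Section dual.
Variables (S : finsys R) (p : nat) (f : nat -> S -> R).
Hypothesis f1 : bounded1 f.
Local Notation T := (@fT _ S).
Local Notation Ti := (@fTi _ S).

(** The adjoint of [avg2] in its last function, evaluated at [a]: translation by T^(-(p+1)m) brings
    that function to time 0 and moves f_i from time (i+1)m to time -(p-i)m. *)
Definition dual (a : S -> R) (N : nat) (x : S) : R := N%:R^-1 *
  \sum_(m < N) (a (iter (p.+1 * m) Ti x) *
                \prod_(i < p) f i (iter ((p - i) * m) Ti x)).

Lemma dualE a r N : mean (fun x => a x * avg2 T p f r N x) =
  mean (fun x => r x * dual a N x).
Proof.
rewrite /avg2 /dual.
rewrite (@mean_eq _ _ _ (fun x => N%:R^-1 * \sum_(n < N)
  a x * (term T p f n x * r (iter (p.+1 * n) T x)))); last first.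
  by move=> x; rewrite mulrCA; congr (_ * _); rewrite mulr_sumr.
rewrite [RHS](@mean_eq _ _ _ (fun x => N%:R^-1 * \sum_(m < N)
  r x * (a (iter (p.+1 * m) Ti x) *
                \prod_(i < p) f i (iter ((p - i) * m) Ti x)))); last first.
  by move=> x; rewrite mulrCA; congr (_ * _); rewrite mulr_sumr.
rewrite !meanZ !mean_sum; congr (_ * _); apply: eq_bigr => m _.
rewrite -(mean_iterTi (p.+1 * m)); apply: mean_eq => x.
rewrite iterKTi mulrA mulrC; congr (_ * (_ * _)).
apply: eq_bigr => i _; congr (f i _).
have -> : (p.+1 * m = i.+1 * m + (p - i) * m)%N.
  by rewrite -mulnDl; congr (_ * _)%N; have := ltn_ord i; lia.
by rewrite iterD iterKTi.
Qed.

Lemma dual_bound a N x : (forall y, `|a y| <= 1) -> `|dual a N x| <= 1.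
Proof.
move=> a1; apply: (@mean_bound _ N (fun m => a (iter (p.+1 * m) Ti x) *
                \prod_(i < p) f i (iter ((p - i) * m) Ti x))) => // m _.
rewrite normrM mulr_ile1 // normr_prod; apply: prodr_ile1 => i _.
by rewrite normr_ge0 f1.
Qed.

End dual.

Lemma sum_ord_split (F : nat -> R) a N : (a <= N)%N ->
  \sum_(m < N) F m = \sum_(m < a) F m + \sum_(m < N - a) F (a + m)%N.
Proof.
move=> /subnKC e.
have : \sum_(m < a + (N - a)) F m = \sum_(m < a) F m + \sum_(m < N - a) F (a + m)%N.
  by rewrite big_split_ord.
by rewrite e.
Qed.

(** The two sums share N - l terms; there remain l terms at either end, each at most 1. *)
Lemma sum_shift_close (G H : nat -> R) (l N : nat) : (l <= N)%N ->
  (forall m, G (l + m)%N = H m) -> (forall m, `|G m| <= 1) -> (forall m, `|H m| <= 1) ->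
  `|\sum_(m < N) G m - \sum_(m < N) H m| <= (l%:R *+ 2).
Proof.
move=> lN GH G1 H1.
have -> : \sum_(m < N) G m = \sum_(m < l) G m + \sum_(m < N - l) H m.
  by rewrite (sum_ord_split _ lN); congr (_ + _); apply: eq_bigr => m _.
have -> : \sum_(m < N) H m = \sum_(m < N - l) H m + \sum_(m < l) H (N - l + m)%N.
  by rewrite (sum_ord_split _ (leq_subr l N)) subKn.
have -> : forall a b c : R, a + b - (b + c) = a - c by move=> *; ring.
apply: le_trans (ler_normB _ _) _; rewrite mulr2n -[l%:R]mul1r lerD //.
  exact: sum_bound.
exact: (@sum_bound _ _ (fun m => H (N - l + m)%N)).
Qed.

(** Up to time [L] the factor of speed p + 1 can be absorbed into those of speeds 1, ..., p, because
    the coefficients [b i x] do not depend on [l]. The bound [C] on the total weight controls the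
    cost of this replacement. *)
Definition reducible (S : finsys R) (p : nat) (h : S -> R) (C err : R) (L : nat) :=
  exists (I : finType) (v : I -> R) (b : I -> S -> R) (c : I -> nat -> S -> R),
  [/\ forall i, 0 <= v i, \sum_i v i <= C, forall i x, `|b i x| <= 1,
    forall i, bounded1 (c i) &
    forall l x, (l <= L)%N -> `|h (iter (p.+1 * l) (@fT _ S) x) -
       \sum_i v i * (b i x * term (@fT _ S) p (c i) l x)| <= err].

Section reducible.
Variables (S : finsys R) (p : nat).
Implicit Types h : S -> R.
Local Notation T := (@fT _ S).
Local Notation Ti := (@fTi _ S).

Lemma reducible0 C L : 0 <= C -> reducible p (fun _ : S => 0) C 0 L.
Proof.
move=> C0; exists unit, (fun=> 0), (fun _ _ => 0), (fun _ _ _ => 0); split => //.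
- by rewrite big1.
- by move=> *; rewrite normr0.
- by move=> i j x; rewrite normr0.
- by move=> l x _; rewrite big1 ?subr0 ?normr0 // => i _; rewrite mul0r.
Qed.

Lemma reducibleD h h' C C' e e' L : reducible p h C e L -> reducible p h' C' e' L ->
  reducible p (fun x => h x + h' x) (C + C') (e + e') L.
Proof.
move=> [I [v [b [c [v0 vC b1 c1 H]]]]] [I' [v' [b' [c' [v0' vC' b1' c1' H']]]]].
exists (I + I')%type, (fun i => match i with inl i => v i | inr i => v' i end).
exists (fun i => match i with inl i => b i | inr i => b' i end).
exists (fun i => match i with inl i => c i | inr i => c' i end); split.
- by case.
- by rewrite big_sumType /= lerD.
- by case.
- by case.
- move=> l x lL; rewrite big_sumType /= opprD addrACA.
  by apply: le_trans (ler_normD _ _) _; rewrite lerD ?H ?H'.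
Qed.

Lemma reducibleZ t h C e L : 0 <= t -> reducible p h C e L ->
  reducible p (fun x => t * h x) (t * C) (t * e) L.
Proof.
move=> t0 [I [v [b [c [v0 vC b1 c1 H]]]]].
exists I, (fun i => t * v i), b, c; split => //.
- by move=> i; rewrite mulr_ge0.
- by rewrite -mulr_sumr ler_wpM2l.
- move=> l x lL; under eq_bigr do rewrite -mulrA.
  by rewrite -mulr_sumr -mulrBr normrM ger0_norm // ler_wpM2l // H.
Qed.

Lemma reducibleW h C C' e e' L L' : C <= C' -> e <= e' -> (L' <= L)%N ->
  reducible p h C e L -> reducible p h C' e' L'.
Proof.
move=> CC ee LL [I [v [b [c [v0 vC b1 c1 H]]]]]; exists I, v, b, c; split => //.
  exact: le_trans vC CC.
by move=> l x lL; apply: le_trans ee; apply: H; apply: leq_trans lL LL.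
Qed.

(** At the point T^((p+1)l) x, replace the summation variable by l + m: the factor [a] stands at
    time -(p+1)m, free of l, and f_i at time (i+1)l - (p-i)m, so its dependence on l has speed i + 1
    <= p. Shifting the range of summation costs 2 l / N. *)
Lemma reducible_dual f a N L : bounded1 f -> (forall y, `|a y| <= 1) ->
  (0 < N)%N -> (L <= N)%N ->
  reducible p (@dual S p f a N) 1 ((L%:R *+ 2) / N%:R) L.
Proof.
move=> f1 a1 N0 LN.
exists 'I_N, (fun=> N%:R^-1), (fun (m : 'I_N) x => a (iter (p.+1 * m) Ti x)).
exists (fun (m : 'I_N) i y => f i (iter ((p - i) * m) Ti y)); split.
- by move=> i; rewrite invr_ge0.
- by rewrite sumr_const card_ord -[X in X <= _]mulr_natr mulVf // pnatr_eq0 -lt0n.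
- by [].
- by move=> m i x; apply: f1.
- move=> l x lL; rewrite -mulr_sumr /dual -mulrBr normrM.
  rewrite gtr0_norm ?invr_gt0 ?ltr0n // mulrC ler_wpM2r ?invr_ge0 //.
  apply: (@le_trans _ _ (l%:R *+ 2)); last by rewrite lerMn2r ler_nat lL.
  pose G m := a (iter (p.+1 * m) Ti (iter (p.+1 * l) T x)) *
      \prod_(i < p) f i (iter ((p - i) * m) Ti (iter (p.+1 * l) T x)).
  pose H m := a (iter (p.+1 * m) Ti x) *
      \prod_(i < p) f i (iter ((p - i) * m) Ti (iter (i.+1 * l) T x)).
  apply: (@sum_shift_close G H); first exact: leq_trans lL LN.
  - move=> m; rewrite /G /H mulnDr addnC iterD iterTiK; congr (_ * _).
    apply: eq_bigr => i _; congr (f i _).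
    have -> : (p.+1 * l = (p - i) * l + i.+1 * l)%N.
      by rewrite -mulnDl; congr (_ * _)%N; have := ltn_ord i; lia.
    by rewrite mulnDr [((p - i) * l + (p - i) * m)%N]addnC iterD iterTi_add.
  - move=> m; rewrite /G normrM mulr_ile1 // normr_prod; apply: prodr_ile1 => i _.
    by rewrite normr_ge0 f1.
  - move=> m; rewrite /H normrM mulr_ile1 // normr_prod; apply: prodr_ile1 => i _.
    by rewrite normr_ge0 f1.
Qed.

End reducible.

Lemma term_mul (X : Type) (T : X -> X) p (f g : nat -> X -> R) n x :
  term T p f n x * term T p g n x = term T p (fun i y => f i y * g i y) n x.
Proof. by rewrite /term -big_split. Qed.

(* For a reducible last function the averages are superpositions of averages of
   [p] functions, that is, averages on a product system. *)
Lemma reducible_metastable p : metastable R p ->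
  forall (C ep : R) (F : nat -> nat), 0 < C -> 0 < ep -> exists K,
  forall (S : finsys R) (f : nat -> S -> R) h err L, bounded1 f -> 0 <= err ->
  reducible p h C err L -> (forall N, (N <= K)%N -> (F N <= L)%N) ->
  exists2 N, (0 < N <= K)%N &
  forall n n', (N <= n <= F N)%N -> (N <= n' <= F N)%N ->
  mean (fun x => (avg2 (@fT _ S) p f h n x - avg2 (@fT _ S) p f h n' x) ^+ 2)
  <= err ^+ 2 * 8 + ep.
Proof.
move=> Mp C ep F C0 ep0.
(* Dividing the weights by [C] gives a product system; undoing this costs C^2, and separating off
   the approximation error costs a factor 2. *)
have [|K HK] := Mp (ep / 2 / C ^+ 2) _ F.
  by rewrite !divr_gt0 // exprn_gt0.
exists K => S f h err L f1 err0 [I [v [b [c [v0 vC b1 c1 H]]]]] FL.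
have w0 i : 0 <= v i / C by rewrite divr_ge0 // ltW.
have w1 : \sum_i v i / C <= 1 by rewrite -mulr_suml ler_pdivrMr ?mul1r.
have [|N NK HN] := HK (prodsys S w0 w1) (fun j (z : S * I) => f j z.1 * c z.2 j z.1).
  by move=> j z; rewrite normrM mulr_ile1 ?normr_ge0 ?f1 //; apply: c1.
exists N => // n n' nN nN'.
pose A i m x := avg (@fT _ S) p (fun j y => f j y * c i j y) m x.
pose w m x := \sum_i v i * (b i x * A i m x).
have appr m x : (m <= F N)%N -> `|avg2 (@fT _ S) p f h m x - w m x| <= err.
  move=> mF.
  have -> : w m x = m%:R^-1 * \sum_(l < m) term (@fT _ S) p f l x *
     \sum_i v i * (b i x * term (@fT _ S) p (c i) l x).
    under [in RHS]eq_bigr do rewrite mulr_sumr.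
    rewrite exchange_big /= mulr_sumr; apply: eq_bigr => i _.
    rewrite /A /avg !mulr_sumr; apply: eq_bigr => l _.
    rewrite -term_mul; ring.
  rewrite /avg2 -mulrBr -sumrB.
  under eq_bigr do rewrite -mulrBr.
  apply: (@mean_bound _ m (fun l => term (@fT _ S) p f l x * (h (iter (p.+1 * l) (@fT _ S) x)
    - \sum_i v i * (b i x * term (@fT _ S) p (c i) l x)))) => // l lm.
  rewrite normrM -[leRHS]mul1r ler_pM ?term_bound ?H //.
  have : (F N <= L)%N by apply: FL; case/andP: NK.
  lia.
have pw x : (avg2 (@fT _ S) p f h n x - avg2 (@fT _ S) p f h n' x) ^+ 2 <=
   err ^+ 2 * 8 + 2 * C ^+ 2 * \sum_i (v i / C) * (A i n x - A i n' x) ^+ 2.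
  have J := jensen_sq (fun i => b i x * (A i n x - A i n' x)) w0.
  have wE : w n x - w n' x = C * \sum_i v i / C * (b i x * (A i n x - A i n' x)).
    rewrite /w -sumrB mulr_sumr; apply: eq_bigr => i _; field.
    exact: lt0r_neq0.
  have J2 : (w n x - w n' x) ^+ 2 <=
      C ^+ 2 * \sum_i (v i / C) * (A i n x - A i n' x) ^+ 2.
    rewrite wE exprMn ler_wpM2l ?sqr_ge0 //; apply: le_trans J _.
    have S0 : 0 <= \sum_i v i / C * (b i x * (A i n x - A i n' x)) ^+ 2.
      by apply: sumr_ge0 => i _; rewrite mulr_ge0 ?sqr_ge0.
    apply: (@le_trans _ _ (\sum_i v i / C * (b i x * (A i n x - A i n' x)) ^+ 2)).
      by rewrite ler_piMl.
    apply: ler_sum => i _; rewrite ler_wpM2l // exprMn ler_piMl ?sqr_ge0 //.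
    by rewrite -real_normK ?num_real // expr_le1.
  have /ler_normlP[a1 a2] : `|avg2 (@fT _ S) p f h n x - w n x| <= err.
    by apply: appr; case/andP: nN.
  have /ler_normlP[a3 a4] : `|avg2 (@fT _ S) p f h n' x - w n' x| <= err.
    by apply: appr; case/andP: nN'.
  move: J2 a1 a2 a3 a4; rewrite -[2 * C ^+ 2 * _]mulrA.
  set q := C ^+ 2 * _; set a := avg2 _ _ _ _ _ _; set a' := avg2 _ _ _ _ _ _.
  set s := w _ _; set s' := w _ _ => J2 a1 a2 a3 a4.
  pose t := a - a' - (s - s').
  have t1 : t <= 2 * err by rewrite /t; lra.
  have t2 : - (2 * err) <= t by rewrite /t; lra.
  have : t ^+ 2 <= 4 * err ^+ 2 by nra.
  have -> : a - a' = t + (s - s') by rewrite /t; ring.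
  have : 0 <= (t - (s - s')) ^+ 2 by apply: sqr_ge0.
  nra.
apply: le_trans (le_mean pw) _.
rewrite meanD meanZ lerD ?mean_le ?mulr_ge0 ?sqr_ge0 //.
have := HN n n' nN nN'.
rewrite (@mean_eq _ (prodsys S w0 w1) _
    (fun z => (fun x i => (A i n x - A i n' x) ^+ 2) z.1 z.2)).
  rewrite (mean_prodsys w0 w1 (fun x i => (A i n x - A i n' x) ^+ 2)).
  rewrite ler_pdivlMr ?exprn_gt0 //; set q := mean _; lra.
case=> x i.
by rewrite !(avg_prodsys w0 w1 p (fun i j x => f j x * c i j x)).
Qed.

End Greedy.

(** * Energy decrement: from p to p + 1 functions *)

Section MetastableStep.
Variables (R : realType) (p : nat).
Hypothesis Mp : metastable R p.
Variables (eps e1 : R) (F : nat -> nat) (smax : nat) (delta : R).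
Hypotheses (eps0 : 0 < eps) (e10 : 0 < e1) (delta0 : 0 < delta).
Hypothesis e1E : e1 = eps / 32.
Hypothesis smaxP : 1 < \sum_(i < smax) (e1 / radius e1 i) ^+ 2.
Hypothesis deltaP : (delta * radius e1 smax) ^+ 2 * 8 <= eps / 32.

Local Notation eta s := (e1 / radius e1 s).

(** After s stages the remainder has lost the squares of the first s step lengths from its energy.
    Energy is nonnegative, so [smaxP] rules out stage [smax]. *)
Definition greedy_state (s : nat) (S : finsys R) (g : S -> R) (L : nat) :=
  exists h : S -> R, [/\ reducible p h (radius e1 s) (delta * radius e1 s) L,
    forall x, `|g x - h x| <= radius e1 s &
    mean (fun x => (g x - h x) ^+ 2) <= 1 - \sum_(i < s) eta i ^+ 2].

(** Let A be a large average of the remainder and C the current radius. By duality the remainder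
    correlates with the dual function of A / C by mean(A^2) / C > e1 / C, the step length eta.
    Adding eta times this dual to [h] lowers the energy by at least 2 eta^2 - eta^2. The new horizon
    [L'] has to be short compared with n, the length of the dual. *)
Lemma greedy_step s (S : finsys R) (f : nat -> S -> R) g L L' n : bounded1 f ->
  (0 < n)%N -> (L' <= L)%N -> (L' <= n)%N -> (L'%:R *+ 2) / n%:R <= delta ->
  forall h : S -> R, reducible p h (radius e1 s) (delta * radius e1 s) L ->
  (forall x, `|g x - h x| <= radius e1 s) ->
  mean (fun x => (g x - h x) ^+ 2) <= 1 - \sum_(i < s) eta i ^+ 2 ->
  e1 < mean (fun x => avg2 (@fT _ S) p f (fun y => g y - h y) n x ^+ 2) ->
  greedy_state s.+1 g L'.
Proof.
move=> f1 n0 LL Ln Ld h hred gh en big.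
set C := radius e1 s; have C1 : 1 <= C by apply: radius_ge1.
have C0 : 0 < C by lra.
have eta0 : 0 < eta s by rewrite divr_gt0.
pose A := avg2 (@fT _ S) p f (fun y => g y - h y) n.
pose a x := C^-1 * A x.
have a1 y : `|a y| <= 1.
  rewrite /a normrM gtr0_norm ?invr_gt0 // mulrC ler_pdivrMr // mul1r.
  by apply: avg2_bound => //; apply: ltW.
pose sg := dual p f a n.
have sg1 y : `|sg y| <= 1 by apply: dual_bound.
exists (fun x => h x + eta s * sg x); split.
- apply: (@reducibleW _ _ _ _ (C + eta s * 1) _ (delta * C + eta s * (L'%:R *+ 2 / n%:R)) _ L').
  + by rewrite mulr1.
  + by rewrite /= mulrDr lerD2l mulrC ler_wpM2r // ltW.
  + by [].
  + apply: reducibleD; first by apply: reducibleW hred.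
    by apply: reducibleZ; [exact: ltW | exact: reducible_dual].
- move=> x; rewrite opprD addrA /=; apply: le_trans (ler_normB _ _) _.
  rewrite lerD // normrM gtr0_norm //.
  by rewrite ler_piMr // ltW.
- rewrite big_ord_recr /= opprD addrA.
  have -> : mean (fun x => (g x - (h x + eta s * sg x)) ^+ 2) =
    mean (fun x => (g x - h x) ^+ 2) - eta s *+ 2 * mean (fun x => (g x - h x) * sg x)
    + eta s ^+ 2 * mean (fun x => sg x ^+ 2).
    rewrite -mulNr -!meanZ -!meanD.
    by apply: mean_eq => x; rewrite mulr2n; ring.
  have cor : eta s <= mean (fun x => (g x - h x) * sg x).
    rewrite -(@dualE _ S p f a (fun x => g x - h x) n).
    rewrite (@mean_eq _ _ _ (fun x => C^-1 * A x ^+ 2)); last first.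
      by move=> x; rewrite /a expr2 [RHS]mulrA.
    by rewrite meanZ mulrC ler_wpM2l ?invr_ge0 ?(ltW C0) // ltW.
  have sgs : mean (fun x => sg x ^+ 2) <= 1.
    by apply: mean_le => // x; rewrite -real_normK ?num_real // expr_le1.
  move: en cor sgs eta0; set X := mean _; set Y := mean _; set Z := mean _.
  set W := \sum_(i < s) _; set t := e1 / radius e1 s; rewrite mulr2n.
  move=> en cor sgs eta0; have := sqr_ge0 t; nra.
Qed.

(** Induction on the number t of stages left. The averages of [h] are stable on some window. Either
    those of the remainder are small throughout the window, and this window serves, or a large one
    among them leads to stage s + 1. *)
Lemma greedy_loop t s : (s + t = smax)%N -> exists K L,
  forall (S : finsys R) (f : nat -> S -> R) g, bounded1 f -> greedy_state s g L ->
  exists2 N, (0 < N <= K)%N &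
  forall n n', (N <= n <= F N)%N -> (N <= n' <= F N)%N ->
  mean (fun x => (avg2 (@fT _ S) p f g n x - avg2 (@fT _ S) p f g n' x) ^+ 2) <= eps.
Proof.
elim: t s => [|t IH] s.
  rewrite addn0 => ->; exists 0%N, 0%N => S f g f1 [h [_ _ en]].
  have : 0 <= mean (fun x => (g x - h x) ^+ 2).
    by apply: mean_ge0 => x; apply: sqr_ge0.
  by move: en smaxP; set X := mean _; set Y := \sum_(_ < _) _ => *; lra.
rewrite addnS -addSn => est; have [Kt [Lt IHt]] := IH _ est.
(* Beyond [Nlow] every length n satisfies 2 Lt / n <= delta, as the dual function handed to the next
   stage demands. *)
pose Nlow := maxn 1 (maxn Lt (Num.truncn (Lt%:R *+ 2 / delta)).+1).
pose F' N := F (maxn N Nlow).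
pose C := radius e1 smax.
have C1 : 1 <= C by apply: radius_ge1.
have [|ep0] := (@reducible_metastable _ p Mp C (eps / 32) F' (lt_le_trans ltr01 C1)).
  by move: eps0; lra.
(* Here [ep0] bounds the start of the window. The horizon covers what the next stage needs and every
   window that may occur. *)
move=> HK; exists (maxn Kt (maxn ep0 Nlow)), (maxn Lt (\max_(N < ep0.+1) F' N)).
move=> S f g f1 [h [hred gh en]].
have sC : radius e1 s <= C by apply: radius_mono => //; lia.
have hred' : reducible p h C (delta * C) (\max_(N < ep0.+1) F' N).
  by apply: reducibleW hred => //; [rewrite ler_wpM2l // ltW | apply: leq_maxr].
have [|N|N NK HN] := HK S f h _ _ f1 _ hred'.
- by rewrite mulr_ge0 ?(ltW delta0) //; lra.
- rewrite -ltnS => NK; exact: (leq_bigmax (Ordinal NK)).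
have [small|] := pselect (forall n, (maxn N Nlow <= n <= F' N)%N ->
  mean (fun x => avg2 (@fT _ S) p f (fun y => g y - h y) n x ^+ 2) <= e1).
  exists (maxn N Nlow); first by rewrite /Nlow; lia.
  move=> n n' nN nN'.
  have dec x : (avg2 (@fT _ S) p f g n x - avg2 (@fT _ S) p f g n' x) ^+ 2 <=
     3 * ((avg2 (@fT _ S) p f h n x - avg2 (@fT _ S) p f h n' x) ^+ 2 +
     (avg2 (@fT _ S) p f (fun y => g y - h y) n x ^+ 2 +
      avg2 (@fT _ S) p f (fun y => g y - h y) n' x ^+ 2)).
    have e m : avg2 (@fT _ S) p f g m x = avg2 (@fT _ S) p f h m x +
       avg2 (@fT _ S) p f (fun y => g y - h y) m x.
      rewrite -avg2D; congr (_ * _); apply: eq_bigr => i _; congr (_ * _); ring.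
    have sq3 (u u' v v' : R) : (u + v - (u' + v')) ^+ 2 <=
        3 * ((u - u') ^+ 2 + (v ^+ 2 + v' ^+ 2)).
      rewrite -subr_ge0.
      have -> : 3 * ((u - u') ^+ 2 + (v ^+ 2 + v' ^+ 2)) - (u + v - (u' + v')) ^+ 2 =
        (u - u' - v) ^+ 2 + (u - u' + v') ^+ 2 + (v + v') ^+ 2 by ring.
      by rewrite !addr_ge0 ?sqr_ge0.
    by rewrite !e.
  apply: le_trans (le_mean dec) _; rewrite meanZ !meanD.
  have h1 := small n nN; have h2 := small n' nN'.
  have h3 : mean (fun x => (avg2 (@fT _ S) p f h n x - avg2 (@fT _ S) p f h n' x) ^+ 2)
      <= (delta * C) ^+ 2 * 8 + eps / 32.
    by apply: HN; [move: nN | move: nN']; rewrite geq_max -andbA => /and3P[-> _ ->].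
  move: h1 h2 h3 deltaP eps0; rewrite -/C -e1E.
  set m1 := mean _; set m2 := mean _; set m3 := mean _.
  by move=> h1 h2 h3 h4 h5; have := e1E; lra.
move=> /existsNP[n /not_implyP[nN /negP]]; rewrite -ltNge => big.
have [N' N'K HN'] : exists2 N, (0 < N <= Kt)%N &
  forall n n', (N <= n <= F N)%N -> (N <= n' <= F N)%N ->
  mean (fun x => (avg2 (@fT _ S) p f g n x - avg2 (@fT _ S) p f g n' x) ^+ 2) <= eps.
  apply: IHt => //.
  have low : (Nlow <= n)%N by clear -nN; lia.
  apply: (@greedy_step s S f g _ Lt n f1 _ _ _ _ h hred gh en big).
  - by clear -low; rewrite /Nlow in low; lia.
  - exact: leq_maxl.
  - by clear -low; rewrite /Nlow in low; lia.
  - have n0 : (0 < n)%N by clear -low; rewrite /Nlow in low; lia.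
    rewrite ler_pdivrMr ?ltr0n // mulrC -ler_pdivrMr //.
    apply: ltW; apply: lt_le_trans (truncnS_gt _) _.
    by rewrite ler_nat; apply: leq_trans low; rewrite /Nlow !leq_max leqnn !orbT.
by exists N' => //; clear -N'K; lia.
Qed.

End MetastableStep.

Lemma metastableS (R : realType) p : metastable R p -> metastable R p.+1.
Proof.
move=> Mp eps eps0 F; pose e1 : R := eps / 32.
have e10 : 0 < e1 by rewrite /e1; lra.
have [smax smaxP] := energy_diverges e10.
pose m : R := Num.min 1 eps; pose C := radius e1 smax.
have C1 : 1 <= C by apply: radius_ge1.
have m0 : 0 < m by rewrite /m lt_min ltr01.
have m1 : m <= 1 by rewrite /m ge_min lexx.
have me : m <= eps by rewrite /m ge_min lexx orbT.
(* Then 8 (delta C)^2 = m^2 / 32 <= eps / 32, by m <= 1 and m <= eps. *)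
pose delta := m / (16 * C).
have delta0 : 0 < delta by rewrite divr_gt0 //; lra.
have dP : (delta * radius e1 smax) ^+ 2 * 8 <= eps / 32.
  have -> : delta * radius e1 smax = m / 16 by rewrite /delta -/C; field; lra.
  nra.
have [K [L KL]] := greedy_loop Mp F eps0 e10 delta0 (erefl _) smaxP dP (add0n smax).
exists K => S f f1.
have [|N NK HN] := KL S f (f p) f1.
- exists (fun=> 0); split => /=.
  + rewrite mulr1; apply: reducibleW (reducible0 S p L ler01) => //; exact: ltW.
  + by move=> x; rewrite subr0.
  + rewrite big_ord0 subr0; apply: mean_le => // x.
    by rewrite subr0 -real_normK ?num_real // expr_le1.
exists N => // n n' nN nN'.
rewrite (@mean_eq _ _ _ (fun x => (avg2 (@fT _ S) p f (f p) n x -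
  avg2 (@fT _ S) p f (f p) n' x) ^+ 2)) ?HN //.
by move=> x; rewrite !avg_avg2.
Qed.

Theorem metastability (R : realType) p : metastable R p.
Proof. by elim: p => [|p]; [exact: metastable0 | exact: metastableS]. Qed.

(** * Weighted averages and van der Corput's inequality *)

Section Circle.
Variable R : realType.
Implicit Types x y : R.

(** With [syc], the real and imaginary parts of e(x) = exp(2 pi i x), kept apart because finite
    systems carry real functions. *)
Definition cyc x : R := cos (pi *+ 2 * x).
Definition syc x : R := sin (pi *+ 2 * x).

Lemma cycDnat x n : cyc (x + n%:R) = cyc x.
Proof. by rewrite /cyc mulrDr mulr_natr (periodicn (@cosD2pi R)). Qed.

Lemma cycDint x (z : int) : cyc (x + z%:~R) = cyc x.
Proof.
case: z => n; first exact: cycDnat.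
by rewrite NegzE mulrNz -(cycDnat (x + _) n.+1) addrNK.
Qed.

Lemma sycDnat x n : syc (x + n%:R) = syc x.
Proof. by rewrite /syc mulrDr mulr_natr (periodicn (@sinD2pi R)). Qed.

Lemma sycDint x (z : int) : syc (x + z%:~R) = syc x.
Proof.
case: z => n; first exact: sycDnat.
by rewrite NegzE mulrNz -(sycDnat (x + _) n.+1) addrNK.
Qed.

Lemma cycB x y : cyc (x - y) = cyc x * cyc y + syc x * syc y.
Proof. by rewrite /cyc mulrBr cosB. Qed.

Lemma syc_cyc x : syc x = cyc (x - 1 / 4).
Proof.
rewrite /syc /cyc -cosBpihalf; congr cos; lra.
Qed.

Lemma cyc_le1 x : `|cyc x| <= 1.
Proof. by rewrite ler_norml cos_geN1 cos_le1. Qed.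

Lemma syc_le1 x : `|syc x| <= 1.
Proof. by rewrite syc_cyc cyc_le1. Qed.

Lemma cyc_sq x : cyc x ^+ 2 + syc x ^+ 2 = 1.
Proof. exact: cos2Dsin2. Qed.

Lemma irrational_mul_int (a : R) (z : int) : irrational a -> z != 0 ->
  irrational (a * z%:~R).
Proof.
move=> ia z0 [q _ qa]; apply: ia; exists (q / z%:~R) => //.
by rewrite fmorph_div /= qa ratr_int mulfK // intr_eq0.
Qed.

Lemma sin_pi_int (z : int) : sin (pi * z%:~R) = 0 :> R.
Proof.
have H n : sin (pi * n%:R) = 0 :> R.
  elim: n => [|n IH]; first by rewrite mulr0 sin0.
  by rewrite -natr1 mulrDr mulr1 sinDpi IH oppr0.
case: z => n; first exact: H.
by rewrite NegzE mulrNz mulrN sinN H oppr0.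
Qed.

Lemma sin_irrational (a : R) : irrational a -> sin (pi * a) != 0.
Proof.
move=> ia; set z := Num.floor a; pose r := a - z%:~R.
have r0 : 0 < r.
  rewrite lt_neqAle subr_ge0 floor_le_tmp andbT; apply/eqP => r0.
  by apply: ia; exists z%:~R => //; rewrite ratr_int; apply/eqP; rewrite eq_sym -subr_eq0 -/r -r0.
have r1 : r < 1 by rewrite /r ltrBlDl; have := floorD1_gt a; rewrite -/z intrD; lra.
have sr : 0 < sin (pi * r).
  by apply: sin_gt0_pi; rewrite mulr_gt0 ?pi_gt0 //= gtr_pMr ?pi_gt0.
have c0 : cos (pi * z%:~R) != 0 :> R.
  have := cos2Dsin2 (pi * z%:~R : R); rewrite sin_pi_int expr0n addr0.
  by move=> h; apply/eqP => h0; move: h; rewrite h0 expr0n => /eqP; rewrite eq_sym oner_eq0.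
have -> : a = r + z%:~R by rewrite /r; ring.
by rewrite mulrDr sinD sin_pi_int mulr0 addr0 mulf_neq0 // gt_eqF.
Qed.

(** Multiplied by 2 sin(pi a) the sum telescopes, with end terms at most 1; irrationality keeps
    sin(pi a) away from 0. *)
Lemma sum_cyc_linear (a b : R) N : irrational a ->
  `|\sum_(n < N) cyc (n%:R * a + b)| <= `|sin (pi * a)|^-1.
Proof.
move=> /sin_irrational sa.
pose t n := sin (pi *+ 2 * (n%:R * a + b) - pi * a).
have E : (2 * sin (pi * a)) * \sum_(n < N) cyc (n%:R * a + b) = t N - t 0%N.
  rewrite mulr_sumr -(big_mkord xpredT (fun n => 2 * sin (pi * a) * cyc (n%:R * a + b))).
  rewrite -(telescope_sumr t) //; apply: eq_bigr => n _.
  rewrite /t /cyc.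
  have -> : pi *+ 2 * (n.+1%:R * a + b) - pi * a =
     pi *+ 2 * (n%:R * a + b) + pi * a by rewrite -natr1 mulr2n; ring.
  by rewrite sinD sinB; ring.
have : `|2 * sin (pi * a)| * `|\sum_(n < N) cyc (n%:R * a + b)| <= 2.
  rewrite -normrM E; apply: le_trans (ler_normB _ _) _.
  have h n : `|t n| <= 1 by rewrite ler_norml sin_geN1 sin_le1.
  by have := h N; have := h 0%N; lra.
rewrite normrM gtr0_norm // => H.
rewrite -[leRHS]mul1r ler_pdivlMr ?normr_gt0 // mulrC; lra.
Qed.

End Circle.

(** * Van der Corput's inequality and polynomial phases *)

Section VanDerCorput.
Variable R : realType.

(** Averaging first over windows of length H changes the average by at most 2 H / N. By Jensen the
    square of the new average is at most the mean square of the window means, which expands into the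
    correlations. Values beyond N are kept, so that the correlations are again full averages. The
    factors 2 and 8 come from (x + y)^2 <= 2 x^2 + 2 y^2. *)
Lemma vdc_pointwise (u : nat -> R) (H N : nat) :
  (forall n, `|u n| <= 1) -> (0 < H <= N)%N ->
  (N%:R^-1 * \sum_(n < N) u n) ^+ 2 <=
  (H%:R ^- 2 * \sum_(h < H) \sum_(h' < H)
     (N%:R^-1 * \sum_(n < N) u (n + h)%N * u (n + h')%N)) *+ 2
  + (H%:R / N%:R) ^+ 2 * 8.
Proof.
move=> u1 /andP[H0 HN].
have N0 : (0 < N)%N by apply: leq_trans HN.
have nH : 0 < H%:R :> R by rewrite ltr0n.
have nN : 0 < N%:R :> R by rewrite ltr0n.
pose a := N%:R^-1 * \sum_(n < N) u n.
pose B n := H%:R^-1 * \sum_(h < H) u (n + h)%N.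
pose b := N%:R^-1 * \sum_(n < N) B n.
have ab : `|a - b| <= 2 * (H%:R / N%:R).
  have -> : a - b = H%:R^-1 * \sum_(h < H)
      (N%:R^-1 * (\sum_(n < N) u n - \sum_(n < N) u (n + h)%N)).
    rewrite -mulr_sumr sumrB sumr_const card_ord.
    rewrite /a /b /B -mulr_sumr [in LHS]exchange_big /= -mulr_natr; field.
    by rewrite !lt0r_neq0.
  apply: (@mean_bound _ H (fun h => N%:R^-1 * (\sum_(n < N) u n - \sum_(n < N) u (n + h)%N))).
    by rewrite mulr_ge0 ?divr_ge0 // ltW.
  move=> h hH; rewrite normrM gtr0_norm ?invr_gt0 // mulrA [leRHS]mulrC.
  rewrite ler_wpM2l ?invr_ge0 ?(ltW nN) //.
  apply: (@le_trans _ _ (h%:R *+ 2)); last by rewrite -[leLHS]mulr_natl ler_wpM2l // ler_nat ltnW.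
  apply: (@sum_shift_close _ u (fun n => u (n + h)%N)) => //.
    by apply: leq_trans HN; apply: ltnW.
  by move=> m; rewrite addnC.
have bB : b ^+ 2 <= N%:R^-1 * \sum_(n < N) B n ^+ 2.
  have NV (i : 'I_N) : 0 <= N%:R^-1 :> R by rewrite invr_ge0 ltW.
  have := @jensen_sq R 'I_N (fun=> N%:R^-1) (fun n => B n) NV.
  have -> : \sum_(i < N) N%:R^-1 = 1 :> R.
    by rewrite sumr_const card_ord -[LHS]mulr_natr mulVf // lt0r_neq0.
  have -> : \sum_(i < N) N%:R^-1 * B i = b by rewrite [RHS]mulr_sumr.
  by rewrite mul1r => J; apply: (le_trans J); rewrite mulr_sumr.
have BE : N%:R^-1 * \sum_(n < N) B n ^+ 2 = H%:R ^- 2 * \sum_(h < H) \sum_(h' < H)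
     (N%:R^-1 * \sum_(n < N) u (n + h)%N * u (n + h')%N).
  under [in RHS]eq_bigr do rewrite -mulr_sumr.
  rewrite -mulr_sumr mulrCA; congr (_ * _); under [in RHS]eq_bigr do rewrite exchange_big.
  rewrite exchange_big mulr_sumr /=; apply: eq_bigr => n _.
  rewrite /B exprMn exprVn; congr (_ * _); rewrite expr2 mulr_suml; apply: eq_bigr => h _.
  by rewrite mulr_sumr.
rewrite -BE -/a; move: ab bB => /ler_normlP[]; set q := _ / _.
set w := N%:R^-1 * _ => ab1 ab2 bw.
have t1 : (a - b) ^+ 2 <= 4 * q ^+ 2 by nra.
have : 0 <= (a - b - b) ^+ 2 by apply: sqr_ge0.
have -> : a = (a - b) + b by ring.
rewrite mulr2n; set t := a - b in t1 *. nra.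
Qed.

Definition wavg (X : Type) (T : X -> X) (l : nat) (f : nat -> X -> R)
  (c : nat -> R) (N : nat) (x : X) : R :=
  N%:R^-1 * \sum_(n < N) c n * term T l f n x.

(** Abstracts polynomials of degree d with irrational leading coefficient ([weyl_poly]), keeping
    just what repeated differencing uses. Degree 0 is [False]: a constant phase has no
    cancellation. *)
Fixpoint weyl (d : nat) (p : nat -> R) : Prop :=
  match d with
  | 0 => False
  | d'.+1 => if d' is 0 then
        exists a b, irrational a /\ forall n, p n = n%:R * a + b
      else forall h h', h != h' -> weyl d' (fun n => p (n + h)%N - p (n + h')%N)
  end.

Lemma weylDc d p c : weyl d p -> weyl d (fun n => p n + c).
Proof.
case: d => [|[|d]] //=.
  by move=> [a [b [ia pE]]]; exists a, (b + c); split=> // n; rewrite pE addrA.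
move=> H h h' hh; have := H h h' hh; congr (weyl d.+1 _); apply/funext => n; ring.
Qed.

(** [N0] precedes the system and the functions: the induction applies the bound to products of
    shifted functions, and the transfer applies it to a system that depends on N. *)
Definition wnull (l : nat) (c : nat -> R) := forall eps : R, 0 < eps ->
  exists N0, forall N, (N0 <= N)%N -> forall (S : finsys R) (f : nat -> S -> R),
  bounded1 f -> mean (fun x => wavg (@fT _ S) l f c N x ^+ 2) <= eps.

Lemma wavg0 (X : Type) (T : X -> X) f c N x :
  wavg T 0 f c N x = N%:R^-1 * \sum_(n < N) c n.
Proof.
by rewrite /wavg; congr (_ * _); apply: eq_bigr => n _; rewrite /term big_ord0 mulr1.
Qed.

Lemma wnull_linear (a b : R) : irrational a -> wnull 0 (fun n => cyc (n%:R * a + b)).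
Proof.
move=> ia eps eps0; pose s := `|sin (pi * a)|^-1.
have s0 : 0 <= s by rewrite invr_ge0.
pose M := (Num.truncn (s ^+ 2 / eps)).+1.
exists M => N MN S f f1; apply: mean_le; first exact: ltW.
move=> x; rewrite wavg0.
have N0 : 0 < N%:R :> R by rewrite ltr0n; apply: leq_trans MN.
have N1 : 1 <= N%:R :> R by rewrite ler1n; apply: leq_trans MN.
have := sum_cyc_linear b N ia; rewrite -/s; set c := \sum_(_ < _) _ => cs.
have c2 : c ^+ 2 <= s ^+ 2 by rewrite -real_normK ?num_real // lerXn2r ?nnegrE.
have sM : s ^+ 2 < eps * N%:R.
  rewrite mulrC -ltr_pdivrMr //; apply: lt_le_trans (truncnS_gt _) _.
  by rewrite ler_nat.
rewrite exprMn exprVn mulrC ler_pdivrMr ?exprn_gt0 //.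
apply: le_trans c2 _; apply: le_trans (ltW sM) _; rewrite ler_wpM2l ?(ltW eps0) //.
by rewrite expr2 ler_peMr // ltW.
Qed.

Lemma term_shift_fun (X : Type) (T : X -> X) l (f : nat -> X -> R) n h x :
  term T l f (n + h)%N x = term T l (fun i y => f i (iter (i.+1 * h) T y)) n x.
Proof.
by apply: eq_bigr => i _; rewrite mulnDr addnC iterD.
Qed.

Lemma term_recl (X : Type) (T : X -> X) l (f : nat -> X -> R) n x :
  term T l.+1 f n x = f 0%N (iter n T x) * term T l (fun i => f i.+1) n (iter n T x).
Proof.
rewrite /term big_ord_recl mul1n; congr (_ * _); apply: eq_bigr => i _.
by rewrite -iterD /= mulSn addnC.
Qed.

(* Measure preservation removes the first factor of the correlations, so that one
   fewer function is left against a phase of one lower degree. *)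
Lemma mean_wavg_corr (S : finsys R) l (g : nat -> S -> R) c N (e : R) :
  0 <= e -> bounded1 g ->
  (forall g' : nat -> S -> R, bounded1 g' ->
     mean (fun x => wavg (@fT _ S) l.-1 g' c N x ^+ 2) <= e ^+ 2) ->
  mean (fun x => wavg (@fT _ S) l g c N x) <= e.
Proof.
move=> e0 g1 He.
have [g0 [g' [g01 g'1 ->]]] : exists g0 : S -> R, exists g' : nat -> S -> R,
   [/\ forall x, `|g0 x| <= 1, bounded1 g' &
   mean (fun x => wavg (@fT _ S) l g c N x) =
   mean (fun x => g0 x * wavg (@fT _ S) l.-1 g' c N x)].
  (* With no function there is none to remove, and [l.-1] is again 0. *)
  case: l {He} => [|l].
    exists (fun=> 1), g; split => //; first by move=> x; rewrite normr1.
    by apply: mean_eq => x; rewrite mul1r.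
  exists (g 0%N), (fun i => g i.+1); split; [by move=> x; apply: g1 | by move=> i x; apply: g1 |].
  rewrite /wavg meanZ mean_sum.
  rewrite [RHS](@mean_eq _ _ _ (fun x => N%:R^-1 * \sum_(n < N)
     c n * (g 0%N x * term (@fT _ S) l (fun i => g i.+1) n x))); last first.
    by move=> x /=; rewrite mulrCA mulr_sumr; congr (_ * _); apply: eq_bigr => n _; rewrite mulrCA.
  rewrite meanZ mean_sum; congr (_ * _); apply: eq_bigr => n _.
  rewrite !meanZ; congr (_ * _).
  rewrite -[RHS](mean_iterT n); apply: mean_eq => x; exact: term_recl.
have := mean_cs g0 (fun x => wavg (@fT _ S) l.-1 g' c N x).
set m := mean (fun x => g0 x * _) => cs.
have : m ^+ 2 <= e ^+ 2.
  apply: le_trans cs _; rewrite -[leRHS]mul1r ler_pM ?He //.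
  - by apply: mean_ge0 => x; apply: sqr_ge0.
  - by apply: mean_ge0 => x; apply: sqr_ge0.
  - by apply: mean_le => // x; rewrite -real_normK ?num_real // expr_le1.
by move=> h; rewrite leNgt; apply/negP => em; nra.
Qed.

(** The inequality is applied to cosine and sine together, since only the sum of their correlations
    is the cosine of a phase difference. Diagonal pairs contribute O(1/H); the others have a phase
    of degree one less and, by [mean_wavg_corr], one function less. *)
Lemma weyl_wnull d : forall l p, (l < d)%N -> weyl d p -> wnull l (fun n => cyc (p n)).
Proof.
elim: d => // -[_|d IH] l p ld.
  move: ld; rewrite ltnS leqn0 => /eqP ->[a [b [ia pE]]].
  by rewrite (_ : (fun n => cyc (p n)) = (fun n => cyc (n%:R * a + b)));
    [exact: wnull_linear | apply/funext => n; rewrite pE].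
move=> pw eps eps0.
(* With N >= H^2 the boundary term is at most 16 / H^2 <= eps / 2, the diagonal gives 2 / H <= eps /
   16, and the other pairs give 2 e = eps / 8. *)
pose H := (Num.truncn (32 / eps)).+1.
have H0 : 0 < H%:R :> R by rewrite ltr0n.
have Heps : 32 / eps < H%:R by apply: truncnS_gt.
pose e := eps / 16.
have e0 : 0 < e by rewrite /e; lra.
have /choice[N0 N0P] : forall hh : nat * nat, exists N0, hh.1 != hh.2 ->
   forall N, (N0 <= N)%N -> forall (S : finsys R) (f : nat -> S -> R), bounded1 f ->
   mean (fun x => wavg (@fT _ S) l.-1 f (fun n => cyc (p (n + hh.1)%N - p (n + hh.2)%N)) N x ^+ 2)
   <= e ^+ 2.
  move=> [h h']; have [->|hh] := eqVneq h h'; first by exists 0%N => /eqP [].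
  have [||N0 HN0] := IH l.-1 (fun n => p (n + h)%N - p (n + h')%N) _ (pw h h' hh) (e ^+ 2) _.
  - by case: l ld.
  - by rewrite exprn_gt0.
  by exists N0 => _.
exists (maxn (\max_(hh : 'I_H * 'I_H) N0 (hh.1 : nat, hh.2 : nat)) (H * H)) => N NN S f f1.
have HN : (0 < H <= N)%N by rewrite /H /= ; apply: leq_trans (leq_trans (leq_maxr _ _) NN); rewrite leq_pmulr.
have N0' : 0 < N%:R :> R by rewrite ltr0n; case/andP: HN => a b; apply: leq_trans b.
pose F n x := term (@fT _ S) l f n x.
have F1 n x : `|F n x| <= 1 by apply: term_bound.
pose g h h' i y := f i (iter (i.+1 * h) (@fT _ S) y) * f i (iter (i.+1 * h') (@fT _ S) y).
have g1 h h' : bounded1 (g h h').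
  by move=> i x; rewrite normrM mulr_ile1 ?normr_ge0 ?f1.
have corE h h' x : N%:R^-1 * \sum_(n < N)
     (cyc (p (n + h)%N) * F (n + h)%N x) * (cyc (p (n + h')%N) * F (n + h')%N x) +
   N%:R^-1 * \sum_(n < N)
     (syc (p (n + h)%N) * F (n + h)%N x) * (syc (p (n + h')%N) * F (n + h')%N x) =
   wavg (@fT _ S) l (g h h') (fun n => cyc (p (n + h)%N - p (n + h')%N)) N x.
  rewrite -mulrDr -big_split /=; congr (_ * _); apply: eq_bigr => n _.
  rewrite cycB -term_mul -!term_shift_fun /F; ring.
have key x : wavg (@fT _ S) l f (fun n => cyc (p n)) N x ^+ 2 <=
   (H%:R ^- 2 * \sum_(h < H) \sum_(h' < H)
     wavg (@fT _ S) l (g h h') (fun n => cyc (p (n + h)%N - p (n + h')%N)) N x) *+ 2 +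
   (H%:R / N%:R) ^+ 2 * 16.
  have c1 n : `|cyc (p n) * F n x| <= 1 by rewrite normrM mulr_ile1 ?normr_ge0 ?cyc_le1.
  have s1 n : `|syc (p n) * F n x| <= 1 by rewrite normrM mulr_ile1 ?normr_ge0 ?syc_le1.
  have := vdc_pointwise c1 HN; have := vdc_pointwise s1 HN.
  have -> : \sum_(h < H) \sum_(h' < H)
     wavg (@fT _ S) l (g h h') (fun n => cyc (p (n + h)%N - p (n + h')%N)) N x =
   \sum_(h < H) \sum_(h' < H) (N%:R^-1 * \sum_(n < N)
     (cyc (p (n + h)%N) * F (n + h)%N x) * (cyc (p (n + h')%N) * F (n + h')%N x)) +
   \sum_(h < H) \sum_(h' < H) (N%:R^-1 * \sum_(n < N)
     (syc (p (n + h)%N) * F (n + h)%N x) * (syc (p (n + h')%N) * F (n + h')%N x)).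
    rewrite -big_split; apply: eq_bigr => h _; rewrite -big_split; apply: eq_bigr => h' _.
    by rewrite /= corE.
  rewrite -/(wavg (@fT _ S) l f (fun n => cyc (p n)) N x).
  rewrite [H%:R ^- 2 * (_ + _)]mulrDr; set X := H%:R ^- 2 * _; set Y := H%:R ^- 2 * _.
  set Z := N%:R^-1 * _; set q := (_ / _) ^+ 2.
  set W := wavg _ _ _ _ _ _; move=> h1 h2; have := sqr_ge0 Z.
  move: h1 h2; lra.
apply: le_trans (le_mean key) _; rewrite meanD.
have m1 : mean (fun x : S => (H%:R / N%:R) ^+ 2 * 16) <= eps / 2.
  apply: mean_le; first lra. move=> _.
  have HH : H%:R / N%:R <= H%:R^-1 :> R.
    rewrite ler_pdivrMr // mulrC ler_pdivlMr // -natrM ler_nat.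
    by apply: leq_trans NN; apply: leq_maxr.
  have H1 : H%:R^-1 <= 1 :> R by rewrite invf_le1 // ler1n.
  have H2 : H%:R^-1 <= eps / 32.
    by rewrite -[leRHS]invrK lef_pV2 ?posrE ?invr_gt0 ?divr_gt0 // invf_div ltW.
  have H3 : 0 <= H%:R / N%:R :> R by rewrite divr_ge0 // ltW.
  nra.
have m2 : mean (fun x : S => (H%:R ^- 2 * \sum_(h < H) \sum_(h' < H)
     wavg (@fT _ S) l (g h h') (fun n => cyc (p (n + h)%N - p (n + h')%N)) N x) *+ 2) <= eps / 2.
  rewrite (@mean_eq _ _ _ (fun x => (H%:R ^- 2 * 2) * \sum_(h < H) \sum_(h' < H)
     wavg (@fT _ S) l (g h h') (fun n => cyc (p (n + h)%N - p (n + h')%N)) N x)); last first.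
    by move=> x; rewrite -[LHS]mulr_natr mulrAC.
  have S1 (h h' : 'I_H) : mean (fun x => wavg (@fT _ S) l (g h h')
      (fun n => cyc (p (n + h)%N - p (n + h')%N)) N x) <= (h == h')%:R + e.
    have [<-|hh] := eqVneq h h'.
      apply: (@le_trans _ _ 1); last by rewrite lerDl ltW.
      apply: mean_le => // x; apply: le_trans (ler_norm _) _.
      apply: (@mean_bound _ N (fun n => cyc (p (n + h)%N - p (n + h)%N) *
         term (@fT _ S) l (g h h) n x)) => // n _.
      by rewrite normrM mulr_ile1 ?normr_ge0 ?cyc_le1 ?term_bound.
    rewrite add0r; apply: mean_wavg_corr; [exact: ltW | exact: g1 |] => g' g'1.
    apply: (N0P (h : nat, h' : nat)) => //=.
    apply: leq_trans NN; apply: leq_trans (leq_maxl _ _).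
    exact: (leq_bigmax (h, h')).
  have S2 (h : 'I_H) : \sum_(h' < H) ((h == h')%:R + e) = 1 + e *+ H.
    rewrite big_split /= sumr_const card_ord (bigD1 h) //= eqxx big1 ?addr0 // => i ih.
    by rewrite eq_sym (negPf ih).
  rewrite meanZ mean_sum.
  apply: (@le_trans _ _ (H%:R ^- 2 * 2 * \sum_(h < H) \sum_(h' < H) ((h == h')%:R + e))).
    rewrite ler_wpM2l ?mulr_ge0 ?invr_ge0 ?exprn_ge0 //.
    apply: ler_sum => h _; rewrite mean_sum; apply: ler_sum => h' _; exact: S1.
  rewrite (eq_bigr _ (fun h _ => S2 h)) sumr_const card_ord.
  have -> : H%:R ^- 2 * 2 * ((1 + e *+ H) *+ H) = 2 * (H%:R^-1 + e).
    by rewrite -[e *+ H]mulr_natr -[_ *+ H in LHS]mulr_natr; field; rewrite lt0r_neq0.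
  have H2 : H%:R^-1 <= eps / 32.
    by rewrite -[leRHS]invrK lef_pV2 ?posrE ?invr_gt0 ?divr_gt0 // invf_div ltW.
  rewrite /e; lra.
lra.
Qed.

(** Taylor expansion at x: the terms of order 0 cancel, and among the others only the first
    derivative reaches degree d, with coefficient (d + 1) times that of P in degree d + 1. *)
Lemma poly_shift_diff d (P : {poly R}) (h h' : R) : (size P <= d.+2)%N ->
  exists Q : {poly R}, [/\ (size Q <= d.+1)%N,
    Q`_d = P`_d.+1 * d.+1%:R * (h - h') &
    forall x, Q.[x] = P.[x + h] - P.[x + h']].
Proof.
move=> sP; exists (\sum_(i < d.+1) (h ^+ i.+1 - h' ^+ i.+1) *: P^`N(i.+1)); split.
- apply/leq_sizeP => j dj; rewrite coef_sum big1 // => i _.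
  rewrite coefZ coef_nderivn nth_default ?mul0rn ?mulr0 //.
  by apply: leq_trans sP _; lia.
- rewrite coef_sum big_ord_recl big1 => [|i _]; last first.
    rewrite coefZ coef_nderivn nth_default ?mul0rn ?mulr0 //.
    by apply: leq_trans sP _; rewrite /= /bump; lia.
  by rewrite addr0 coefZ coef_nderivn /= add1n bin1 !expr1 -mulr_natr; ring.
- move=> x; rewrite !(@nderiv_taylor_wide _ d.+2 P x) //; try exact: mulrC.
  rewrite [X in _ = X - _]big_ord_recl [X in _ = _ - X]big_ord_recl /=.
  rewrite !expr0 !mulr1 opprD addrACA subrr add0r -sumrB horner_sum.
  by apply: eq_bigr => i _; rewrite hornerZ /bump /= add1n; ring.
Qed.

(** Each difference multiplies the leading coefficient by a nonzero integer, which keeps it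
    irrational. *)
Lemma weyl_poly d (P : {poly R}) : (size P <= d.+2)%N -> irrational P`_d.+1 ->
  weyl d.+1 (fun n => P.[n%:R]).
Proof.
elim: d P => [|d IH] P sP iP.
  exists P`_1, P`_0; split=> // n.
  rewrite (horner_coef_wide _ sP) !big_ord_recr big_ord0 /=.
  by rewrite add0r expr0 expr1 mulr1 addrC mulrC.
move=> h h' hh; have [Q [sQ QE QP]] := poly_shift_diff h%:R h'%:R sP.
rewrite (_ : (fun n => _) = (fun n => Q.[n%:R])).
  apply: IH => //; rewrite QE -mulrA.
  have -> : d.+2%:R * (h%:R - h'%:R) = (d.+2%:Z * (h%:Z - h'%:Z))%:~R :> R.
    by rewrite intrM intrB.
  apply: irrational_mul_int => //; rewrite mulf_neq0 // subr_eq0.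
  by apply: contra hh => /eqP [->].
by apply/funext => n; rewrite QP !natrD.
Qed.

Lemma weyl_monomial k (b c : R) : (0 < k)%N -> irrational b ->
  weyl k (fun n => n%:R ^+ k * b + c).
Proof.
case: k => // k _ ib; apply: (weylDc (p := fun n => n%:R ^+ k.+1 * b)).
rewrite (_ : (fun n => _) = (fun n => (b *: 'X^(k.+1)).[n%:R])).
  apply: weyl_poly; last by rewrite coefZ coefXn eqxx mulr1.
  by apply: leq_trans (size_scale_leq _ _) _; rewrite size_polyXn.
by apply/funext => n; rewrite hornerZ hornerXn mulrC.
Qed.

End VanDerCorput.

(** * Trigonometric approximation of arcs *)

Section Bernstein.
Variable R : realType.

(** De Casteljau's recursion for the Bernstein polynomial, that is, the expectation of [h] at a
    binomial variable with parameters n and u. Positivity and moments follow by induction, without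
    binomial coefficients. *)
Fixpoint bernstein (n : nat) (h : nat -> R) (u : R) : R :=
  if n is n'.+1 then
    (1 - u) * bernstein n' h u + u * bernstein n' (fun i => h i.+1) u
  else h 0%N.

Lemma bernsteinD n h h' u : bernstein n (fun i => h i + h' i) u =
  bernstein n h u + bernstein n h' u.
Proof. by elim: n h h' => //= n IH h h'; rewrite !IH; ring. Qed.

Lemma bernsteinZ n c h u : bernstein n (fun i => c * h i) u = c * bernstein n h u.
Proof. by elim: n h => //= n IH h; rewrite !IH; ring. Qed.

Lemma bernstein_cst n c u : bernstein n (fun=> c) u = c.
Proof. by elim: n => //= n ->; ring. Qed.

Lemma bernstein_ge0 n h u : 0 <= u <= 1 -> (forall i, 0 <= h i) ->
  0 <= bernstein n h u.
Proof.
move=> /andP[u0 u1]; elim: n h => //= n IH h h0.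
by rewrite addr_ge0 ?mulr_ge0 ?IH ?subr_ge0.
Qed.

Lemma le_bernstein n h h' u : 0 <= u <= 1 -> (forall i, h i <= h' i) ->
  bernstein n h u <= bernstein n h' u.
Proof.
move=> u01 hh; rewrite -subr_ge0 -[- _]mulN1r -bernsteinZ -bernsteinD.
by apply: bernstein_ge0 => // i; rewrite mulN1r subr_ge0.
Qed.

Lemma bernstein_id n u : bernstein n (fun i => i%:R) u = n%:R * u.
Proof.
elim: n => [|n IH] /=; first by rewrite mul0r.
rewrite (_ : (fun i => i.+1%:R) = (fun i : nat => i%:R + 1 : R)); last first.
  by apply/funext => i; rewrite natr1.
by rewrite bernsteinD bernstein_cst IH -natr1; ring.
Qed.

Lemma bernstein_sq n u : bernstein n (fun i => i%:R ^+ 2) u =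
  n%:R * u * (1 - u) + (n%:R * u) ^+ 2.
Proof.
elim: n => [|n IH] /=; first by ring.
rewrite (_ : (fun i => i.+1%:R ^+ 2) = (fun i : nat => i%:R ^+ 2 + (2 * i%:R + 1) : R)); last first.
  by apply/funext => i; rewrite -natr1; ring.
by rewrite !bernsteinD bernsteinZ bernstein_cst bernstein_id IH -natr1; ring.
Qed.

(** Chebyshev's argument: L t <= e / 2 + L^2 t^2 / (2 e) bounds the error by a quadratic in i / n -
    u, whose expectation involves only the variance u (1 - u) / n. *)
Lemma bernstein_approx (g : R -> R) (L : R) : 0 < L ->
  (forall x y, `|g x - g y| <= L * `|x - y|) -> forall e, 0 < e ->
  exists n, forall u, 0 <= u <= 1 ->
  `|bernstein n (fun i => g (i%:R / n%:R)) u - g u| <= e.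
Proof.
move=> L0 gL e e0; pose n := (Num.truncn (L ^+ 2 / e ^+ 2)).+1.
exists n => u u01.
have n0 : 0 < n%:R :> R by rewrite ltr0n.
have ng : L ^+ 2 < e ^+ 2 * n%:R.
  by rewrite mulrC -ltr_pdivrMr ?exprn_gt0 //; apply: truncnS_gt.
pose W i := e / 2 + L ^+ 2 / (2 * e) * (i%:R / n%:R - u) ^+ 2.
have gW i : `|g (i%:R / n%:R) - g u| <= W i.
  apply: le_trans (gL _ _) _; rewrite /W -[(_ - u) ^+ 2]real_normK ?num_real //.
  set t := `|_ - u|; have t0 : 0 <= t by apply: normr_ge0.
  have -> : e / 2 + L ^+ 2 / (2 * e) * t ^+ 2 = (e ^+ 2 + (L * t) ^+ 2) / (2 * e).
    by field; rewrite lt0r_neq0.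
  rewrite ler_pdivlMr ?mulr_gt0 //; have := sqr_ge0 (e - L * t); lra.
have BW : bernstein n W u <= e.
  rewrite (_ : W = (fun i => (e / 2 + L ^+ 2 / (2 * e) * u ^+ 2) +
     (L ^+ 2 / (2 * e) * n%:R ^- 2 * i%:R ^+ 2 + (- (2 * u * (L ^+ 2 / (2 * e)) / n%:R)) * i%:R))).
    rewrite bernsteinD bernstein_cst bernsteinD !bernsteinZ bernstein_id bernstein_sq.
    have -> : e / 2 + L ^+ 2 / (2 * e) * u ^+ 2 + (L ^+ 2 / (2 * e) * n%:R ^- 2 *
      (n%:R * u * (1 - u) + (n%:R * u) ^+ 2) + - (2 * u * (L ^+ 2 / (2 * e)) / n%:R) * (n%:R * u))
      = (e ^+ 2 * n%:R + L ^+ 2 * (u * (1 - u))) / (2 * e * n%:R).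
      by field; rewrite !lt0r_neq0.
    rewrite ler_pdivrMr ?mulr_gt0 //.
    have : u * (1 - u) <= 1 by case/andP: u01 => *; nra.
    have : 0 <= u * (1 - u) by case/andP: u01 => *; nra.
    have := sqr_ge0 L; nra.
  by apply/funext => i; rewrite /W; field; rewrite !lt0r_neq0.
have -> : bernstein n (fun i => g (i%:R / n%:R)) u - g u =
   bernstein n (fun i => g (i%:R / n%:R) + - g u) u.
  by rewrite bernsteinD bernstein_cst.
rewrite ler_norml; apply/andP; split.
  rewrite lerNl -mulN1r -bernsteinZ; apply: le_trans BW; apply: le_bernstein => // i.
  by rewrite mulN1r; have /ler_normlP[] := gW i.
apply: le_trans BW; apply: le_bernstein => // i.
by have /ler_normlP[] := gW i.
Qed.

(** Even trigonometric polynomials. Cosines are enough for an arc that has been centred at 0. *)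
Inductive trig : (R -> R) -> Prop :=
| trig_cyc (m : nat) : trig (fun t => cyc (m%:R * t))
| trig_lin a b f g : trig f -> trig g -> trig (fun t => a * f t + b * g t).

Lemma trig_ext f g : f =1 g -> trig f -> trig g.
Proof. by move=> /funext ->. Qed.

Lemma trig_cst c : trig (fun=> c).
Proof.
apply: trig_ext (trig_lin c 0 (trig_cyc 0) (trig_cyc 0)) => t.
by rewrite /cyc mul0r mulr0 cos0; ring.
Qed.

Lemma trig_mul_cyc f : trig f -> trig (fun t => cyc t * f t).
Proof.
elim=> [m|a b g h _ tg _ th]; last first.
  by apply: trig_ext (trig_lin a b tg th) => t; ring.
case: m => [|m].
  by apply: trig_ext (trig_cyc 1) => t; rewrite {3}/cyc !mul1r mul0r mulr0 cos0 mulr1.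
apply: trig_ext (trig_lin (1 / 2) (1 / 2) (trig_cyc m.+2) (trig_cyc m)) => t.
have -> : m.+2%:R * t = m.+1%:R * t + t by rewrite -[in LHS]natr1; ring.
have -> : m%:R * t = m.+1%:R * t - t by rewrite -[in RHS]natr1; ring.
by rewrite /cyc mulrDr mulrBr cosD cosB; lra.
Qed.

(** The substitution u = (1 + cos 2 pi t) / 2 maps the circle into [0, 1], and products with a
    cosine stay within [trig]. *)
Lemma trig_bernstein n h : trig (fun t => bernstein n h ((1 + cyc t) / 2)).
Proof.
elim: n h => [|n IH] h /=; first exact: trig_cst.
have t1 := trig_lin 1 (-1) (IH h) (trig_mul_cyc (IH h)).
have t2 := trig_lin 1 1 (IH (fun i => h i.+1)) (trig_mul_cyc (IH (fun i => h i.+1))).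
apply: trig_ext (trig_lin (1 / 2) (1 / 2) t1 t2) => t.
by field.
Qed.

End Bernstein.

(** * Null weights and mean values of trigonometric polynomials *)

Section Means.
Variable R : realType.

Lemma wnull_lin l a b (c c' : nat -> R) : wnull l c -> wnull l c' ->
  wnull l (fun n => a * c n + b * c' n).
Proof.
move=> nc nc' e e0.
have d0 z : 0 < 4 * (z ^+ 2 + 1) :> R by have := sqr_ge0 z; lra.
have [|N0 H0] := nc (e / (4 * (a ^+ 2 + 1))); first by rewrite divr_gt0.
have [|N1 H1] := nc' (e / (4 * (b ^+ 2 + 1))); first by rewrite divr_gt0.
exists (maxn N0 N1) => N NN S f f1.
have k0 := H0 N (leq_trans (leq_maxl _ _) NN) S f f1.
have k1 := H1 N (leq_trans (leq_maxr _ _) NN) S f f1.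
apply: (@le_trans _ _ (mean (fun x => 2 * a ^+ 2 * wavg (@fT _ S) l f c N x ^+ 2 +
   2 * b ^+ 2 * wavg (@fT _ S) l f c' N x ^+ 2))).
  apply: le_mean => x.
  have -> : wavg (@fT _ S) l f (fun n => a * c n + b * c' n) N x =
     a * wavg (@fT _ S) l f c N x + b * wavg (@fT _ S) l f c' N x.
    rewrite /wavg !(mulrCA _ N%:R^-1) -mulrDr; congr (_ * _).
    by rewrite !mulr_sumr -big_split; apply: eq_bigr => n _ /=; ring.
  set u := wavg _ _ _ _ _ _; set v := wavg _ _ _ _ _ _.
  have := sqr_ge0 (a * u - b * v); lra.
rewrite meanD !meanZ.
move: k0 k1; rewrite !ler_pdivlMr //; set X := mean _; set Y := mean _ => k0 k1.
have X0 : 0 <= X by apply: mean_ge0 => x; apply: sqr_ge0.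
have Y0 : 0 <= Y by apply: mean_ge0 => x; apply: sqr_ge0.
lra.
Qed.

Lemma wnull0 l : wnull l (fun=> 0 : R).
Proof.
move=> e e0; exists 0%N => N _ S f f1.
apply: mean_le; first exact: ltW.
by move=> x; rewrite /wavg big1 ?mulr0 ?expr0n ?ltW // => i _; rewrite mul0r.
Qed.

(** The telescoping of [sum_cyc_linear] with a = m / Q: periodicity makes the end terms equal, and 0
    < m < Q keeps sin(pi a) nonzero. *)
Lemma sum_cyc_rational (m Q : nat) : (0 < m < Q)%N ->
  \sum_(q < Q) cyc (m%:R * (q%:R / Q%:R)) = 0 :> R.
Proof.
move=> /andP[m0 mQ]; pose a : R := m%:R / Q%:R.
have Q0' : (0 < Q)%N by apply: leq_trans mQ.
have Q0 : 0 < Q%:R :> R by rewrite ltr0n.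
have sa : sin (pi * a) != 0.
  rewrite gt_eqF // sin_gt0_pi // mulr_gt0 ?pi_gt0 ?divr_gt0 ?ltr0n //=.
  by rewrite gtr_pMr ?pi_gt0 // ltr_pdivrMr // mul1r ltr_nat.
pose t n := sin (pi *+ 2 * (n%:R * a) - pi * a).
have E : (2 * sin (pi * a)) * \sum_(q < Q) cyc (m%:R * (q%:R / Q%:R)) = t Q - t 0%N.
  rewrite mulr_sumr -(big_mkord xpredT (fun q => 2 * sin (pi * a) * cyc (m%:R * (q%:R / Q%:R)))).
  rewrite -(telescope_sumr t) //; apply: eq_bigr => n _.
  rewrite /t /cyc.
  have -> : pi *+ 2 * (n.+1%:R * a) - pi * a =
     pi *+ 2 * (n%:R * a) + pi * a by rewrite -natr1; ring.
  have -> : m%:R * (n%:R / Q%:R) = n%:R * a by rewrite /a; ring.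
  by rewrite sinD sinB; ring.
have tQ : t Q = t 0%N.
  rewrite /t mul0r mulr0 add0r (_ : Q%:R * a = m%:R); last by rewrite /a; field; rewrite lt0r_neq0.
  by rewrite addrC mulr_natr (periodicn (@sinD2pi R)).
move: E; rewrite tQ subrr => /eqP; rewrite !mulf_eq0 (negPf sa) pnatr_eq0 /=.
by move/eqP.
Qed.

(* [c0] is the mean of [f] over the circle, computed on fine equidistant grids. *)
Lemma trig_mean k (alpha c : R) (f : R -> R) : (0 < k)%N -> irrational alpha ->
  trig f -> exists c0,
  (forall l, (l < k)%N -> wnull l (fun n => f (n%:R ^+ k * alpha - c) - c0)) /\
  exists Q0, forall Q, (Q0 <= Q)%N -> \sum_(q < Q) f (q%:R / Q%:R) = Q%:R * c0.
Proof.
move=> k0 ia; elim=> [m|a b g h _ [cg [wg [Qg Hg]]] _ [ch [wh [Qh Hh]]]]; last first.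
  exists (a * cg + b * ch); split.
    move=> l lk; have := wnull_lin a b (wg l lk) (wh l lk).
    by congr (wnull l _); apply/funext => n; ring.
  exists (maxn Qg Qh) => Q; rewrite geq_max => /andP[q1 q2].
  by rewrite big_split /= -!mulr_sumr Hg // Hh //; ring.
case: m => [|m].
  have c1 t : cyc (0%:R * t) = 1 :> R by rewrite /cyc mul0r mulr0 cos0.
  exists 1; split.
    move=> l lk; rewrite (_ : (fun n => _) = (fun=> 0)); first exact: wnull0.
    by apply/funext => n; rewrite c1 subrr.
  exists 0%N => Q _; rewrite (eq_bigr (fun=> 1)) => [|q _]; last exact: c1.
  by rewrite sumr_const card_ord mulr1.
exists 0; split.
  move=> l lk; rewrite (_ : (fun n => _ - 0) =
     (fun n => cyc (n%:R ^+ k * (alpha * m.+1%:Z%:~R) + - (m.+1%:R * c)))).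
    by apply: (weyl_wnull lk); apply: weyl_monomial => //; apply: irrational_mul_int.
  by apply/funext => n; rewrite /cyc subr0; congr cos; rewrite -pmulrn; ring.
by exists m.+2 => Q mQ; rewrite mulr0; apply: sum_cyc_rational.
Qed.

End Means.

(** * Arcs, their smoothing and their mass on grids *)

Section Arcs.
Variable R : realType.
Implicit Types x y t : R.

Lemma cycN t : cyc (- t) = cyc t.
Proof. by rewrite /cyc mulrN cosN. Qed.

Lemma cyc_sym t : cyc (1 - t) = cyc t.
Proof. by rewrite addrC -[1]/(1%:R) cycDnat cycN. Qed.

Lemma lt_cyc x y : 0 <= x <= 1 / 2 -> 0 <= y <= 1 / 2 -> (cyc x < cyc y) = (y < x).
Proof.
move=> hx hy; have p2 : 0 < pi *+ 2 :> R by rewrite mulrn_wgt0 ?pi_gt0.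
have inP (z : R) : 0 <= z <= 1 / 2 -> (pi *+ 2 * z \in `[0, pi]).
  move=> /andP[z0 z1]; rewrite in_itv /= mulr_ge0 ?(ltW p2) //=.
  by rewrite mulrnAl -mulr_natr -mulrA ler_piMr ?pi_ge0 //; lra.
by rewrite /cyc (ltr_cos (inP _ hy) (inP _ hx)) ltr_pM2l.
Qed.

Lemma le_cyc x y : 0 <= x <= 1 / 2 -> 0 <= y <= 1 / 2 -> (cyc x <= cyc y) = (y <= x).
Proof. by move=> hx hy; rewrite !leNgt lt_cyc. Qed.

(** The closed arc of length 1/10 about 0, written as a condition on [cyc t] alone so that it can be
    approximated by polynomials in the cosine. *)
Definition arc t : bool := cyc (1 / 20) <= cyc t.

(** The bounds on c prevent wrapping: the distance s from the fractional part to c is below 19/20,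
    so that s > 1/2 leaves 1 - s > 1/20, outside the arc. *)
Lemma arcE (y c : R) : 1 / 20 <= c < 19 / 20 ->
  arc (y - c) = (c - 1 / 20 <= y - (Num.floor y)%:~R <= c + 1 / 20).
Proof.
move=> /andP[c0 c1]; set f := y - (Num.floor y)%:~R.
have f0 : 0 <= f by rewrite /f subr_ge0 floor_le_tmp.
have f1 : f < 1 by rewrite /f ltrBlDl; have := floorD1_gt y; rewrite intrD; lra.
have -> : y - c = (f - c) + (Num.floor y)%:~R by rewrite /f; ring.
rewrite /arc cycDint.
have [s [s0 s1 -> ->]] : exists s, [/\ 0 <= s, s < 19 / 20, cyc (f - c) = cyc s &
    (c - 1 / 20 <= f <= c + 1 / 20) = (s <= 1 / 20)].
  have [fc|fc] := leP c f.
    exists (f - c); split => //; [lra|lra|].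
    by apply/andP/idP => [[]|]; [lra|split; lra].
  exists (c - f); split; [lra|lra|by rewrite -cycN opprB|].
  by apply/andP/idP => [[]|]; [lra|split; lra].
have [s2|s2] := leP s (1 / 2); first by rewrite le_cyc //; lra.
rewrite -(cyc_sym s) le_cyc; [|lra|lra].
by apply/idP/idP; lra.
Qed.

Lemma sum_interval (a b Q : nat) : (a <= b)%N -> (b <= Q)%N ->
  \sum_(q < Q) (a <= q < b)%:R = (b - a)%:R :> R.
Proof.
move=> ab bQ; rewrite -natr_sum; congr (_%:R).
have H n : (\sum_(q < n) (a <= q < b) = minn n b - a)%N.
  elim: n => [|n IH]; first by rewrite big_ord0; lia.
  by rewrite big_ord_recr /= IH; lia.
by have := H Q; rewrite (minn_idPr bQ).
Qed.

(** Truncation to [0, 1]; in this form the Lipschitz bound is the triangle inequality. *)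
Definition clamp x : R := (`|x| - `|x - 1| + 1) / 2.

Lemma clamp_lip x y : `|clamp x - clamp y| <= `|x - y|.
Proof.
have h1 := ler_dist_dist x y; have h2 := ler_dist_dist (x - 1) (y - 1).
move: h1 h2; rewrite (_ : x - 1 - (y - 1) = x - y) /clamp; last by ring.
rewrite !ler_norml => /andP[a1 a2] /andP[a3 a4]; apply/andP; split; lra.
Qed.

Lemma clamp01 x : 0 <= clamp x <= 1.
Proof.
have := ler_dist_dist x (x - 1).
rewrite (_ : x - (x - 1) = 1) ?normr1 /clamp; last by ring.
by rewrite ler_norml => /andP[a1 a2]; apply/andP; split; lra.
Qed.

Lemma clamp_le0 x : x <= 0 -> clamp x = 0.
Proof. by move=> x0; rewrite /clamp !ler0_norm; lra. Qed.

Lemma clamp_ge1 x : 1 <= x -> clamp x = 1.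
Proof. by move=> x0; rewrite /clamp !ger0_norm; lra. Qed.

Lemma trig_clamp (b d e : R) : 0 < d -> 0 < e ->
  exists2 f, trig f & forall t, `|f t - clamp ((cyc t - b) / d)| <= e.
Proof.
move=> d0 e0; pose g u := clamp ((2 * u - 1 - b) / d).
have L0 : 0 < 2 / d by rewrite divr_gt0.
have gL x y : `|g x - g y| <= 2 / d * `|x - y|.
  apply: le_trans (clamp_lip _ _) _; rewrite -[2 / d]gtr0_norm // -normrM.
  rewrite (_ : _ - _ = 2 / d * (x - y)) //; field; exact: lt0r_neq0.
have [n Hn] := bernstein_approx L0 gL e0.
exists (fun t => bernstein n (fun i => g (i%:R / n%:R)) ((1 + cyc t) / 2)).
  exact: trig_bernstein.
move=> t; have /ler_normlP[c1 c2] := cyc_le1 t.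
have := Hn ((1 + cyc t) / 2).
have -> : g ((1 + cyc t) / 2) = clamp ((cyc t - b) / d).
  by rewrite /g; congr (clamp (_ / _)); lra.
by apply; lra.
Qed.

Section grid.
Variables r s : nat.
Hypotheses (r2 : (2 <= r)%N) (s1 : (0 < s)%N).
Let Q := (20 * r * s)%N.

Lemma grid_half q : (q < Q)%N -> exists2 m, (m * 2 <= Q)%N & (m = q \/ m = Q - q)%N /\
  cyc (q%:R / Q%:R) = cyc (m%:R / Q%:R) :> R.
Proof.
move=> qQ; have Q0 : 0 < Q%:R :> R by rewrite ltr0n; lia.
have [qh|qh] := leqP (q * 2) Q; first by exists q => //; split => //; left.
exists (Q - q)%N; first lia; split; first by right.
rewrite -cyc_sym natrB 1?ltnW //; congr cyc; field; exact: lt0r_neq0.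
Qed.

Lemma grid_itv m : (m * 2 <= Q)%N -> 0 <= (m%:R / Q%:R : R) <= 1 / 2.
Proof.
move=> mQ; rewrite divr_ge0 //=.
have [->|Q0] := posnP Q; first by rewrite invr0 mulr0; lra.
by rewrite ler_pdivrMr ?ltr0n // mulrC mul1r ler_pdivlMr // -natrM ler_nat.
Qed.

(** Q = 20 r s places the end 1/20 on the grid point r s. Both ends belong to the closed arc, whence
    one point more than Q / 10. *)
Lemma sum_arc : \sum_(q < Q) (arc (q%:R / Q%:R))%:R = (2 * r * s + 1)%:R :> R.
Proof.
have Q0 : 0 < Q%:R :> R by rewrite ltr0n /Q; lia.
rewrite (eq_bigr (fun q : 'I_Q => (0 <= q < r * s + 1)%:R + (19 * r * s <= q < Q)%:R)).
  rewrite big_split (@sum_interval 0 _ _) ?(@sum_interval (19 * r * s) _ _) /Q; try lia.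
  by rewrite /= -natrD; congr (_%:R); lia.
move=> q _; have qQ := ltn_ord q.
have [m mQ [mq ->]] : exists2 m, (m * 2 <= Q)%N & (m = q \/ m = Q - q)%N /\
  arc (q%:R / Q%:R) = (m <= r * s)%N.
  have [m mQ [mq E]] := grid_half qQ; exists m => //; split=> //.
  rewrite /arc E le_cyc ?grid_itv //; last by lra.
  rewrite ler_pdivrMr //.
  have -> : 1 / 20 * Q%:R = (r * s)%:R :> R by rewrite /Q !natrM; field.
  by rewrite ler_nat.
rewrite -natrD; congr (_%:R); move: mq mQ qQ; rewrite /Q.
case: leqP; case: ltnP; case: leqP => /=; lia.
Qed.

(** Counts the grid points at distance less than 1/(20 r) from the ends of the arc: at most 2 s + 1
    at each end, and 4 s + 2 <= 6 s. *)
Lemma sum_boundary : \sum_(q < Q)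
   (@cyc R ((r + 1)%:R / (20 * r)%:R) < @cyc R (q%:R / Q%:R) < @cyc R ((r - 1)%:R / (20 * r)%:R))%R%:R
   <= (6 * s)%:R :> R.
Proof.
have Q0 : 0 < Q%:R :> R by rewrite ltr0n /Q; lia.
apply: (@le_trans _ _ (\sum_(q < Q) ((s * (r - 1) <= q < s * (r + 1) + 1)%:R +
    (Q - s * (r + 1) <= q < Q - s * (r - 1) + 1)%:R))); last first.
  rewrite big_split /= !sum_interval /Q; try nia.
  by rewrite -natrD ler_nat; nia.
apply: ler_sum => q _; have qQ := ltn_ord q.
have [m mQ [mq E]] := grid_half qQ; rewrite E.
have e1 : (r + 1)%:R / (20 * r)%:R = (s * (r + 1))%:R / Q%:R :> R.
  by rewrite /Q !natrM; field; rewrite !pnatr_eq0; lia.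
have e2 : (r - 1)%:R / (20 * r)%:R = (s * (r - 1))%:R / Q%:R :> R.
  by rewrite /Q !natrM; field; rewrite !pnatr_eq0; lia.
rewrite e1 e2 !lt_cyc ?grid_itv //; try by rewrite /Q; nia.
rewrite !ltr_pM2r ?invr_gt0 // !ltr_nat -natrD ler_nat.
case: (ltnP m _) => /=; case: (ltnP (s * (r - 1)) m) => /= *; try lia.
Qed.

End grid.

End Arcs.

(** * The centred indicator of an arc is a null weight *)

Section OnePoint.
Variable R : realType.

Lemma onept_ge0 (x : unit) : 0 <= 1 :> R. Proof. by []. Qed.
Lemma onept_sum : \sum_(x : unit) 1 <= 1 :> R.
Proof. by rewrite sumr_const card_unit. Qed.
Lemma onept_K : cancel (@id unit) id. Proof. by []. Qed.

Definition onept := FinSys onept_ge0 onept_sum onept_K onept_K (fun=> erefl).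

Lemma wnull_scalar (l : nat) (c : nat -> R) : wnull l c -> forall e, 0 < e ->
  exists N0, forall N, (N0 <= N)%N -> `|N%:R^-1 * \sum_(n < N) c n| <= e.
Proof.
move=> wc e e0; have [|N0 H] := wc (e ^+ 2) _; first by rewrite exprn_gt0.
have b1 : bounded1 (fun (_ : nat) (_ : unit) => 1 : R) by move=> i x; rewrite normr1.
exists N0 => N NN; have := H N NN onept _ b1.
rewrite /mean (bigD1 tt) //= big1 ?addr0 ?mul1r; last by case.
have -> : wavg id l (fun _ _ => 1) c N tt = N%:R^-1 * \sum_(n < N) c n.
  by rewrite /wavg; congr (_ * _); apply: eq_bigr => n _; rewrite /term big1 ?mulr1.
by rewrite -[X in X <= _]real_normK ?num_real // ler_sqr ?nnegrE // ltW.
Qed.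

(** The approximation has to be good only on average: [E] may be of order 1 near the ends of an arc,
    provided that its averages tend to a small [d]; then [chi] and [phi] have averages within 2 e of
    each other, whatever the functions. *)
Lemma wnull_sandwich l (chi : nat -> R) :
  (forall e, 0 < e -> exists phi E d, [/\ wnull l phi, wnull 0 (fun n => E n - d),
     d <= e & forall n, `|chi n - phi n| <= E n]) -> wnull l chi.
Proof.
move=> H eps eps0; pose e := Num.min 1 eps / 4.
have m0 : 0 < Num.min 1 eps by rewrite lt_min ltr01.
have e0 : 0 < e by rewrite /e; lra.
have e2 : 8 * e ^+ 2 <= eps / 2.
  have : Num.min 1 eps <= 1 by rewrite ge_min lexx.
  have : Num.min 1 eps <= eps by rewrite ge_min lexx orbT.
  move: m0; rewrite /e; set m := Num.min _ _; nra.
have [phi [E [d [wphi wE de HE]]]] := H e e0.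
have [|N0 H0] := wphi (eps / 4); first by lra.
have [N1 H1] := wnull_scalar wE e0.
exists (maxn 1 (maxn N0 N1)) => N NN S f f1.
have N0' : 0 < N%:R :> R by rewrite ltr0n; lia.
have NN0 : (N0 <= N)%N by lia.
have NN1 : (N1 <= N)%N by lia.
have hE : N%:R^-1 * \sum_(n < N) E n <= 2 * e.
  have /ler_normlP[_] := H1 N NN1; rewrite sumrB sumr_const card_ord -[d *+ N]mulr_natr.
  have -> : N%:R^-1 * (\sum_(n < N) E n - d * N%:R) = N%:R^-1 * \sum_(n < N) E n - d.
    by field; exact: lt0r_neq0.
  set X := N%:R^-1 * _; lra.
have pw x : wavg (@fT _ S) l f chi N x ^+ 2 <=
    2 * wavg (@fT _ S) l f phi N x ^+ 2 + 8 * e ^+ 2.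
  have : `|wavg (@fT _ S) l f chi N x - wavg (@fT _ S) l f phi N x| <= 2 * e.
    apply: le_trans hE; rewrite /wavg -mulrBr -sumrB normrM gtr0_norm ?invr_gt0 //.
    rewrite ler_wpM2l ?invr_ge0 ?(ltW N0') //; apply: le_trans (ler_norm_sum _ _ _) _.
    apply: ler_sum => n _; rewrite -mulrBl normrM -[leRHS]mulr1.
    by rewrite ler_pM ?term_bound.
  move=> /ler_normlP[]; set a := wavg _ _ _ _ _ _; set b := wavg _ _ _ _ _ _ => h1 h2.
  have : (a - b) ^+ 2 <= 4 * e ^+ 2 by nra.
  have := sqr_ge0 (a - b - b); lra.
apply: le_trans (le_mean pw) _; rewrite meanD meanZ.
have := H0 N NN0 S f f1; have : mean (fun _ : S => 8 * e ^+ 2) <= 8 * e ^+ 2.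
  by apply: mean_const_le; rewrite mulr_ge0 ?sqr_ge0.
set X := mean _; set Y := mean _; lra.
Qed.

(** [flo] and [fhi] approximate ramps in the cosine lying below and above the arc. The first bound
    makes the error a trigonometric polynomial, whose averages along the phase are known; the other
    two confine it to the ends of the arc, whose mass on the grid is known. *)
Lemma arc_sandwich (r : nat) (e : R) : (2 <= r)%N -> 0 < e ->
  exists flo fhi, [/\ trig flo, trig fhi, forall t, `|(arc t)%:R - flo t| <= fhi t - flo t + 3 * e,
   forall t, `|(arc t)%:R - flo t| <=
     e + (@cyc R ((r + 1)%:R / (20 * r)%:R) < cyc t < @cyc R ((r - 1)%:R / (20 * r)%:R))%R%:R &
   forall t, fhi t - flo t <=
     2 * e + (@cyc R ((r + 1)%:R / (20 * r)%:R) < cyc t < @cyc R ((r - 1)%:R / (20 * r)%:R))%R%:R].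
Proof.
move=> r2 e0; set y1 := cyc (_ / _); set y2 := cyc (_ / _); pose y0 : R := cyc (1 / 20).
have r0 : 2 <= r%:R :> R by rewrite ler_nat.
have b1 : (r + 1)%:R / (20 * r)%:R <= 3 / 40 :> R.
  by rewrite ler_pdivrMr ?natrM ?natrD; lra.
have b2 : 1 / 20 < (r + 1)%:R / (20 * r)%:R :> R.
  by rewrite ltr_pdivlMr ?natrM ?natrD; lra.
have b3 : (r - 1)%:R / (20 * r)%:R < 1 / 20 :> R.
  have rb : (r - 1)%:R = r%:R - 1 :> R by rewrite natrB // ltnW.
  by rewrite rb ltr_pdivrMr ?natrM; lra.
have b4 : 0 <= (r - 1)%:R / (20 * r)%:R :> R by rewrite divr_ge0.
have y10 : y1 < y0 by rewrite lt_cyc //; lra.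
have y02 : y0 < y2 by rewrite lt_cyc //; lra.
pose d := Num.min (y0 - y1) (y2 - y0).
have d0 : 0 < d by rewrite lt_min !subr_gt0 y10.
have d1 : d <= y0 - y1 by rewrite ge_min lexx.
have d2 : d <= y2 - y0 by rewrite ge_min lexx orbT.
have [flo tlo Hlo] := trig_clamp y0 d0 e0.
have [fhi thi Hhi] := trig_clamp (y0 - d) d0 e0.
exists flo, fhi.
pose glo t := clamp ((cyc t - y0) / d); pose ghi t := clamp ((cyc t - (y0 - d)) / d).
have gA t : glo t <= (arc t)%:R <= ghi t.
  have /andP[l0 l1] := clamp01 ((cyc t - y0) / d).
  have /andP[h0 h1] := clamp01 ((cyc t - (y0 - d)) / d).
  rewrite /arc -/y0; case: (leP y0 (cyc t)) => ct /=; rewrite ?mulr1n ?mulr0n /glo /ghi.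
    rewrite l1 (@clamp_ge1 _ (_ / _)) ?lexx // ler_pdivlMr // mul1r; lra.
  rewrite h0 andbT clamp_le0 //; rewrite ler_pdivrMr // mul0r; lra.
have gB t : ghi t - glo t <= (y1 < cyc t < y2)%R%:R.
  have /andP[l0 l1] := clamp01 ((cyc t - y0) / d).
  have /andP[h0 h1] := clamp01 ((cyc t - (y0 - d)) / d).
  case: (ltP y1 (cyc t)) => c1 /=; last first.
    rewrite /ghi clamp_le0 ?sub0r ?oppr_le0 //; rewrite ler_pdivrMr // mul0r; lra.
  case: (ltP (cyc t) y2) => c2 /=; first by rewrite /ghi /glo; lra.
  rewrite /glo clamp_ge1; first by rewrite /ghi; lra.
  rewrite ler_pdivlMr // mul1r; lra.
have F t : [/\ flo t - glo t <= e, glo t - flo t <= e, fhi t - ghi t <= e &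
    ghi t - fhi t <= e].
  have /ler_normlP[] := Hlo t; have /ler_normlP[] := Hhi t; rewrite -/(glo t) -/(ghi t).
  by split; lra.
split => // t; have [f1 f2 f3 f4] := F t; have /andP[a1 a2] := gA t; have := gB t.
- by move=> a3; apply/ler_normlP; split; lra.
- by move=> a3; apply/ler_normlP; split; lra.
- by move=> a3; lra.
Qed.

(** The mean [clo] of the lower approximation is accessible only through grid sums; comparing them
    with [sum_arc] and [sum_boundary] shows that it is close to 1/10. *)
Lemma arc_wnull k (alpha c : R) l : irrational alpha -> (l < k)%N ->
  wnull l (fun n => (arc (n%:R ^+ k * alpha - c))%:R - 1 / 10 : R).
Proof.
move=> ia lk; have k0 : (0 < k)%N by apply: leq_trans lk.
apply: wnull_sandwich => e' e'0; pose e := e' / 20.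
have e0 : 0 < e by rewrite /e; lra.
pose r := (Num.truncn (20 / e')).+2.
have r0 : 0 < r%:R :> R by [].
have re : 1 / r%:R <= e' / 20.
  have rr : 20 < r%:R * e'.
    rewrite -ltr_pdivrMr //; apply: lt_le_trans (truncnS_gt _) _.
    by rewrite ler_nat.
  by rewrite ler_pdivrMr //; lra.
have [flo [fhi [tlo thi H1 H2 H3]]] := arc_sandwich (r := r) isT e0.
have [clo [wlo [Qlo Mlo]]] := trig_mean c k0 ia tlo.
have [chi [whi [Qhi Mhi]]] := trig_mean c k0 ia thi.
(* [r] determines the approximations and these determine [Qlo] and [Qhi]; only afterwards can [s]
   make the grid fine enough. *)
pose s := (Qlo + Qhi).+1; pose Q := (20 * r * s)%N.
have Q0 : 0 < Q%:R :> R by rewrite ltr0n /Q /s; lia.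
have qlo : (Qlo <= Q)%N by rewrite /Q /s; nia.
have qhi : (Qhi <= Q)%N by rewrite /Q /s; nia.
have r2 : (2 <= r)%N by [].
have s1 : (0 < s)%N by [].
have sA := @sum_arc R r s r2 s1.
have sB := @sum_boundary R r s r2 s1.
have s0 : 1 <= s%:R :> R by rewrite ler1n.
have QE : Q%:R = 20 * r%:R * s%:R :> R by rewrite !natrM.
set B := \sum_(q < _) _ in sB.
have m1 : Q%:R * `|clo - 1 / 10| <= Q%:R * e + 7 * s%:R.
  have -> : Q%:R * `|clo - 1 / 10| = `|\sum_(q < Q) (flo (q%:R / Q%:R) - (arc (q%:R / Q%:R : R))%:R) + 1|.
    rewrite sumrB Mlo // sA -[in LHS](gtr0_norm Q0) -normrM QE; congr (`| _ |).
    by rewrite natrD !natrM; field.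
  apply: le_trans (ler_normD _ _) _; rewrite normr1.
  have : `|\sum_(q < Q) (flo (q%:R / Q%:R) - (arc (q%:R / Q%:R : R))%:R)| <= Q%:R * e + B.
    apply: le_trans (ler_norm_sum _ _ _) _.
    have -> : Q%:R * e = \sum_(q < Q) e by rewrite sumr_const card_ord mulr_natl.
    by rewrite /B -big_split; apply: ler_sum => q _; rewrite distrC.
  have : (6 * s)%:R = 6 * s%:R :> R by rewrite natrM.
  lra.
have m2 : Q%:R * (chi - clo) <= Q%:R * (2 * e) + 6 * s%:R.
  have -> : Q%:R * (chi - clo) = \sum_(q < Q) (fhi (q%:R / Q%:R) - flo (q%:R / Q%:R)).
    by rewrite sumrB Mlo // Mhi // mulrBr.
  have : \sum_(q < Q) (fhi (q%:R / Q%:R) - flo (q%:R / Q%:R)) <= Q%:R * (2 * e) + B.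
    have -> : Q%:R * (2 * e) = \sum_(q < Q) (2 * e) by rewrite sumr_const card_ord mulr_natl.
    by rewrite /B -big_split; apply: ler_sum => q _.
  have : (6 * s)%:R = 6 * s%:R :> R by rewrite natrM.
  lra.
have sQ : s%:R = Q%:R * (1 / r%:R / 20) :> R by rewrite QE; field; rewrite lt0r_neq0.
have m1' : `|clo - 1 / 10| <= e + 7 * (1 / r%:R / 20).
  by rewrite -(ler_pM2l Q0) mulrDr; move: m1; rewrite {1}sQ; lra.
have m2' : chi - clo <= 2 * e + 6 * (1 / r%:R / 20).
  by rewrite -(ler_pM2l Q0) mulrDr; move: m2; rewrite {1}sQ; lra.
pose t n : R := n%:R ^+ k * alpha - c.
exists (fun n => flo (t n) - clo).
exists (fun n => fhi (t n) - flo (t n) + 3 * e + `|clo - 1 / 10|).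
exists (chi - clo + 3 * e + `|clo - 1 / 10|); split.
- exact: wlo.
- have := wnull_lin 1 (-1) (whi 0%N k0) (wlo 0%N k0).
  by congr (wnull _ _); apply/funext => n; rewrite /t; ring.
- by rewrite /e in m1' m2' *; lra.
- move=> n; rewrite -/(t n).
  have -> : (arc (t n))%:R - 1 / 10 - (flo (t n) - clo) =
    ((arc (t n))%:R - flo (t n)) + (clo - 1 / 10) by ring.
  by apply: le_trans (ler_normD _ _) _; rewrite lerD2r.
Qed.

End OnePoint.

(** * Null weights assembled from dyadic blocks *)

Section Dyadic.
Variable R : realType.

Definition mnorm (S : finsys R) (f : S -> R) : R :=
  Num.sqrt (mean (fun x => f x ^+ 2)).

Lemma mean_sq_ge0 (S : finsys R) (f : S -> R) : 0 <= mean (fun x => f x ^+ 2).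
Proof. by apply: mean_ge0 => x; apply: sqr_ge0. Qed.

Lemma mnormD (S : finsys R) (f g : S -> R) :
  mnorm (fun x => f x + g x) <= mnorm f + mnorm g.
Proof.
rewrite -(@ler_pXn2r _ 2) ?nnegrE ?addr_ge0 ?sqrtr_ge0 // sqrrD !sqr_sqrtr ?mean_sq_ge0 //.
have -> : mean (fun x => (f x + g x) ^+ 2) =
    mean (fun x => f x ^+ 2) + 2 * mean (fun x => f x * g x) + mean (fun x => g x ^+ 2).
  by rewrite -meanZ -!meanD; apply: mean_eq => x; ring.
rewrite lerD2r lerD2l -[_ * _ *+ 2]mulr_natl ler_pM2l // /mnorm -sqrtrM ?mean_sq_ge0 //.
apply: le_trans (ler_norm _) _; rewrite -sqrtr_sqr ler_wsqrtr //; exact: mean_cs.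
Qed.

Lemma mnorm_le (S : finsys R) (f : S -> R) c : 0 <= c ->
  (mnorm f <= c) = (mean (fun x => f x ^+ 2) <= c ^+ 2).
Proof.
move=> c0; rewrite -(@ler_pXn2r _ 2) ?nnegrE ?sqrtr_ge0 // sqr_sqrtr ?mean_sq_ge0 //.
Qed.

Lemma mnormN (S : finsys R) (f : S -> R) : mnorm (fun x => - f x) = mnorm f.
Proof. by congr Num.sqrt; apply: mean_eq => x; rewrite sqrrN. Qed.

Lemma mnorm_bound (S : finsys R) (f : S -> R) c : 0 <= c ->
  (forall x, `|f x| <= c) -> mnorm f <= c.
Proof.
move=> c0 fc; rewrite mnorm_le //; apply: mean_le; first exact: sqr_ge0.
by move=> x; rewrite -real_normK ?num_real // lerXn2r ?nnegrE.
Qed.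

Definition wsum (X : Type) (T : X -> X) (l : nat) (f : nat -> X -> R)
  (c : nat -> R) (N : nat) (x : X) : R := \sum_(n < N) c n * term T l f n x.

Lemma wavg_sum (S : finsys R) l (f : nat -> S -> R) c N (e : R) : 0 <= e -> (0 < N)%N ->
  (mnorm (wsum (@fT _ S) l f c N) <= e * N%:R) =
  (mean (fun x => wavg (@fT _ S) l f c N x ^+ 2) <= e ^+ 2).
Proof.
move=> e0 N0; have N0' : 0 < N%:R :> R by rewrite ltr0n.
rewrite mnorm_le ?mulr_ge0 //.
have -> : mean (fun x => wsum (@fT _ S) l f c N x ^+ 2) =
  N%:R ^+ 2 * mean (fun x => wavg (@fT _ S) l f c N x ^+ 2).
  rewrite -meanZ; apply: mean_eq => x; rewrite /wavg /wsum; field.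
  exact: lt0r_neq0.
by rewrite exprMn mulrC ler_pM2r // exprn_gt0.
Qed.

(** The additive constant covers the lengths below the threshold, so that one bound holds for every
    N and may be used at both ends of a block. *)
Lemma wnull_wsum l (c : nat -> R) : (forall n, `|c n| <= 1) -> wnull l c ->
  forall e, 0 < e -> exists N0, forall N (S : finsys R) (f : nat -> S -> R), bounded1 f ->
  mnorm (wsum (@fT _ S) l f c N) <= e * N%:R + N0%:R.
Proof.
move=> c1 wc e e0; have [|N0 H] := wc (e ^+ 2) _; first by rewrite exprn_gt0.
exists N0.+1 => N S f f1.
have [N0N|NN0] := ltnP N0 N.
  apply: (@le_trans _ _ (e * N%:R)); last by rewrite lerDl.
  by rewrite wavg_sum ?(ltW e0) ?(leq_trans _ N0N) // H // ltnW.
apply: (@le_trans _ _ N%:R); last first.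
  apply: (@le_trans _ _ N0.+1%:R); first by rewrite ler_nat; lia.
  by rewrite lerDr mulr_ge0 // ltW.
apply: mnorm_bound => // x; rewrite /wsum -[N%:R]mul1r.
apply: (@sum_bound _ _ (fun n => c n * term (@fT _ S) l f n x)) => n _.
by rewrite normrM mulr_ile1 ?term_bound.
Qed.

Lemma sq_le_exp2 j : ((j.+1) ^ 2 <= 4 * 2 ^ j)%N.
Proof.
have H i : ((i + 2).+1 ^ 2 <= 4 * 2 ^ (i + 2))%N.
  elim: i => // i IH; rewrite addSn [(2 ^ (i + 2).+1)%N]expnS; nia.
by case: j => [|[|j]] //; have := H j; rewrite addn2.
Qed.

(** On a block the sum of [c] is a difference of two partial sums of [c0] or [c1], hence at most a
    small multiple of 2^j plus a constant. The multiples form a geometric series; the constants add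
    up to j D, negligible against 2^j by [sq_le_exp2]. *)
Lemma wnull_dyadic l (c c0 c1 : nat -> R) : (forall n, `|c n| <= 1) ->
  (forall n, `|c0 n| <= 1) -> (forall n, `|c1 n| <= 1) -> wnull l c0 -> wnull l c1 ->
  (forall j n, (2 ^ j < n < 2 ^ j.+1)%N -> c n = if odd j then c1 n else c0 n) ->
  wnull l c.
Proof.
(* Of the nine parts, four pay for the complete blocks, four for the last one, and one for all the
   constants. *)
move=> bc bc0 bc1 w0 w1 cE eps eps0; pose e := Num.min 1 eps / 9.
have m0 : 0 < Num.min 1 eps by rewrite lt_min ltr01.
have e0 : 0 < e by rewrite /e; lra.
have e2 : (9 * e) ^+ 2 <= eps.
  have : Num.min 1 eps <= 1 by rewrite ge_min lexx.
  have : Num.min 1 eps <= eps by rewrite ge_min lexx orbT.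
  have -> : 9 * e = Num.min 1 eps by rewrite /e; field.
  move: m0; set m := Num.min _ _; nra.
have [N0 H0] := wnull_wsum bc0 w0 e0; have [N1 H1] := wnull_wsum bc1 w1 e0.
pose D : R := 2 * (N0 + N1)%:R + 2.
have D0 : 0 <= D by rewrite /D addr_ge0 ?mulr_ge0.
pose K := (Num.truncn (4 * (D + 1) / e)).+1.
exists (2 ^ K)%N => N NK S f f1.
pose U b := wsum (@fT _ S) l f b.
have step j M : (2 ^ j <= M <= 2 ^ j.+1)%N ->
    mnorm (U c M) <= mnorm (U c (2 ^ j)%N) + (4 * e * (2 ^ j)%:R + D).
  move=> /andP[jM Mj]; pose b := if odd j then c1 else c0.
  have bb n : `|b n| <= 1 by rewrite /b; case: ifP.
  have Hb M' : mnorm (U b M') <= e * M'%:R + (N0 + N1)%:R.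
    rewrite /U /b natrD; case: ifP => _.
      by apply: le_trans (H1 M' S f f1) _; rewrite lerD2l lerDr.
    by apply: le_trans (H0 M' S f f1) _; rewrite lerD2l lerDl.
  (* At n = 2^j two blocks meet and [c] is not prescribed; this single term has size at most 2. *)
  pose d x := if (2 ^ j < M)%N then (c (2 ^ j)%N - b (2 ^ j)%N) * term (@fT _ S) l f (2 ^ j) x else 0.
  have UE x : U c M x = U c (2 ^ j)%N x + ((U b M x + - U b (2 ^ j)%N x) + d x).
    rewrite /U /wsum (sum_ord_split (fun n => c n * term (@fT _ S) l f n x) jM).
    rewrite (sum_ord_split (fun n => b n * term (@fT _ S) l f n x) jM).
    rewrite [X in _ = _ + (X + _)]addrC addKr; congr (_ + _).
    rewrite /d; case: ltnP => [jM'|Mj']; last first.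
      by rewrite (_ : (M - 2 ^ j)%N = 0%N) ?big_ord0 ?addr0 //; lia.
    have -> : (M - 2 ^ j = (M - 2 ^ j).-1.+1)%N by lia.
    have R1 (u v w : R) : u + w + (v - u) = v + w by ring.
    rewrite !big_ord_recl /= !addn0 mulrBl R1; congr (_ + _).
    apply: eq_bigr => i _; congr (_ * _).
    rewrite (cE j) ?/b; first by case: ifP.
    by have := ltn_ord i; rewrite /bump /=; lia.
  have -> : mnorm (U c M) = mnorm (fun x => U c (2 ^ j)%N x + ((U b M x + - U b (2 ^ j)%N x) + d x)).
    by congr Num.sqrt; apply: mean_eq => x; rewrite UE.
  apply: le_trans (mnormD _ _) _; rewrite lerD2l.
  apply: le_trans (mnormD _ _) _.
  have d2 : mnorm d <= 2.
    apply: mnorm_bound => // x; rewrite /d; case: ifP => _; last by rewrite normr0.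
    rewrite normrM -[2]mulr1 ler_pM ?term_bound //.
    by apply: le_trans (ler_normB _ _) _; rewrite -[2]/(1 + 1) lerD.
  have := mnormD (U b M) (fun x => - U b (2 ^ j)%N x); rewrite mnormN.
  have := Hb M; have := Hb (2 ^ j)%N.
  have : M%:R <= 2 * (2 ^ j)%:R :> R by rewrite -natrM ler_nat -expnS.
  have : e * M%:R <= e * (2 * (2 ^ j)%:R).
    by rewrite ler_wpM2l ?(ltW e0) // -natrM ler_nat -expnS.
  have : 0 <= e * (2 ^ j)%:R by rewrite mulr_ge0 ?(ltW e0).
  rewrite /D; set u1 := mnorm _; set u2 := mnorm _; set u3 := mnorm _.
  set P := (2 ^ j)%:R; lra.
have pow j : mnorm (U c (2 ^ j)%N) <= 1 + j%:R * D + 4 * e * (2 ^ j)%:R.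
  elim: j => [|j IH].
    rewrite mul0r addr0; apply: (@le_trans _ _ 1); last by rewrite expn0; lra.
    apply: mnorm_bound => // x; rewrite /U /wsum big_ord_recl big_ord0 addr0.
    by rewrite normrM mulr_ile1 ?term_bound.
  apply: le_trans (step j _ _) _; first by rewrite leqnn leq_exp2l //; lia.
  rewrite expnS natrM -natr1; move: IH; set u := mnorm _; lra.
have N0' : (0 < N)%N by apply: leq_trans NK; rewrite expn_gt0.
pose j := trunc_log 2 N.
have /andP[jN Nj] : (2 ^ j <= N < 2 ^ j.+1)%N by apply: trunc_log_bounds.
have Kj : (K <= j)%N by rewrite /j trunc_log_max.
have large : (j%:R + 1) * (D + 1) <= e * (2 ^ j)%:R.
  have h1 : 4 * (D + 1) <= e * (j%:R + 1).
    rewrite mulrC [leRHS]mulrC -ler_pdivrMr // mulrC; apply/ltW.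
    apply: lt_le_trans (truncnS_gt _) _; rewrite natr1 ler_nat; exact: leq_trans Kj _.
  have h2 : (j%:R + 1) ^+ 2 <= 4 * (2 ^ j)%:R :> R.
    by rewrite natr1 -natrX -natrM ler_nat sq_le_exp2.
  have h3 : 0 <= j%:R :> R by []. nra.
apply: le_trans e2; rewrite -wavg_sum //; last by rewrite mulr_ge0 // ltW.
apply: le_trans (step j N _) _; first by rewrite jN ltnW.
have jN' : e * (2 ^ j)%:R <= e * N%:R by rewrite ler_wpM2l ?(ltW e0) // ler_nat.
have j0 : 0 <= j%:R :> R by [].
have := pow j; set u := mnorm _; lra.
Qed.

End Dyadic.

(** * Transfer to probability preserving systems *)

Local Open Scope classical_set_scope.
Local Open Scope ring_scope.

Section BoundedMeasurable.
Context (R : realType) (d : measure_display) (X : measurableType d)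
  (mu : probability X R).
Implicit Types f g : X -> R.

Definition bmf f := measurable_fun [set: X] f /\ exists C, forall x, `|f x| <= C.

Definition EX f : R := \int[mu]_x f x.

Lemma bmf_integrable f : bmf f -> mu.-integrable setT (EFin \o f).
Proof.
move=> [mf [C fC]]; apply: measurable_bounded_integrable => //.
  exact: (le_lt_trans (probability_le1 mu measurableT) (ltry 1)).
exists C; split; first exact: num_real.
by move=> y Cy x _ /=; apply: le_trans (fC x) (ltW Cy).
Qed.

Lemma bmf_cst c : bmf (fun=> c).
Proof. by split; [exact: measurable_cst | exists `|c|]. Qed.

Lemma bmfD f g : bmf f -> bmf g -> bmf (fun x => f x + g x).
Proof.
move=> [mf [C fC]] [mg [D gD]]; split; first exact: measurable_funD.
by exists (C + D) => x; apply: le_trans (ler_normD _ _) _; rewrite lerD.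
Qed.

Lemma bmfM f g : bmf f -> bmf g -> bmf (fun x => f x * g x).
Proof.
move=> [mf [C fC]] [mg [D gD]]; split; first exact: measurable_funM.
by exists (C * D) => x; rewrite normrM ler_pM.
Qed.

Lemma bmfZ c f : bmf f -> bmf (fun x => c * f x).
Proof. exact: (bmfM (bmf_cst c)). Qed.

Lemma bmfB f g : bmf f -> bmf g -> bmf (fun x => f x - g x).
Proof.
move=> bf bg; rewrite (_ : (fun x => _) = (fun x => f x + (-1) * g x)).
  by apply: bmfD => //; apply: bmfZ.
by apply/funext => x; rewrite mulN1r.
Qed.

Lemma bmf_sqr f : bmf f -> bmf (fun x => f x ^+ 2).
Proof. by move=> bf; apply: bmfM. Qed.

Lemma bmf_sum (I : Type) (r : seq I) (P : pred I) (f : I -> X -> R) :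
  (forall i, P i -> bmf (f i)) -> bmf (fun x => \sum_(i <- r | P i) f i x).
Proof.
move=> bf; elim: r => [|i r IH].
  by under eq_fun do rewrite big_nil; apply: bmf_cst.
under eq_fun do rewrite big_cons; case Pi: (P i) => //.
by apply: bmfD => //; apply: bf.
Qed.

Lemma bmf_prod (I : Type) (r : seq I) (P : pred I) (f : I -> X -> R) :
  (forall i, P i -> bmf (f i)) -> bmf (fun x => \prod_(i <- r | P i) f i x).
Proof.
move=> bf; elim: r => [|i r IH].
  by under eq_fun do rewrite big_nil; apply: bmf_cst.
under eq_fun do rewrite big_cons; case Pi: (P i) => //.
by apply: bmfM => //; apply: bf.
Qed.

Lemma EXD f g : bmf f -> bmf g -> EX (fun x => f x + g x) = EX f + EX g.
Proof. by move=> /bmf_integrable bf /bmf_integrable bg; apply: RintegralD. Qed.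

Lemma EXZ c f : bmf f -> EX (fun x => c * f x) = c * EX f.
Proof. by move=> /bmf_integrable bf; apply: RintegralZl. Qed.

Lemma EXB f g : bmf f -> bmf g -> EX (fun x => f x - g x) = EX f - EX g.
Proof. by move=> /bmf_integrable bf /bmf_integrable bg; apply: RintegralB. Qed.

Lemma EX_cst c : EX (fun=> c) = c.
Proof.
rewrite /EX Rintegral_cst // -[RHS]mulr1; congr (_ * _).
exact: (congr1 fine (probability_setT mu)).
Qed.

Lemma le_EX f g : bmf f -> bmf g -> (forall x, f x <= g x) -> EX f <= EX g.
Proof.
move=> /bmf_integrable bf /bmf_integrable bg fg.
by apply: le_Rintegral.
Qed.

Lemma EX_norm_le f c : bmf f -> (forall x, `|f x| <= c) -> `|EX f| <= c.
Proof.
move=> bf fc; rewrite ler_norml -(EX_cst (- c)) -[X in _ && (_ <= X)]EX_cst.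
apply/andP; split; apply: le_EX => //; try exact: bmf_cst.
  by move=> x; have := fc x; rewrite ler_norml => /andP[].
by move=> x; have := fc x; rewrite ler_norml => /andP[].
Qed.

Lemma EX_sum (I : Type) (r : seq I) (P : pred I) (f : I -> X -> R) :
  (forall i, P i -> bmf (f i)) ->
  EX (fun x => \sum_(i <- r | P i) f i x) = \sum_(i <- r | P i) EX (f i).
Proof.
move=> bf; elim: r => [|i r IH].
  by under eq_fun do rewrite big_nil; rewrite EX_cst big_nil.
under eq_fun do rewrite big_cons; rewrite big_cons; case Pi: (P i) => //.
by rewrite EXD ?IH //; [exact: bf | exact: bmf_sum].
Qed.

Lemma bmf_indic A : measurable A -> bmf (\1_A : X -> R).
Proof.
move=> mA; split; first exact: measurable_indic.
by exists 1 => x; rewrite indicE; case: (_ \in _); rewrite ?normr1 ?normr0.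
Qed.

Lemma EX_indic A : measurable A -> EX (\1_A : X -> R) = fine (mu A).
Proof. by move=> mA; rewrite /EX /Rintegral integral_indic // setIT. Qed.

Section finite_valued.
Variables (W : finType) (pi : X -> W).
Hypothesis mpi : forall w, measurable [set x | pi x = w].

Lemma finite_valuedE (G : W -> R) :
  (fun x => G (pi x)) = (fun x => \sum_w G w * \1_[set x | pi x = w] x).
Proof.
apply/funext => x; rewrite (bigD1 (pi x)) //= big1 => [|w wp].
  by rewrite indicE mem_set // mulr1 addr0.
by rewrite indicE memNset ?mulr0 // => /= e; rewrite e eqxx in wp.
Qed.

Lemma bmf_finite_valued (G : W -> R) : bmf (fun x => G (pi x)).
Proof.
rewrite finite_valuedE; apply: bmf_sum => w _; apply: bmfZ; exact: bmf_indic.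
Qed.

Lemma EX_finite_valued (G : W -> R) :
  EX (fun x => G (pi x)) = \sum_w fine (mu [set x | pi x = w]) * G w.
Proof.
rewrite finite_valuedE EX_sum => [|w _]; last by apply: bmfZ; exact: bmf_indic.
apply: eq_bigr => w _; rewrite EXZ; last exact: bmf_indic.
by rewrite EX_indic // mulrC.
Qed.

End finite_valued.

Section invariance.
Variable T : X -> X.
Hypotheses (mT : measurable_fun [set: X] T)
  (muT : forall A, measurable A -> mu (T @^-1` A) = mu A).

Lemma measurable_iter n : measurable_fun [set: X] (iter n T).
Proof.
elim: n => [|n IH]; first exact: measurable_id.
exact: (measurableT_comp mT IH).
Qed.

Lemma bmf_iter n f : bmf f -> bmf (fun x => f (iter n T x)).
Proof.
move=> [mf [C fC]]; split; last by exists C.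
exact: (measurableT_comp mf (measurable_iter n)).
Qed.

Lemma EX_T f : bmf f -> EX (fun x => f (T x)) = EX f.
Proof.
move=> bf; congr fine; have bT := bmf_iter 1 bf.
rewrite -(@integral_pushforward _ _ X X R T mT mu setT (EFin \o f)) //.
- by apply: eq_measure_integral => A mA _; apply: muT.
- by apply/measurable_EFinP; case: bf.
- by rewrite preimage_setT; exact: bmf_integrable.
Qed.

Lemma EX_iter n f : bmf f -> EX (fun x => f (iter n T x)) = EX f.
Proof.
elim: n f => // n IH f bf; rewrite -[RHS](IH f bf) -(EX_T (bmf_iter n bf)).
by congr EX; apply/funext => x; rewrite iterSr.
Qed.

Lemma bmf_term p (f : nat -> X -> R) n : bounded1 f -> (forall i, measurable_fun [set: X] (f i)) ->
  bmf (term T p f n).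
Proof.
move=> f1 mf; apply: bmf_prod => i _; apply: bmf_iter; split => //.
by exists 1; apply: f1.
Qed.

Lemma bmf_wsum p (f : nat -> X -> R) (B : nat) (c : nat -> R) : bounded1 f ->
  (forall i, measurable_fun [set: X] (f i)) ->
  bmf (fun x => \sum_(n < B) c n * term T p f n x).
Proof. by move=> f1 mf; apply: bmf_sum => n _; apply: bmfZ; apply: bmf_term. Qed.

Section transfer.
Variables (p : nat) (f : nat -> X -> R) (H Q' : nat).
Hypotheses (H0 : (0 < H)%N) (f1 : bounded1 f)
  (mf : forall i, measurable_fun [set: X] (f i)).
Let Q := Q'.+1.

Definition quant (y : R) : 'I_(2 * H).+1 := inord (Num.truncn ((y + 1) * H%:R)).
Definition quant_val (j : 'I_(2 * H).+1) : R := j%:R / H%:R - 1.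

Let H0' : 0 < H%:R :> R. Proof. by rewrite ltr0n. Qed.

Lemma quantE y : `|y| <= 1 ->
  (quant y)%:R <= (y + 1) * H%:R < (quant y)%:R + 1.
Proof.
move=> /ler_normlP[y1 y2].
have z0 : 0 <= (y + 1) * H%:R by rewrite mulr_ge0 //; lra.
have /andP[t1 t2] := truncn_itv z0.
rewrite /quant inordK ?t1 ?natr1 ?t2 // ltnS -(ler_nat R).
by apply: le_trans t1 _; rewrite natrM ler_wpM2r ?ler0n //; lra.
Qed.

Lemma quant_close y : `|y| <= 1 -> `|quant_val (quant y) - y| <= H%:R^-1.
Proof.
move=> y1; have /andP[h1 h2] := quantE y1; rewrite /quant_val.
have -> : (quant y)%:R / H%:R - 1 - y = ((quant y)%:R - (y + 1) * H%:R) / H%:R.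
  by field; rewrite lt0r_neq0.
rewrite normrM (gtr0_norm (x := H%:R^-1)) ?invr_gt0 // -[leRHS]mul1r ler_wpM2r ?invr_ge0 //.
by rewrite ler_norml; apply/andP; split; lra.
Qed.

Lemma quant_val_bound j : `|quant_val j| <= 1.
Proof.
have jH : j%:R <= 2 * H%:R :> R by rewrite -natrM ler_nat -ltnS.
have : j%:R / H%:R <= 2 :> R by rewrite ler_pdivrMr.
have : 0 <= j%:R / H%:R :> R by rewrite divr_ge0.
by rewrite /quant_val ler_norml => *; apply/andP; split; lra.
Qed.

Lemma measurable_quant (g : X -> R) j : measurable_fun [set: X] g ->
  (forall x, `|g x| <= 1) -> measurable [set x | quant (g x) = j].
Proof.
move=> mg g1.
rewrite (_ : [set x | _] = [set: X] `&` g @^-1` `[quant_val j, quant_val j + H%:R^-1[).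
  exact: mg.
have jE (i : 'I_(2 * H).+1) : i%:R / H%:R - 1 + H%:R^-1 = (i%:R + 1) / H%:R - 1 :> R.
  by ring.
apply/seteqP; split => x /=.
  move=> <-; split => //=; have /andP[h1 h2] := quantE (g1 x).
  rewrite in_itv /= /quant_val; apply/andP; split.
    by rewrite lerBlDr ler_pdivrMr.
  by rewrite jE ltrBrDr ltr_pdivlMr.
move=> [_]; rewrite /= in_itv /= /quant_val => /andP[h1 h2].
have /andP[k1 k2] := quantE (g1 x).
move: h1; rewrite lerBlDr ler_pdivrMr // => h1.
move: h2; rewrite jE ltrBrDr ltr_pdivlMr // => h2.
apply/val_inj/eqP; rewrite eqn_leq; apply/andP; split;
  rewrite -ltnS -(ltr_nat R) -natr1; lra.
Qed.

(** ['I_p.+1] is inhabited also for p = 0, as the [inord] of [pattern_fun] requires. *)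
Definition pattern (x : X) : {ffun 'I_p.+1 * 'I_Q -> 'I_(2 * H).+1} :=
  [ffun it : 'I_p.+1 * 'I_Q => quant (f it.1 (iter it.2 T x))].

Lemma measurable_pattern w : measurable [set x | pattern x = w].
Proof.
rewrite (_ : [set x | _] = \bigcap_(it in [set: 'I_p.+1 * 'I_Q])
    [set x | quant (f it.1 (iter it.2 T x)) = w it]).
  apply: fin_bigcap_measurable; first exact: finite_finset.
  move=> it _; apply: (@measurable_quant (fun x => f it.1 (iter it.2 T x))).
    exact: (measurableT_comp (mf _) (measurable_iter _)).
  by move=> x; apply: f1.
apply/seteqP; split => x /=; first by move=> <- it _ /=; rewrite ffunE.
by move=> h; apply/ffunP => it; rewrite ffunE; apply: h.
Qed.

Definition pattern_wt (z : {ffun 'I_p.+1 * 'I_Q -> 'I_(2 * H).+1} * 'I_Q) : R :=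
  fine (mu [set x | pattern x = z.1]) / Q%:R.

Lemma pattern_wt_ge0 z : 0 <= pattern_wt z.
Proof. by rewrite divr_ge0 // fine_ge0. Qed.

Lemma sum_pattern (G : {ffun 'I_p.+1 * 'I_Q -> 'I_(2 * H).+1} -> 'I_Q -> R) :
  \sum_z pattern_wt z * G z.1 z.2 = Q%:R^-1 * \sum_(t < Q) EX (fun x => G (pattern x) t).
Proof.
rewrite -(pair_bigA _ (fun w t => pattern_wt (w, t) * G w t)) exchange_big /= mulr_sumr.
apply: eq_bigr => t _.
rewrite (EX_finite_valued measurable_pattern (fun w => G w t)) mulr_sumr.
by apply: eq_bigr => w _; rewrite /pattern_wt /= mulrAC mulrC.
Qed.

Lemma pattern_wt_sum : \sum_z pattern_wt z <= 1.
Proof.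
rewrite (eq_bigr (fun z => pattern_wt z * 1)); last by move=> z _; rewrite mulr1.
rewrite (sum_pattern (fun _ _ => 1)).
rewrite (eq_bigr (fun=> 1)); last by move=> t _; rewrite EX_cst.
by rewrite sumr_const card_ord mulVf // pnatr_eq0.
Qed.

Definition pattern_T (z : {ffun 'I_p.+1 * 'I_Q -> 'I_(2 * H).+1} * 'I_Q) :=
  (z.1, ordS z.2).
Definition pattern_Ti (z : {ffun 'I_p.+1 * 'I_Q -> 'I_(2 * H).+1} * 'I_Q) :=
  (z.1, ord_pred z.2).
Lemma pattern_TK : cancel pattern_T pattern_Ti.
Proof. by case=> w t; rewrite /pattern_Ti /= ordSK. Qed.
Lemma pattern_TiK : cancel pattern_Ti pattern_T.
Proof. by case=> w t; rewrite /pattern_T /= ord_predK. Qed.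

(** Only the time coordinate moves and the weight ignores it, so invariance holds by definition. The
    invariance of [mu] enters in [transfer], where an expectation is spread over Q starting
    times. *)
Definition pattern_sys := FinSys pattern_wt_ge0 pattern_wt_sum pattern_TK
  pattern_TiK (fun=> erefl).

Definition pattern_fun (i : nat) (z : pattern_sys) : R :=
  quant_val (z.1 (inord i, z.2)).

Lemma pattern_fun_bound : bounded1 pattern_fun.
Proof. by move=> i z; apply: quant_val_bound. Qed.

Lemma iter_pattern_T k w (t : 'I_Q) : (t + k < Q)%N ->
  iter k pattern_T (w, t) = (w, inord (t + k)).
Proof.
elim: k => [|k IH] tk /=; first by rewrite addn0 inord_val.
rewrite IH; last by apply: leq_ltn_trans tk; rewrite leq_add2l.
rewrite /pattern_T /=; congr (_, _); apply: val_inj => /=.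
rewrite !inordK // ?modn_small ?addnS //; last by rewrite -ltnS -addnS ltnW.
by rewrite -addnS.
Qed.

Lemma prod_close (m : nat) (a b : nat -> R) (e : R) : 0 <= e ->
  (forall i, `|a i| <= 1) -> (forall i, `|b i| <= 1) ->
  (forall i, (i < m)%N -> `|a i - b i| <= e) ->
  `|\prod_(i < m) a i - \prod_(i < m) b i| <= m%:R * e.
Proof.
move=> e0 a1 b1; elim: m => [|m IH] ab; first by rewrite !big_ord0 subrr normr0 mul0r.
rewrite !big_ord_recr /=; set u := \prod_(i < m) a i; set v := \prod_(i < m) b i.
have -> : u * a m - v * b m = (u - v) * a m + v * (a m - b m) by ring.
apply: le_trans (ler_normD _ _) _; rewrite -natr1 [(_ + 1) * e]mulrDl mul1r lerD //.
  rewrite normrM -[leRHS]mulr1 ler_pM //; apply: IH => i im; apply: ab.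
  exact: ltnW.
rewrite normrM -[leRHS]mul1r ler_pM ?ab // normr_prod.
by apply: prodr_ile1 => i _; rewrite normr_ge0 b1.
Qed.

Lemma pattern_term n x (t : 'I_Q) : (t + p * n < Q)%N ->
  `|term pattern_T p pattern_fun n (pattern x, t) - term T p f n (iter t T x)|
  <= p%:R / H%:R.
Proof.
move=> tn; apply: (@prod_close p (fun i => pattern_fun i (iter (i.+1 * n) pattern_T (pattern x, t)))
  (fun i => f i (iter (i.+1 * n) T (iter t T x)))) => //.
- by move=> i; apply: pattern_fun_bound.
move=> i ip; have tin : (t + i.+1 * n < Q)%N.
  by apply: leq_ltn_trans tn; rewrite leq_add2l leq_mul2r ip orbT.
rewrite iter_pattern_T // /pattern_fun /= ffunE /=.
rewrite !inordK //; last by rewrite ltnS ltnW.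
rewrite addnC iterD; apply: quant_close; exact: f1.
Qed.

End transfer.

(* The system is coded by the patterns of [Q] consecutive values of the functions,
   discretised with mesh 1/H, together with a cyclic time coordinate, whose
   wrap-around affects only the last [p * B] times. *)
Lemma transfer p (f : nat -> X -> R) (B : nat) (e : R) : bounded1 f ->
  (forall i, measurable_fun [set: X] (f i)) -> 0 < e ->
  exists (S : finsys R) (f' : nat -> S -> R), bounded1 f' /\
  forall c : nat -> R, \sum_(n < B) `|c n| <= 2 ->
  `|EX (fun x => (\sum_(n < B) c n * term T p f n x) ^+ 2) -
    mean (fun z => (\sum_(n < B) c n * term (@fT _ S) p f' n z) ^+ 2)| <= e.
Proof.
move=> f1 mf e0.
(* Discretisation will cost 8 p / H and wrap-around 4 p B / Q; each is made at most e / 2. *)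
pose H := (Num.truncn (16 * p%:R / e)).+1.
pose Q' := (Num.truncn (8 * (p * B)%:R / e)).+1.
pose Q := Q'.+1.
have H0 : 0 < H%:R :> R by [].
have Q0 : 0 < Q%:R :> R by [].
have He : 16 * p%:R <= e * H%:R.
  by rewrite [leRHS]mulrC -ler_pdivrMr //; apply/ltW/truncnS_gt.
have Qe : 8 * (p * B)%:R <= e * Q%:R.
  rewrite [leRHS]mulrC -ler_pdivrMr //; apply/ltW; apply: lt_le_trans (truncnS_gt _) _.
  by rewrite ler_nat.
exists (@pattern_sys p f H Q' isT f1 mf), (@pattern_fun p f H Q' isT f1 mf).
split; first exact: pattern_fun_bound.
move=> c c2.
pose S := @pattern_sys p f H Q' isT f1 mf; pose f' := @pattern_fun p f H Q' isT f1 mf.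
pose u x := \sum_(n < B) c n * term T p f n x.
pose v (z : S) := \sum_(n < B) c n * term (@pattern_T p H Q') p f' n z.
have bnd (Y : Type) (T' : Y -> Y) (g : nat -> Y -> R) y : bounded1 g ->
    `|\sum_(n < B) c n * term T' p g n y| <= 2.
  move=> g1; apply: le_trans (ler_norm_sum _ _ _) _; apply: le_trans c2.
  by apply: ler_sum => n _; rewrite normrM -[leRHS]mulr1 ler_pM ?term_bound.
have u2 x : `|u x| <= 2 by apply: bnd.
have v2 z : `|v z| <= 2 by apply: bnd; exact: pattern_fun_bound.
have bu : bmf u by apply: bmf_wsum.
have bv t : bmf (fun x => v (pattern p f H Q' x, t) ^+ 2).
  exact: (bmf_finite_valued (@measurable_pattern p f H Q' isT f1 mf) (fun w => v (w, t) ^+ 2)).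
pose bad (t : nat) := (Q - p * B <= t < Q)%N.
have diff (t : 'I_Q) : `|EX (fun x => u (iter t T x) ^+ 2) -
    EX (fun x => v (pattern p f H Q' x, t) ^+ 2)| <= 8 * (p%:R / H%:R) + 4 * (bad t)%:R.
  rewrite -EXB //; last by apply: (bmf_iter t (f := fun x => u x ^+ 2)); apply: bmf_sqr.
  apply: EX_norm_le.
    by apply: bmfB => //; apply: (bmf_iter t (f := fun x => u x ^+ 2)); apply: bmf_sqr.
  move=> x; have := u2 (iter t T x); have := v2 (pattern p f H Q' x, t).
  have pH : 0 <= p%:R / H%:R :> R by rewrite divr_ge0.
  rewrite /bad ltn_ord andbT; case: leqP => [tb|tg] /=.
    set a := u _; set b := v _ => /ler_normlP[b1 b2] /ler_normlP[a1 a2].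
    rewrite mulr1n ler_norml; apply/andP; split; nra.
  have : `|u (iter t T x) - v (pattern p f H Q' x, t)| <= 2 * (p%:R / H%:R).
    rewrite /u /v -sumrB; apply: le_trans (ler_norm_sum _ _ _) _.
    apply: (@le_trans _ _ (\sum_(n < B) `|c n| * (p%:R / H%:R))).
      apply: ler_sum => n _; rewrite -mulrBr normrM ler_wpM2l // distrC.
      apply: pattern_term => //.
      have : (p * n <= p * B)%N by rewrite leq_mul2l ltnW ?orbT.
      move=> h; apply: leq_ltn_trans (_ : (t + p * B < _)%N); first by rewrite leq_add2l.
      by move: tg; rewrite ltn_subRL addnC.
    by rewrite -mulr_suml ler_wpM2r.
  rewrite mulr0n mulr0 addr0.
  set a := u _; set b := v _ => ab /ler_normlP[b1 b2] /ler_normlP[a1 a2].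
  have -> : a ^+ 2 - b ^+ 2 = (a - b) * (a + b) by ring.
  rewrite normrM; have h4 : `|a + b| <= 4 by rewrite ler_norml; apply/andP; split; lra.
  apply: le_trans (ler_pM _ _ ab h4) _ => //; lra.
have -> : EX (fun x => u x ^+ 2) = Q%:R^-1 * \sum_(t < Q) EX (fun x => u (iter t T x) ^+ 2).
  rewrite (eq_bigr (fun=> EX (fun x => u x ^+ 2))) => [|t _].
    by rewrite sumr_const card_ord -[EX _ *+ Q]mulr_natl mulrA mulVf ?mul1r // lt0r_neq0.
  by apply: (EX_iter t (f := fun x => u x ^+ 2)); apply: bmf_sqr.
have -> : mean (fun z : S => v z ^+ 2) =
    Q%:R^-1 * \sum_(t < Q) EX (fun x => v (pattern p f H Q' x, t) ^+ 2).
  rewrite -(@sum_pattern p f H Q' isT f1 mf (fun w t => v (w, t) ^+ 2)).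
  by apply: eq_bigr => -[w t] _.
rewrite -mulrBr -sumrB normrM gtr0_norm ?invr_gt0 // mulrC ler_pdivrMr //.
apply: le_trans (ler_norm_sum _ _ _) _.
apply: le_trans (ler_sum _ (fun t _ => diff t)) _.
rewrite big_split /= sumr_const card_ord -mulr_sumr sum_interval ?leq_subr //.
have : (Q - (Q - p * B))%:R <= (p * B)%:R :> R by rewrite ler_nat; lia.
have : 8 * (p%:R / H%:R) <= e / 2.
  by rewrite mulrA ler_pdivrMr //; lra.
rewrite -[_ *+ Q]mulr_natr; set w := 8 * (_ / _) => h1 h2.
have : w * Q%:R <= e / 2 * Q%:R by rewrite ler_wpM2r // ltW.
lra.
Qed.

End invariance.

End BoundedMeasurable.

(** * Null weights and Cauchy averages on a probability space *)

Section SystemAverages.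
Context (R : realType) (d : measure_display) (X : measurableType d)
  (mu : probability X R).
Variable T : X -> X.
Hypotheses (mT : measurable_fun [set: X] T)
  (muT : forall A, measurable A -> mu (T @^-1` A) = mu A).
Variables (p : nat) (f : nat -> X -> R).
Hypotheses (f1 : bounded1 f) (mf : forall i, measurable_fun [set: X] (f i)).

(** Averages of different lengths up to B become linear forms in the same B terms, the shape that
    [transfer] accepts. *)
Lemma sum_cutoff (B n : nat) (c t : nat -> R) : (n <= B)%N ->
  \sum_(m < B) (if (m < n)%N then n%:R^-1 * c m else 0) * t m =
  n%:R^-1 * \sum_(m < n) c m * t m.
Proof.
move=> nB; rewrite (sum_ord_split (fun m => (if (m < n)%N then n%:R^-1 * c m else 0) * t m) nB).
rewrite [X in _ + X]big1 ?addr0 => [|i _]; last by rewrite ltnNge leq_addr mul0r.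
by rewrite mulr_sumr; apply: eq_bigr => i _; rewrite ltn_ord mulrA.
Qed.

Lemma norm_cutoff (B n : nat) (c : nat -> R) : (n <= B)%N -> (forall m, `|c m| <= 1) ->
  \sum_(m < B) `|if (m < n)%N then n%:R^-1 * c m else 0| <= 1.
Proof.
move=> nB c1; rewrite (eq_bigr (fun m : 'I_B =>
    (if (m < n)%N then n%:R^-1 * `|c m| else 0) * 1)) => [|m _]; last first.
  by rewrite mulr1; case: ifP; rewrite ?normr0 // normrM ger0_norm ?invr_ge0.
rewrite (sum_cutoff (fun m => `|c m|) (fun=> 1) nB); apply: le_trans (ler_norm _) _.
apply: (@mean_bound _ n (fun m => `|c m| * 1)) => // m _.
by rewrite mulr1 normr_id.
Qed.

Lemma EX_wnull (c : nat -> R) : (forall n, `|c n| <= 1) -> wnull p c ->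
  forall e, 0 < e -> exists N0, forall N, (N0 <= N)%N ->
  EX mu (fun x => wavg T p f c N x ^+ 2) <= e.
Proof.
move=> c1 wc e e0; have [|N0 H0] := wc (e / 2); first by lra.
exists N0 => N NN; have [|S [f' [f'1 H]]] := transfer (mu := mu) mT muT p N f1 mf (e := e / 2).
  by lra.
pose w m := if (m < N)%N then N%:R^-1 * c m else 0.
have := H w; have -> : (fun x => (\sum_(n < N) w n * term T p f n x) ^+ 2) =
    (fun x => wavg T p f c N x ^+ 2).
  by apply/funext => x; rewrite (sum_cutoff c (fun n => term T p f n x) (leqnn N)).
have -> : mean (fun z => (\sum_(n < N) w n * term (@fT _ S) p f' n z) ^+ 2) =
    mean (fun z => wavg (@fT _ S) p f' c N z ^+ 2).
  by apply: mean_eq => z; rewrite (sum_cutoff c (fun n => term _ p f' n z) (leqnn N)).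
have h2 := H0 N NN S f' f'1; have h3 := norm_cutoff (leqnn N) c1.
move=> h; have /ler_normlP[_] := h (le_trans h3 (ler1n _ 2)).
move: h2; set a := EX _ _; set b := mean _; lra.
Qed.

(** Otherwise every N has a bad pair of lengths beyond it. Let [F N] bound this pair: metastability
    for that [F] on the finite model, with error e / 2, contradicts the bad pair at some N. A
    difference of two averages has total weight at most 2, the bound in [transfer]. *)
Lemma EX_cauchy e : 0 < e -> exists N, forall n n', (N <= n)%N -> (N <= n')%N ->
  EX mu (fun x => (avg T p f n x - avg T p f n' x) ^+ 2) <= e.
Proof.
move=> e0; apply: contrapT => /forallNP nC.
have /choice[F0 F0P] : forall N, exists nn : nat * nat, [/\ (N <= nn.1)%N, (N <= nn.2)%N &
    e < EX mu (fun x => (avg T p f nn.1 x - avg T p f nn.2 x) ^+ 2)].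
  move=> N; have /existsNP[n /existsNP[n' /not_implyP[Nn /not_implyP[Nn' /negP]]]] := nC N.
  by rewrite -ltNge => h; exists (n, n').
pose F N := maxn (F0 N).1 (F0 N).2.
have [|K HK] := metastability p (eps := e / 2) _ F; first by lra.
pose B := (\max_(N < K.+1) F N).+1.
have [|S [f' [f'1 H]]] := transfer (mu := mu) mT muT p B f1 mf (e := e / 2).
  by lra.
have [N /andP[N0 NK] HN] := HK S f' f'1.
have [h1 h2] := F0P N; set n := (F0 N).1 in h1 h2 *; set n' := (F0 N).2 in h1 h2 *.
move=> big.
have nF : (n <= F N)%N by rewrite /F leq_max leqnn.
have nF' : (n' <= F N)%N by rewrite /F leq_max leqnn orbT.
have FB : (F N <= B)%N.
  by apply: leqW; apply: (leq_bigmax (Ordinal (_ : (N < K.+1)%N))).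
have nB := leq_trans nF FB; have nB' := leq_trans nF' FB.
pose w m := (if (m < n)%N then n%:R^-1 * 1 else 0) - (if (m < n')%N then n'%:R^-1 * 1 else 0) : R.
have wE (Y : Type) (T' : Y -> Y) (g : nat -> Y -> R) y :
    \sum_(m < B) w m * term T' p g m y = avg T' p g n y - avg T' p g n' y.
  rewrite /avg; under eq_bigr do rewrite mulrBl.
  rewrite sumrB !(sum_cutoff (fun=> 1) (fun m => term T' p g m y)) //.
  by congr (_ * _ - _ * _); apply: eq_bigr => i _; rewrite mul1r.
have := H w; have -> : (fun x => (\sum_(m < B) w m * term T p f m x) ^+ 2) =
    (fun x => (avg T p f n x - avg T p f n' x) ^+ 2).
  by apply/funext => x; rewrite wE.
have -> : mean (fun z => (\sum_(m < B) w m * term (@fT _ S) p f' m z) ^+ 2) =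
    mean (fun z => (avg (@fT _ S) p f' n z - avg (@fT _ S) p f' n' z) ^+ 2).
  by apply: mean_eq => z; rewrite wE.
have w2 : \sum_(m < B) `|w m| <= 2.
  have c1 (m : nat) : `|1 : R| <= 1 by rewrite normr1.
  apply: (@le_trans _ _ (\sum_(m < B) (`|if (m < n)%N then n%:R^-1 * 1 else 0 : R| +
     `|if (m < n')%N then n'%:R^-1 * 1 else 0 : R|))).
    by apply: ler_sum => m _; apply: ler_normB.
  by rewrite big_split /= -[2]/(1 + 1) lerD // (norm_cutoff (c := fun=> 1)).
move=> /(_ w2) /ler_normlP[_].
have := HN n n'; rewrite h1 h2 nF nF' => /(_ isT isT).
move: big; set a := EX _ _; set b := mean _; lra.
Qed.

End SystemAverages.

(** * Completeness for uniformly bounded sequences *)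

Section Completeness.
Context (R : realType) (d : measure_display) (X : measurableType d)
  (mu : probability X R).

(** Integrates the pointwise bound |h| <= e / 2 + h^2 / (2 e). *)
Lemma EX_norm_sq (h : X -> R) e : bmf h -> 0 < e -> EX mu (fun x => h x ^+ 2) <= e ^+ 2 ->
  EX mu (fun x => `|h x|) <= e.
Proof.
move=> bh e0 he.
have bn : bmf (fun x => `|h x|).
  case: bh => mh [C hC]; split; first exact: measurableT_comp.
  by exists C => x; rewrite normr_id.
have b2 : bmf (fun x => e / 2 + (2 * e)^-1 * h x ^+ 2).
  by apply: bmfD; [exact: bmf_cst | apply: bmfZ; exact: bmf_sqr].
apply: le_trans (le_EX mu bn b2 _) _.
  move=> x; rewrite -[h x ^+ 2]real_normK ?num_real //; set t := `|h x|.
  have -> : e / 2 + (2 * e)^-1 * t ^+ 2 = (e ^+ 2 + t ^+ 2) / (2 * e).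
    by field; rewrite lt0r_neq0.
  rewrite ler_pdivlMr ?mulr_gt0 //; have := sqr_ge0 (e - t); lra.
rewrite EXD ?EXZ ?EX_cst; [|exact: bmf_sqr|exact: bmf_cst|exact: bmf_cst|
  by apply: bmfZ; exact: bmf_sqr].
rewrite [leRHS](_ : e = e / 2 + (2 * e)^-1 * e ^+ 2); last by field; rewrite lt0r_neq0.
by rewrite lerD2l ler_wpM2l // invr_ge0 mulr_ge0 // ltW.
Qed.

Lemma limn_sup_close (u : nat -> R) (k : nat) (a r : R) : (forall n, `|u n| <= 1) ->
  (forall m, (k <= m)%N -> `|u m - a| <= r) -> `|limn_sup u - a| <= r.
Proof.
move=> u1 ur.
have bu : bounded_fun (u : nat -> R^o).
  exists 1; split; first exact: num_real.
  by move=> y y1 n _; apply: le_trans (u1 n) (ltW y1).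
have ub : has_ubound (range u).
  by exists 1 => _ [n _ <-]; have /ler_normlP[] := u1 n.
rewrite limn_supE // ler_norml; apply/andP; split.
  rewrite lerBrDr; apply: lb_le_inf; first by exists (sups u 0), 0%N.
  move=> _ [n _ <-]; apply: (@le_trans _ _ (u (maxn n k))).
    by have := ur (maxn n k) (leq_maxr _ _); rewrite ler_norml => /andP[h1 h2]; lra.
  by apply: ub_le_sup; [exact: has_ubound_sdrop | exists (maxn n k) => //=; exact: leq_maxl].
rewrite lerBlDr; apply: (@le_trans _ _ (sups u k)).
  apply: ge_inf; last by exists k.
  exists (-1) => _ [n _ <-]; apply: (@le_trans _ _ (u n)).
    by have /ler_normlP[] := u1 n; rewrite lerNl.
  by apply: ub_le_sup; [exact: has_ubound_sdrop | exists n => /=].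
apply: ge_sup; first by exists (u k), k => /=.
by move=> _ [m /= km <-]; have := ur m km; rewrite ler_norml => /andP[h1 h2]; lra.
Qed.

(* A subsequence with summable increments converges in L1 to its pointwise limsup. *)
Lemma bounded_L2_complete (u : nat -> X -> R) :
  (forall n, measurable_fun [set: X] (u n)) -> (forall n x, `|u n x| <= 1) ->
  (forall e, 0 < e -> exists N, forall n m, (N <= n)%N -> (N <= m)%N ->
     EX mu (fun x => (u n x - u m x) ^+ 2) <= e) ->
  exists g : X -> R, [/\ measurable_fun [set: X] g, forall x, `|g x| <= 1 &
   forall e, 0 < e -> exists N, forall n, (N <= n)%N ->
     EX mu (fun x => (u n x - g x) ^+ 2) <= e].
Proof.
move=> mu1 u1 cau.
pose s k : R := 1 / (2 ^ k.+1)%:R.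
have s0 k : 0 < s k by rewrite divr_gt0 // ltr0n expn_gt0.
have /choice[phi phiP] : forall k, exists N, forall n m, (N <= n)%N -> (N <= m)%N ->
     EX mu (fun x => (u n x - u m x) ^+ 2) <= s k ^+ 2.
  by move=> k; apply: cau; rewrite exprn_gt0.
(* Partial sums turn the thresholds into a monotone sequence, so [v k] and [v k.+1] both lie beyond
   [phi k]. *)
pose psi k := (\sum_(i < k.+1) phi i)%N.
have psiS k : (psi k <= psi k.+1)%N by rewrite /psi [leqRHS]big_ord_recr leq_addr.
have phipsi k : (phi k <= psi k)%N by rewrite /psi big_ord_recr leq_addl.
pose v k := u (psi k).
have bu n : bmf (u n) by split => //; exists 1.
have v2 k : EX mu (fun x => `|v k.+1 x - v k x|) <= s k.
  apply: EX_norm_sq => //; first by apply: bmfB; apply: bu.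
  by apply: phiP => //; exact: leq_trans (phipsi k) (psiS k).
pose g x := limn_sup (v ^~ x).
have g1 x : `|g x| <= 1.
  rewrite -[g x]subr0; apply: (@limn_sup_close _ 0) => [m|m _]; first exact: u1.
  by rewrite subr0; apply: u1.
have mg : measurable_fun [set: X] g.
  apply: measurable_fun_limn_sup => [x _|x _|n]; last exact: mu1.
    by exists 1 => _ [n _ <-]; have /ler_normlP[] := u1 (psi n) x.
  exists (-1) => _ [n _ <-]; have /ler_normlP[] := u1 (psi n) x.
  by rewrite lerNl.
have bg : bmf g by split => //; exists 1.
have babs (h : X -> R) : bmf h -> bmf (fun x => `|h x| : R).
  move=> [mh [C hC]]; split; first exact: measurableT_comp.
  by exists C => x; rewrite normr_id.
have EXE (h : X -> R) : bmf h -> (EX mu h)%:E = (\int[mu]_x (h x)%:E)%E.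
  by move=> /(bmf_integrable mu) ih; rewrite /EX /Rintegral fineK // integrable_fin_num.
have gv k : EX mu (fun x => `|g x - v k x|) <= 1 / (2 ^ k)%:R.
  rewrite -lee_fin EXE; last by apply: babs; apply: bmfB => //; apply: bu.
  pose h i x : \bar R := (`|v (k + i).+1 x - v (k + i)%N x|)%:E.
  have mh i : measurable_fun [set: X] (h i).
    apply/measurable_EFinP; case: (babs (fun x => v (k + i).+1 x - v (k + i)%N x)) => //.
    by apply: bmfB; apply: bu.
  apply: (@le_trans _ _ (\int[mu]_x (\sum_(i <oo) h i x))%E).
    apply: ge0_le_integral => //.
    - apply/measurable_EFinP; case: (babs (fun x => g x - v k x)) => //.
      by apply: bmfB => //; apply: bu.
    - by apply: ge0_emeasurable_sum => // i x _ _; rewrite lee_fin.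
    move=> x _.
    have part M : (`|v (k + M)%N x - v k x|%:E <= \sum_(i <oo) h i x)%E.
      apply: le_trans (nneseries_lim_ge M _); last by move=> n _ _; rewrite lee_fin.
      rewrite sumEFin lee_fin big_mkord.
      elim: M => [|M IH]; first by rewrite addn0 subrr normr0 big_ord0.
      rewrite big_ord_recr /= addnS.
      have -> : v (k + M).+1 x - v k x = (v (k + M)%N x - v k x) +
        (v (k + M).+1 x - v (k + M)%N x) by ring.
      by apply: le_trans (ler_normD _ _) _; rewrite lerD2r.
    move: part; case: (\sum_(i <oo) h i x)%E => [r| |] part; last 2 first.
    - by rewrite leey.
    - by have := part 0%N; rewrite leeNy_eq.
    rewrite lee_fin; apply: (@limn_sup_close _ k) => [n|m km]; first exact: u1.
    by have := part (m - k)%N; rewrite subnKC // lee_fin.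
  rewrite integral_nneseries //; last by move=> n x _; rewrite lee_fin.
  apply: (@le_trans _ _ (\sum_(i <oo) ((1 / (2 ^ k)%:R) / (2 ^ i.+1)%:R)%:E)%E); last first.
    by apply: epsilon_trick0; rewrite divr_ge0.
  apply: lee_nneseries => [i _ _|i _]; first by apply: integral_ge0 => x _; rewrite lee_fin.
  rewrite /h -EXE; last by apply: babs; apply: bmfB; apply: bu.
  rewrite lee_fin; apply: le_trans (v2 _) _.
  by rewrite /s -mulrA -invfM -natrM -expnD addnS.
exists g; split => // e e0.
(* Both functions being bounded by 1, (g - v k)^2 <= 2 |g - v k| turns the L1 bound into an L2
   bound; the total is 2 s_k^2 + 4 / 2^k <= 6 / 2^k. *)
pose k := (Num.truncn (6 / e)).+1.
have ke : 6 / (2 ^ k)%:R <= e.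
  rewrite ler_pdivrMr ?ltr0n ?expn_gt0 // mulrC -ler_pdivrMr //.
  apply: le_trans (ltW (truncnS_gt _)) _; rewrite ler_nat -/k; exact: ltnW (ltn_expl _ _).
exists (psi k) => n kn.
have k1 : EX mu (fun x => (u n x - v k x) ^+ 2) <= s k ^+ 2.
  by apply: phiP => //; exact: leq_trans (phipsi k) _.
have b1 : bmf (fun x => 2 * (u n x - v k x) ^+ 2).
  by apply: bmfZ; apply: bmf_sqr; apply: bmfB; apply: bu.
have b2 : bmf (fun x => 4 * `|g x - v k x|).
  by apply: bmfZ; apply: babs; apply: bmfB => //; apply: bu.
apply: (@le_trans _ _ (EX mu (fun x => 2 * (u n x - v k x) ^+ 2 + 4 * `|g x - v k x|))).
  apply: le_EX => [||x]; [by apply: bmf_sqr; apply: bmfB => //; apply: bu | exact: bmfD |].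
  have : (g x - v k x) ^+ 2 <= 2 * `|g x - v k x|.
    rewrite -real_normK ?num_real // expr2 ler_wpM2r //.
    apply: le_trans (ler_normB _ _) _; have := g1 x; have := u1 (psi k) x; rewrite -/(v k); lra.
  have := sqr_ge0 (u n x - v k x + (g x - v k x)).
  set q := `|_|; set a := u n x; set b := v k x; set c := g x; lra.
rewrite EXD // !EXZ; [|by apply: babs; apply: bmfB => //; apply: bu|
  by apply: bmf_sqr; apply: bmfB; apply: bu].
apply: le_trans ke; have := gv k.
have sk : s k ^+ 2 <= 1 / (2 ^ k)%:R.
  have : s k <= 1 / (2 ^ k)%:R.
    by rewrite /s !div1r lef_pV2 ?posrE ?ltr0n ?expn_gt0 // ler_nat leq_exp2l.
  have : s k <= 1 by rewrite /s div1r invf_le1 ?ltr0n ?expn_gt0 // ler1n expn_gt0.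
  have := s0 k; nra.
move: k1 sk; rewrite !div1r; set a := EX _ _; set b := EX _ _; lra.
Qed.

End Completeness.

(** * Averages along the set *)

Section SetWeight.
Variables (R : realType) (k : nat) (alpha : R).
Hypotheses (k0 : (0 < k)%N) (ia : irrational alpha).

Definition Sweight (n : nat) : R := (`[< S_set k alpha n >])%:R - 1 / 10.

Lemma Sweight_le1 n : `|Sweight n| <= 1.
Proof.
by rewrite /Sweight ler_norml; case: (asbool _); rewrite ?mulr1n ?mulr0n; apply/andP; split; lra.
Qed.

Lemma I_set_range j n : I_set k alpha j n -> (2 ^ j <= n <= 2 ^ j.+1)%N.
Proof. by rewrite /I_set; case: ifP => _ []. Qed.

(** The blocks are closed and neighbours share a power of 2; strictly between two powers only one
    block is possible. *)
Lemma S_set_dyadic j n : (2 ^ j < n < 2 ^ j.+1)%N ->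
  S_set k alpha n <-> I_set k alpha j n.
Proof.
move=> /andP[jn nj]; split=> [[i /= i1 Iin]|Ijn].
  have /andP[h1 h2] := I_set_range Iin.
  suff -> : j = i by [].
  have : (2 ^ i < 2 ^ j.+1)%N by apply: leq_ltn_trans nj.
  have : (2 ^ j < 2 ^ i.+1)%N by apply: leq_trans h2.
  rewrite !ltn_exp2l // !ltnS => *; lia.
(* The union starts at j = 1, and block 0 has no interior. *)
exists j => //=; case: j jn nj {Ijn} => // n1 n2; lia.
Qed.

(** 11/20 and 3/20 are the midpoints of the two arcs. *)
Lemma Sweight_dyadic j n : (2 ^ j < n < 2 ^ j.+1)%N -> Sweight n =
  if odd j then (arc (n%:R ^+ k * alpha - 11 / 20))%:R - 1 / 10
  else (arc (n%:R ^+ k * alpha - 3 / 20))%:R - 1 / 10.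
Proof.
move=> jn; have /andP[j1 j2] := jn.
rewrite /Sweight (asbool_equiv_eq (S_set_dyadic jn)).
have R2 : (2 ^ j <= n <= 2 ^ j.+1)%N by apply/andP; split; apply: ltnW.
rewrite /I_set; case: ifP => _ /=; congr ((nat_of_bool _)%:R - _).
  rewrite arcE; last by lra.
  by rewrite /frac; set y := _ - _%:~R; apply/asboolP/idP => [[_]|h]; [|split => //]; lra.
rewrite arcE; last by lra.
by rewrite /frac; set y := _ - _%:~R; apply/asboolP/idP => [[_]|h]; [|split => //]; lra.
Qed.

Lemma Sweight_wnull l : (l < k)%N -> wnull l Sweight.
Proof.
move=> lk; have b (c : R) (n : nat) : `|(arc (n%:R ^+ k * alpha - c))%:R - 1 / 10 : R| <= 1.
  by rewrite ler_norml; case: (arc _); rewrite ?mulr1n ?mulr0n; apply/andP; split; lra.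
apply: (wnull_dyadic Sweight_le1 (b _) (b _) (arc_wnull _ ia lk) (arc_wnull _ ia lk)).
exact: Sweight_dyadic.
Qed.

Section enumeration.
Variable a : nat -> nat.
Hypothesis enum_a : increasing_enumeration (S_set k alpha) a.

Lemma enum_lt m n : (a m < a n)%N = (m < n)%N.
Proof. exact: (leqW_mono (leq_mono enum_a.1)). Qed.

Lemma enum_ge n : (n <= a n)%N.
Proof.
elim: n => // n IH; apply: leq_ltn_trans IH _; rewrite enum_lt //.
Qed.

Lemma enum_in n : S_set k alpha (a n).
Proof. by rewrite -enum_a.2; exists n. Qed.

Lemma enum_between m n : (forall i, (i < m)%N -> a i != n) -> (n < a m)%N ->
  ~ S_set k alpha n.
Proof.
move=> h nm; rewrite -enum_a.2 => -[i _ ain].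
by have := h i; rewrite ain eqxx -enum_lt ain nm => /(_ isT).
Qed.

Lemma enum_sum (t : nat -> R) M :
  \sum_(n < a M) (`[< S_set k alpha n >])%:R * t n = \sum_(i < M) t (a i).
Proof.
elim: M => [|M IH].
  rewrite big_ord0 big1 // => i _; rewrite asboolF ?mul0r //.
  exact: (@enum_between 0).
have aM : (a M < a M.+1)%N by rewrite enum_lt.
rewrite (sum_ord_split (fun n => (`[< S_set k alpha n >])%:R * t n) (ltnW aM)) IH.
rewrite big_ord_recr /=; congr (_ + _).
have -> : (a M.+1 - a M = (a M.+1 - a M).-1.+1)%N by lia.
rewrite big_ord_recl /= addn0 asboolT ?mul1r; last exact: enum_in.
rewrite big1 ?addr0 // => i _; rewrite asboolF ?mul0r //.
apply: (@enum_between M.+1); last by have := ltn_ord i; rewrite /bump /=; lia.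
move=> j jM; apply/eqP => e.
have : (a j <= a M)%N by rewrite leqNgt enum_lt -leqNgt.
by rewrite e /bump /=; lia.
Qed.

(** There are M elements below [a M], so M / a(M) is the average of the indicator over that
    range. *)
Lemma enum_density e : 0 < e -> exists M0, forall M, (M0 <= M)%N ->
  `|M%:R / (a M)%:R - 1 / 10 : R| <= e.
Proof.
move=> e0; have [N0 H] := wnull_scalar (Sweight_wnull k0) e0.
exists (maxn 1 N0) => M MM.
have aM : (maxn 1 N0 <= a M)%N by apply: leq_trans MM (enum_ge M).
have a0 : 0 < (a M)%:R :> R by rewrite ltr0n; lia.
have := H (a M); rewrite (leq_trans (leq_maxr _ _) aM) => /(_ isT).
rewrite sumrB sumr_const card_ord -[_ *+ a M]mulr_natr.
have -> : \sum_(i < a M) (`[< S_set k alpha i >])%:R = M%:R :> R.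
  have := enum_sum (fun=> 1) M; rewrite sumr_const card_ord => <-.
  by apply: eq_bigr => i _; rewrite mulr1.
by congr (`| _ | <= _); field; exact: lt0r_neq0.
Qed.

(** The indicator of the set is [Sweight] + 1/10, and the prefactor tends to 10. *)
Lemma enum_avg (X : Type) (T : X -> X) p (f : nat -> X -> R) M x : (0 < M)%N ->
  M%:R^-1 * \sum_(i < M) term T p f (a i) x =
  (a M)%:R / M%:R * (wavg T p f Sweight (a M) x + 1 / 10 * avg T p f (a M) x).
Proof.
move=> M0; have M0' : M%:R != 0 :> R by rewrite pnatr_eq0 -lt0n.
have a0 : (a M)%:R != 0 :> R.
  by rewrite pnatr_eq0 -lt0n; apply: leq_trans M0 (enum_ge M).
rewrite -(enum_sum (fun n => term T p f n x)) /wavg /avg.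
under [\sum_(n < a M) Sweight n * _]eq_bigr do rewrite /Sweight mulrBl.
rewrite sumrB -mulr_sumr; field; by rewrite ?M0' ?a0.
Qed.

End enumeration.

End SetWeight.

(** * Convergence along the set for real functions *)

Section RealConvergence.
Context (R : realType) (d : measure_display) (X : measurableType d)
  (mu : probability X R).
Variable T : X -> X.
Hypotheses (mT : measurable_fun [set: X] T)
  (muT : forall A, measurable A -> mu (T @^-1` A) = mu A).

Lemma real_convergence (k p : nat) (alpha : R) (a : nat -> nat) (f : nat -> X -> R) :
  irrational alpha -> (p < k)%N -> increasing_enumeration (S_set k alpha) a ->
  bounded1 f -> (forall i, measurable_fun [set: X] (f i)) ->
  exists g : X -> R, [/\ measurable_fun [set: X] g, forall x, `|g x| <= 1 &
    forall e, 0 < e -> exists M0, forall M, (M0 <= M)%N ->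
    EX mu (fun x => (M%:R^-1 * \sum_(n < M) term T p f (a n) x - g x) ^+ 2) <= e].
Proof.
move=> ia pk enum f1 mf; have k0 : (0 < k)%N by apply: leq_trans pk.
have bterm n : bmf (term T p f n) by apply: bmf_term.
have bavg n : bmf (avg T p f n) by apply: bmfZ; apply: bmf_sum.
have bw n : bmf (wavg T p f (Sweight k alpha) n).
  by apply: bmfZ; apply: bmf_sum => i _; apply: bmfZ.
have [g [mg g1 Hg]] := bounded_L2_complete (mu := mu) (fun n => (bavg n).1)
  (fun n x => avg_bound T p n x f1) (fun e e0 => EX_cauchy mT muT p f1 mf e0).
have bg : bmf g by split => //; exists 1.
exists g; split => // e e0.
pose m := Num.min 1 e; have m0 : 0 < m by rewrite lt_min ltr01.
have m1 : m <= 1 by rewrite ge_min lexx.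
have me : m <= e by rewrite ge_min lexx orbT.
(* With r = a(M) / M <= 20 this gives |r / 10 - 1| <= m / 10. The error splits into r w, (r / 10 -
   1) A and A - g, each allotted e / 3 after the factor 3 for the square of a sum; r^2 <= 400
   explains the 3600. *)
pose e1 := m / 200; have e10 : 0 < e1 by rewrite /e1; lra.
have [M1 H1] := enum_density k0 ia enum e10.
have [|N2 H2] := EX_wnull mT muT f1 mf (Sweight_le1 k alpha) (Sweight_wnull k0 ia pk) (e := e / 3600).
  by lra.
have [|N3 H3] := Hg (e / 9); first by lra.
exists (maxn 1 (maxn M1 (maxn N2 N3))) => M MM.
have M0 : (0 < M)%N by apply: leq_trans MM; rewrite leq_max.
have aM := leq_trans MM (enum_ge enum M).
have h1 : `|M%:R / (a M)%:R - 1 / 10 : R| <= e1 by apply: H1; apply: leq_trans MM; rewrite !leq_max leqnn !orbT.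
have h2 : EX mu (fun x => wavg T p f (Sweight k alpha) (a M) x ^+ 2) <= e / 3600.
  by apply: H2; apply: leq_trans aM; rewrite !leq_max leqnn !orbT.
have h3 : EX mu (fun x => (avg T p f (a M) x - g x) ^+ 2) <= e / 9.
  by apply: H3; apply: leq_trans aM; rewrite !leq_max leqnn !orbT.
pose r : R := (a M)%:R / M%:R.
have M0' : 0 < M%:R :> R by rewrite ltr0n.
have a0' : 0 < (a M)%:R :> R by rewrite ltr0n; apply: leq_trans aM; rewrite leq_max.
have rE : r * (M%:R / (a M)%:R) = 1 by rewrite /r; field; rewrite !lt0r_neq0.
have r0 : 0 < r by rewrite divr_gt0.
move: h1; rewrite ler_norml => /andP[h1 h1'].
have r20 : r <= 20 by rewrite /e1 in h1; nra.
have r1 : (r / 10 - 1) ^+ 2 <= e / 9.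
  have u1 : r / 10 - 1 <= m / 10 by rewrite /e1 in h1 h1'; nra.
  have u2 : - (m / 10) <= r / 10 - 1 by rewrite /e1 in h1 h1'; nra.
  nra.
pose w x := wavg T p f (Sweight k alpha) (a M) x.
apply: (@le_trans _ _ (EX mu (fun x => 1200 * w x ^+ 2 + (e / 3 + 3 * (avg T p f (a M) x - g x) ^+ 2)))).
  apply: le_EX => [||x].
  - by apply: bmf_sqr; apply: bmfB => //; apply: bmfZ; apply: bmf_sum => i _; exact: bterm.
  - apply: bmfD; first by apply: bmfZ; apply: bmf_sqr; exact: bw.
    by apply: bmfD; [exact: bmf_cst | apply: bmfZ; apply: bmf_sqr; exact: bmfB].
  rewrite (enum_avg k0 enum) // -/r -/(w x).
  have := avg_bound T p (a M) x f1; set A := avg _ _ _ _ _ => A1.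
  have -> : r * (w x + 1 / 10 * A) - g x = r * w x + (r / 10 - 1) * A + (A - g x) by field.
  set u := r * w x; set v := (r / 10 - 1) * A; set z := A - g x.
  have uw : u ^+ 2 <= 400 * w x ^+ 2.
    by rewrite /u exprMn ler_wpM2r ?sqr_ge0 //; nra.
  have vw : v ^+ 2 <= e / 9.
    apply: le_trans r1; rewrite /v exprMn ler_piMr ?sqr_ge0 //.
    by rewrite -real_normK ?num_real // expr_le1.
  have sq3 : (u + v + z) ^+ 2 <= 3 * (u ^+ 2 + v ^+ 2 + z ^+ 2).
    rewrite -subr_ge0.
    have -> : 3 * (u ^+ 2 + v ^+ 2 + z ^+ 2) - (u + v + z) ^+ 2 =
      (u - v) ^+ 2 + (u - z) ^+ 2 + (v - z) ^+ 2 by ring.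
    by rewrite !addr_ge0 ?sqr_ge0.
  lra.
have b1 : bmf (fun x => w x ^+ 2) by apply: bmf_sqr; exact: bw.
have b2 : bmf (fun x => (avg T p f (a M) x - g x) ^+ 2) by apply: bmf_sqr; apply: bmfB.
rewrite EXD; [|exact: bmfZ|by apply: bmfD; [exact: bmf_cst | exact: bmfZ]].
rewrite EXD; [|exact: bmf_cst|exact: bmfZ].
rewrite EX_cst EXZ // EXZ //.
by move: h2 h3; rewrite -/w; set A := EX _ _; set B := EX _ _; lra.
Qed.

End RealConvergence.

(** * Complex-valued functions *)

Section ComplexFunctions.
Variable R : realType.
Implicit Types z w : R[i].

Definition csq z : R := complex.Re z ^+ 2 + complex.Im z ^+ 2.

Lemma csq_ge0 z : 0 <= csq z.
Proof. by rewrite addr_ge0 ?sqr_ge0. Qed.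

Lemma cmod_csq z : cmod z = Num.sqrt (csq z).
Proof. by case: z. Qed.

Lemma ReD z w : complex.Re (z + w) = complex.Re z + complex.Re w.
Proof. by case: z; case: w. Qed.
Lemma ImD z w : complex.Im (z + w) = complex.Im z + complex.Im w.
Proof. by case: z; case: w. Qed.
Lemma ReM z w : complex.Re (z * w) =
  complex.Re z * complex.Re w - complex.Im z * complex.Im w.
Proof. by case: z; case: w. Qed.
Lemma ImM z w : complex.Im (z * w) =
  complex.Re z * complex.Im w + complex.Im z * complex.Re w.
Proof. by case: z; case: w. Qed.

Lemma Re_sum (I : Type) (r : seq I) (P : pred I) (F : I -> R[i]) :
  complex.Re (\sum_(i <- r | P i) F i) = \sum_(i <- r | P i) complex.Re (F i).
Proof. by apply: (big_morph (@complex.Re R) ReD). Qed.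
Lemma Im_sum (I : Type) (r : seq I) (P : pred I) (F : I -> R[i]) :
  complex.Im (\sum_(i <- r | P i) F i) = \sum_(i <- r | P i) complex.Im (F i).
Proof. by apply: (big_morph (@complex.Im R) ImD). Qed.

Lemma csqM z w : csq (z * w) = csq z * csq w.
Proof. rewrite /csq ReM ImM; ring. Qed.

Lemma complexE z : z = (complex.Re z)%:C%C + 'i%C * (complex.Im z)%:C%C.
Proof. by case: z => a b; apply/eqP; rewrite eq_complex ReD ImD ReM ImM /=; apply/andP; split; apply/eqP; ring. Qed.

Lemma csq_comb (J : finType) (c : J -> R[i]) (b : J -> R) :
  csq (\sum_j c j * (b j)%:C%C) <= #|J|%:R * \sum_j csq (c j) * b j ^+ 2.
Proof.
rewrite /csq Re_sum Im_sum.
have E1 j : complex.Re (c j * (b j)%:C%C) = complex.Re (c j) * b j.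
  by rewrite ReM /= mulr0 subr0.
have E2 j : complex.Im (c j * (b j)%:C%C) = complex.Im (c j) * b j.
  by rewrite ImM /= mulr0 add0r.
rewrite (eq_bigr _ (fun j _ => E1 j)) [X in _ + X ^+ 2](eq_bigr _ (fun j _ => E2 j)).
have Js (y : J -> R) : (\sum_j y j) ^+ 2 <= #|J|%:R * \sum_j y j ^+ 2.
  have := jensen_sq (v := fun=> 1) y (fun=> ler01).
  rewrite sumr_const (eq_bigr y) => [|j _]; last by rewrite mul1r.
  by rewrite [X in _ * X](eq_bigr (fun j => y j ^+ 2)) // => j _; rewrite mul1r.
apply: le_trans (lerD (Js _) (Js _)) _.
rewrite -mulrDr ler_wpM2l // -big_split; apply: ler_sum => j _ /=.
by rewrite !exprMn -mulrDl.
Qed.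

Context (d : measure_display) (X : measurableType d) (mu : probability X R).
Implicit Types f g : X -> R[i].

Lemma cmeasurable_cst z : cmeasurable (fun _ : X => z).
Proof. by split; apply: measurable_cst. Qed.

Lemma cmeasurableD f g : cmeasurable f -> cmeasurable g ->
  cmeasurable (fun x => f x + g x).
Proof.
move=> [f1 f2] [g1 g2]; split.
  by under eq_fun do rewrite ReD; apply: measurable_funD.
by under eq_fun do rewrite ImD; apply: measurable_funD.
Qed.

Lemma cmeasurableM f g : cmeasurable f -> cmeasurable g ->
  cmeasurable (fun x => f x * g x).
Proof.
move=> [f1 f2] [g1 g2]; split.
  under eq_fun do rewrite ReM.
  by apply: measurable_funB; apply: measurable_funM.
under eq_fun do rewrite ImM.
by apply: measurable_funD; apply: measurable_funM.
Qed.

Lemma cmeasurable_sum (I : Type) (r : seq I) (F : I -> X -> R[i]) :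
  (forall i, cmeasurable (F i)) -> cmeasurable (fun x => \sum_(i <- r) F i x).
Proof.
move=> mF; elim: r => [|i r IH].
  by under eq_fun do rewrite big_nil; apply: cmeasurable_cst.
by under eq_fun do rewrite big_cons; apply: cmeasurableD.
Qed.

Lemma cmeasurable_prod (I : Type) (r : seq I) (F : I -> X -> R[i]) :
  (forall i, cmeasurable (F i)) -> cmeasurable (fun x => \prod_(i <- r) F i x).
Proof.
move=> mF; elim: r => [|i r IH].
  by under eq_fun do rewrite big_nil; apply: cmeasurable_cst.
by under eq_fun do rewrite big_cons; apply: cmeasurableM.
Qed.

Lemma cmeasurable_comp f (S : X -> X) : measurable_fun [set: X] S -> cmeasurable f ->
  cmeasurable (fun x => f (S x)).
Proof. by move=> mS [f1 f2]; split; [exact: (measurableT_comp f1 mS) | exact: (measurableT_comp f2 mS)]. Qed.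

Lemma cmeasurable_real (b : X -> R) : measurable_fun [set: X] b ->
  cmeasurable (fun x => (b x)%:C%C).
Proof. by move=> mb; split => //=; apply: measurable_cst. Qed.

Lemma cmeasurable_csq f : cmeasurable f -> measurable_fun [set: X] (fun x => csq (f x)).
Proof. by move=> [f1 f2]; apply: measurable_funD; apply: measurable_funX. Qed.

Lemma cLnorm2E f : cLnorm mu 2%:E f = ((\int[mu]_x (csq (f x))%:E) `^ 2^-1)%E.
Proof.
rewrite /cLnorm unlock; congr (_ `^ _)%E; apply: eq_integral => x _ /=.
rewrite cmod_csq ger0_norm ?sqrtr_ge0 // powR_mulrn ?sqrtr_ge0 //.
by rewrite sqr_sqrtr // csq_ge0.
Qed.

Lemma cLnorm2_le f (c : R) : 0 <= c ->
  ((\int[mu]_x (csq (f x))%:E) <= (c ^+ 2)%:E)%E -> (cLnorm mu 2%:E f <= c%:E)%E.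
Proof.
move=> c0 h; rewrite cLnorm2E.
have -> : c%:E = ((c ^+ 2)%:E `^ 2^-1)%E.
  by rewrite poweR_EFin -powR_mulrn // -powRrM mulfV // powRr1.
apply: gt0_ler_poweR => //.
- rewrite in_itv /= leey andbT; apply: integral_ge0 => x _.
  by rewrite lee_fin csq_ge0.
- by rewrite in_itv /= leey andbT lee_fin sqr_ge0.
Qed.

Lemma cLnorm2_eq_ae f g : cmeasurable f -> cmeasurable g ->
  {ae mu, forall x, f x = g x} -> cLnorm mu 2%:E f = cLnorm mu 2%:E g.
Proof.
move=> mf mg fg; rewrite !cLnorm2E; congr (_ `^ _)%E.
apply: ge0_ae_eq_integral => //.
- by apply/measurable_EFinP; exact: cmeasurable_csq.
- by apply/measurable_EFinP; exact: cmeasurable_csq.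
- by move=> x _; rewrite lee_fin csq_ge0.
- by move=> x _; rewrite lee_fin csq_ge0.
by apply: filterS fg => x /= -> _.
Qed.

Lemma cvg_cLnorm2 (F : nat -> X -> R[i]) :
  (forall e, 0 < e -> exists N0, forall N, (N0 <= N)%N -> (cLnorm mu 2%:E (F N) <= e%:E)%E) ->
  cLnorm mu 2%:E (F N) @[N --> \oo] --> 0%E.
Proof.
move=> H; apply/fine_cvgP; split.
  have [N0 H0] := H 1 ltr01; exists N0 => // N /= NN.
  by rewrite ge0_fin_numE ?Lnorm_ge0 // (le_lt_trans (H0 N NN)) // ltry.
apply/cvgrPdist_le => e e0; have [N0 H0] := H e e0; exists N0 => // N /= NN.
rewrite sub0r normrN ger0_norm ?fine_ge0 ?Lnorm_ge0 //.
rewrite -lee_fin fineK ?H0 // ge0_fin_numE ?Lnorm_ge0 //.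
by rewrite (le_lt_trans (H0 N NN)) // ltry.
Qed.

(** Turns a bound almost everywhere into one at every point, as [bounded1] demands. *)
Definition clip (y : R) : R := Num.max (-1) (Num.min 1 y).

Lemma clip_bound y : `|clip y| <= 1.
Proof.
rewrite /clip ler_norml; apply/andP; split; first by rewrite le_max lexx.
by rewrite ge_max ge_min lexx andbT; lra.
Qed.

Lemma clip_id y : `|y| <= 1 -> clip y = y.
Proof.
rewrite ler_norml => /andP[h1 h2]; rewrite /clip.
by rewrite (min_idPr h2) (max_idPr h1).
Qed.

Lemma measurable_clip (b : X -> R) : measurable_fun [set: X] b ->
  measurable_fun [set: X] (fun x => clip (b x)).
Proof.
by move=> mb; apply: measurable_maxr => //; apply: measurable_minr.
Qed.

Lemma cLfun_oo_ae f : cLfun mu +oo%E f ->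
  exists C : R, 0 < C /\ {ae mu, forall x, cmod (f x) <= C}.
Proof.
move=> [mf]; rewrite /cLnorm unlock.
have m0 : (0 < mu [set: X])%E.
  by have := probability_setT mu; rewrite /= => ->; rewrite lte01.
rewrite m0 => fin; have := ess_sup_ge mu (abse \o (EFin \o (@cmod R \o f))).
move: fin; case: (ess_sup _ _) => [r| |] // _ H.
  exists (Num.max 1 r); split; first by rewrite lt_max ltr01.
  apply: filterS H => x /=; rewrite lee_fin => h.
  by rewrite le_max (le_trans (ler_norm _) h) orbT.
exists 1; split => //; apply: filterS H => x /=; by rewrite leeNy_eq.
Qed.

Lemma ae_iter (T : X -> X) (P : X -> Prop) n : measurable_fun [set: X] T ->
  (forall A, measurable A -> mu (T @^-1` A) = mu A) ->
  {ae mu, forall x, P x} -> {ae mu, forall x, P (iter n T x)}.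
Proof.
move=> mT muT; elim: n => // n IH aeP.
have [A [mA A0 PA]] := IH aeP.
exists (T @^-1` A); split.
- by rewrite -[X in measurable X]setTI; apply: mT.
- by rewrite muT.
- by move=> x nP; apply: PA => h; apply: nP; move: h; rewrite /= -iterSr.
Qed.

End ComplexFunctions.

Section ComplexConvergence.
Context (R : realType) (d : measure_display) (X : measurableType d)
  (mu : probability X R).

Lemma EXE (h : X -> R) : bmf h -> (EX mu h)%:E = (\int[mu]_x (h x)%:E)%E.
Proof.
by move=> /(bmf_integrable mu) ih; rewrite /EX /Rintegral fineK // integrable_fin_num.
Qed.

Lemma comb_cLnorm2 (J : finType) (c : J -> R[i]) (b : J -> X -> R) (e : R) : 0 <= e ->
  (forall j, bmf (b j)) ->
  #|J|%:R * \sum_j csq (c j) * EX mu (fun x => b j x ^+ 2) <= e ^+ 2 ->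
  (cLnorm mu 2%:E (fun x => (\sum_j c j * (b j x)%:C%C)%R) <= e%:E)%E.
Proof.
move=> e0 bb H; apply: cLnorm2_le => //; apply: (@le_trans _ _
  (\int[mu]_x (#|J|%:R * \sum_j csq (c j) * b j x ^+ 2)%R%:E)%E).
  have b2 : bmf (fun x => #|J|%:R * \sum_j csq (c j) * b j x ^+ 2).
    by apply: bmfZ; apply: bmf_sum => j _; apply: bmfZ; apply: bmf_sqr.
  apply: ge0_le_integral => //.
  - by move=> x _; rewrite lee_fin csq_ge0.
  - apply/measurable_EFinP; apply: cmeasurable_csq; apply: cmeasurable_sum => j.
    by apply: cmeasurableM; [exact: cmeasurable_cst | apply: cmeasurable_real; case: (bb j)].
  - by apply/measurable_EFinP; case: b2.
  - by move=> x _; rewrite lee_fin csq_comb.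
rewrite -EXE ?lee_fin; last first.
  by apply: bmfZ; apply: bmf_sum => j _; apply: bmfZ; apply: bmf_sqr.
rewrite EXZ; last by apply: bmf_sum => j _; apply: bmfZ; apply: bmf_sqr.
rewrite EX_sum => [|j _]; last by apply: bmfZ; apply: bmf_sqr.
rewrite (eq_bigr (fun j => csq (c j) * EX mu (fun x => b j x ^+ 2))) // => j _.
by rewrite EXZ //; apply: bmf_sqr.
Qed.

Variables (T : X -> X) (mT : measure_preserving mu T).

(** Almost everywhere f_o = C_o (u_o + i v_o) with u_o and v_o bounded by 1. Expanding the product
    over the choices [J] of real or imaginary part gives a fixed combination of 2^p real
    averages. *)
Lemma complex_convergence (k p : nat) (alpha : R) (a : nat -> nat) (f : 'I_p -> X -> R[i]) :
  irrational alpha -> (p < k)%N -> increasing_enumeration (S_set k alpha) a ->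
  (forall i, cLfun mu +oo%E (f i)) -> converges_in_L2 mu (multiple_average T a f).
Proof.
move=> ia pk enum Lf; have [mT1 muT] := mT.
have /choice[C HC] : forall o, exists C : R, 0 < C /\ {ae mu, forall x, cmod (f o x) <= C}.
  by move=> o; apply: cLfun_oo_ae.
pose u o x := clip (complex.Re (f o x) / C o).
pose v o x := clip (complex.Im (f o x) / C o).
(* The finite family is extended by 0 to all indices. *)
pose w (J : {ffun 'I_p -> bool}) (i : nat) (x : X) : R :=
  if insub i is Some o then (if J o then v o x else u o x) else 0.
have w1 J : bounded1 (w J).
  move=> i x; rewrite /w; case: (insub i) => [j|]; last by rewrite normr0.
  by case: (J j); apply: clip_bound.
have mw J i : measurable_fun [set: X] (w J i).
  rewrite /w; case: (insub i) => [j|]; last by exact: measurable_cst.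
  have [[mR mI] _] := Lf j; case: (J j); apply: measurable_clip.
    by apply: measurable_funM => //; exact: measurable_cst.
  by apply: measurable_funM => //; exact: measurable_cst.
pose S J M x : R := M%:R^-1 * \sum_(n < M) term T p (w J) (a n) x.
have /choice[g Hg] : forall J, exists g : X -> R,
   [/\ measurable_fun [set: X] g, forall x, `|g x| <= 1 &
    forall e, 0 < e -> exists M0, forall M, (M0 <= M)%N ->
    EX mu (fun x => (S J M x - g x) ^+ 2) <= e].
  by move=> J; apply: (real_convergence mT1 muT ia pk enum (w1 J) (mw J)).
pose c (J : {ffun 'I_p -> bool}) : R[i] :=
  (\prod_o (C o)%:C%C) * \prod_o (if J o then 'i%C else 1).
pose G x : R[i] := \sum_J c J * (g J x)%:C%C.
pose F M x : R[i] := \sum_J c J * (S J M x)%:C%C.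
have bg J : bmf (g J) by have [? ? _] := Hg J; split => //; exists 1.
have bS J M : bmf (S J M) by apply: bmfZ; apply: bmf_sum => n _; apply: bmf_term.
have mG : cmeasurable G.
  apply: cmeasurable_sum => J; apply: cmeasurableM; first exact: cmeasurable_cst.
  by apply: cmeasurable_real; case: (bg J).
have mF M : cmeasurable (F M).
  apply: cmeasurable_sum => J; apply: cmeasurableM; first exact: cmeasurable_cst.
  by apply: cmeasurable_real; case: (bS J M).
have mA M : cmeasurable (multiple_average T a f M).
  apply: cmeasurableM; first exact: cmeasurable_cst.
  apply: cmeasurable_sum => n; apply: cmeasurable_prod => i.
  by apply: cmeasurable_comp; [exact: measurable_iter | case: (Lf i)].
have aeF M : {ae mu, forall x, multiple_average T a f M x = F M x}.
  (* The bound has to hold along the whole orbit: countably many preimages of null sets are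
     discarded. *)
  have good : {ae mu, forall x, forall m o, cmod (f o (iter m T x)) <= C o}.
    apply/ae_foralln => m; apply: filter_forall => o.
    apply: (@ae_iter _ _ _ mu T (fun y => cmod (f o y) <= C o) m mT1 muT).
    by case: (HC o).
  apply: filterS good => x Hx.
  have fE o m : f o (iter m T x) = (C o)%:C%C *
      ((u o (iter m T x))%:C%C + 'i%C * (v o (iter m T x))%:C%C).
    have C0 : 0 < C o by case: (HC o).
    have Hm := Hx m o; set y := iter m T x in Hm *.
    have bound (q : R) : q ^+ 2 <= csq (f o y) -> `|q / C o| <= 1.
      move=> hq; rewrite normrM (gtr0_norm (x := (C o)^-1)) ?invr_gt0 //.
      rewrite ler_pdivrMr // mul1r; apply: le_trans Hm; rewrite cmod_csq -sqrtr_sqr.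
      by rewrite ler_wsqrtr.
    rewrite /u /v !clip_id; last 2 first.
    - by apply: bound; rewrite /csq ?lerDl ?lerDr sqr_ge0.
    - by apply: bound; rewrite /csq ?lerDl ?lerDr sqr_ge0.
    rewrite mulrDr mulrCA -!rmorphM /= !(mulrC (C o)) !divfK ?lt0r_neq0 //.
    exact: complexE.
  have prodE n : \prod_(i < p) f i (iter (i.+1 * a n) T x) =
      \sum_J c J * (term T p (w J) (a n) x)%:C%C.
    rewrite (eq_bigr _ (fun o _ => fE o _)) big_split /=.
    pose h (o : 'I_p) (b : bool) : R[i] := (if b then 'i%C else 1) *
      (if b then v o (iter (o.+1 * a n) T x) else u o (iter (o.+1 * a n) T x))%:C%C.
    rewrite [X in _ * X](eq_bigr (fun o => \sum_b h o b)); last first.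
      by move=> o _; rewrite big_bool /h /= mul1r addrC.
    rewrite bigA_distr_bigA mulr_sumr; apply: eq_bigr => J _.
    rewrite /h big_split /= mulrA; congr (_ * _).
    rewrite /term rmorph_prod; apply: eq_bigr => o _; rewrite /w.
    by rewrite valK.
  rewrite /multiple_average /F (eq_bigr _ (fun (n : 'I_M) _ => prodE n)) exchange_big mulr_sumr.
  apply: eq_bigr => J _; rewrite /S rmorphM rmorph_sum /= fmorphV rmorph_nat.
  by rewrite mulrCA -mulr_sumr.
pose K := \sum_J csq (c J); have K0 : 0 <= K by apply: sumr_ge0 => J _; exact: csq_ge0.
pose B : R := #|{ffun 'I_p -> bool}|%:R * K.
have B0 : 0 <= B by rewrite mulr_ge0.
exists G.
  split=> //; apply: (@le_lt_trans _ _ (B + 1)%:E); last exact: ltry.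
  apply: comb_cLnorm2 => //; first by rewrite addr_ge0.
  apply: (@le_trans _ _ B); last nra.
  rewrite ler_wpM2l //; apply: ler_sum => J _; rewrite ler_piMr ?csq_ge0 //.
  apply: le_trans (ler_norm _) _; apply: EX_norm_le => [|x]; first exact: bmf_sqr.
  have [_ g1 _] := Hg J.
  by rewrite ger0_norm ?sqr_ge0 // -real_normK ?num_real // expr_le1.
apply: cvg_cLnorm2 => e e0; pose e' := e ^+ 2 / (B + 1).
have e'0 : 0 < e' by rewrite divr_gt0 ?exprn_gt0 //; lra.
have /choice[M0 HM0] : forall J, exists M0, forall M, (M0 <= M)%N ->
    EX mu (fun x => (S J M x - g J x) ^+ 2) <= e'.
  by move=> J; have [_ _] := Hg J; apply.
exists (\max_J M0 J) => M MM.
rewrite (@cLnorm2_eq_ae _ _ _ _ _ (fun x => \sum_J c J * (S J M x - g J x)%:C%C)).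
- apply: comb_cLnorm2 => [|J|]; [exact: ltW|exact: bmfB|].
  apply: (@le_trans _ _ (#|{ffun 'I_p -> bool}|%:R * \sum_J csq (c J) * e')).
    rewrite ler_wpM2l //; apply: ler_sum => J _; rewrite ler_wpM2l ?csq_ge0 //.
    by apply: HM0; apply: leq_trans MM; apply: leq_bigmax.
  rewrite -mulr_suml -/K mulrA -/B /e' mulrA ler_pdivrMr; last lra.
  by rewrite mulrC ler_wpM2l ?sqr_ge0 //; lra.
- apply: cmeasurableD; first exact: mA.
  rewrite (_ : (fun x => - G x) = (fun x => -1 * G x)).
    by apply: cmeasurableM; [exact: cmeasurable_cst | exact: mG].
  by apply/funext => x; rewrite mulN1r.
- apply: cmeasurable_sum => J; apply: cmeasurableM; first exact: cmeasurable_cst.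
  by apply: cmeasurable_real; case: (bmfB (bS J M) (bg J)).
- apply: filterS (aeF M) => x ->; rewrite /F /G -sumrB; apply: eq_bigr => J _.
  by rewrite -mulrBr -rmorphB.
Qed.

End ComplexConvergence.

(** * Skew products with polynomial phases *)

Section CircleMeasure.
Variable R : realType.

Lemma measurable_frac : measurable_fun [set: R] (@frac R).
Proof.
apply: measurable_funB; first exact: measurable_id.
apply: nondecreasing_measurable => // x y xy.
by rewrite ler_int; exact: le_floor.
Qed.

Lemma frac_itv (x : R) : 0 <= frac x < 1.
Proof.
rewrite /frac subr_ge0 floor_le_tmp ltrBlDl /=.
by have := floorD1_gt x; rewrite intrD; lra.
Qed.

Lemma frac_shift (x : R) (z : int) : 0 <= x + z%:~R < 1 -> frac x = x + z%:~R.
Proof.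
move=> /andP[h0 h1]; rewrite /frac (@floor_def _ x (- z)).
  by rewrite mulrNz opprK.
by rewrite intrD mulrNz; apply/andP; split; lra.
Qed.

Local Notation lam := (@lebesgue_measure R).

Lemma lebesgue_measure_shift (c : R) (A : set R) : measurable A ->
  lam ((fun x => x + c) @^-1` A) = lam A.
Proof.
move=> mA.
have ms : measurable_fun [set: R] (fun x : R => x + c).
  by apply: measurable_funD => //; exact: measurable_cst.
transitivity (pushforward lam (fun x : measurableTypeR R => x + c : measurableTypeR R) A) => //.
apply/esym/lebesgue_measure_unique => //= _ [[a b]] _ <-.
rewrite /pushforward /=.
rewrite (_ : (fun x => x + c) @^-1` `]a, b] = `]a - c, b - c]%classic); last first.
  by apply/seteqP; split => x /=; rewrite !in_itv /= ltrBlDr lerBrDr.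
by rewrite !lebesgue_measure_itv /= !lte_fin ltrD2r -!EFinB; case: ifP => // _; congr (_%:E); ring.
Qed.

(** The circle is the line with mass on [0, 1), [frac] bringing points back; the coordinate is then
    itself a real-valued phase. *)
Definition circle : set (measurableTypeR R) -> \bar R :=
  mrestr lam (measurable_itv `[0, 1[).

HB.instance Definition _ := Measure.on circle.

Lemma circle_setT : circle setT = 1%E.
Proof.
by rewrite /circle /mrestr setTI lebesgue_measure_itv /= lte_fin ltr01 oppr0 adde0.
Qed.

HB.instance Definition _ := Measure_isProbability.Build _ _ _ circle circle_setT.

(** Modulo 1 the rotation is by t = [frac c]. Cut at 1 - t, it is a translation by t on one piece
    and by t - 1 on the other, with images in [t, 1) and [0, t). *)
Lemma circle_rotation (c : R) (A : set R) : measurable A ->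
  circle ((fun y => frac (y + c)) @^-1` A) = circle A.
Proof.
move=> mA; rewrite /circle /mrestr.
pose t := frac c; have /andP[t0 t1] : 0 <= t < 1 := frac_itv c.
have shift_meas (r : R) B : measurable B -> measurable ((fun y : R => y + r) @^-1` B : set R).
  move=> mB; rewrite -[X in measurable X]setTI.
  have ms : measurable_fun [set: R] (fun x : R => x + r).
    by apply: measurable_funD => //; exact: measurable_cst.
  exact: ms.
pose A1 := A `&` `[t, 1[%classic; pose A0 := A `&` `[0, t[%classic.
have mA1 : measurable A1 by apply: measurableI.
have mA0 : measurable A0 by apply: measurableI.
have fc1 (y : R) : 0 <= y < 1 - t -> frac (y + c) = y + t.
  move=> hy; rewrite (@frac_shift _ (- Num.floor c)) mulrNz; first by rewrite /t /frac; ring.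
  have -> : y + c - (Num.floor c)%:~R = y + t by rewrite /t /frac; ring.
  by move: hy => /andP[h0 h1]; apply/andP; split; lra.
have fc0 (y : R) : 1 - t <= y < 1 -> frac (y + c) = y + (t - 1).
  have e : y + c + (- Num.floor c - 1)%:~R = y + (t - 1).
    by rewrite /t /frac intrD !mulrNz; ring.
  move=> hy; rewrite (@frac_shift _ (- Num.floor c - 1)) e //.
  by move: hy => /andP[h0 h1]; apply/andP; split; lra.
rewrite (_ : _ `&` `[0, 1[%classic = (fun y : R => y + t) @^-1` A1 `|`
    (fun y : R => y + (t - 1)) @^-1` A0); last first.
  apply/seteqP; split => y /=.
    rewrite in_itv /= => -[Ay /andP[y0 y1]].
    have [yt|ty] := ltP y (1 - t); [left|right]; split.
    - by rewrite -fc1 // y0.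
    - by rewrite /= in_itv /=; lra.
    - by rewrite -fc0 // ty.
    - by rewrite /= in_itv /=; lra.
  case=> -[Ay]; rewrite /= !in_itv /= => /andP[y0 y1].
    by rewrite fc1; [split => //; lra | lra].
  by rewrite fc0; [split => //; lra | lra].
rewrite (_ : A `&` `[0, 1[%classic = A1 `|` A0); last first.
  rewrite /A1 /A0 -setIUr; congr (_ `&` _); apply/seteqP; split => y /=.
    rewrite !in_itv /= => /andP[y0 y1].
    have [yt|ty] := ltP y t; [right|left]; rewrite /= ?in_itv /=; lra.
  by case; rewrite !in_itv /= => /andP[y0 y1]; apply/andP; split; lra.
have d1 : (fun y : R => y + t) @^-1` A1 `&` (fun y : R => y + (t - 1)) @^-1` A0 = set0.
  apply/seteqP; split => // y [[_ /=]]; rewrite in_itv /= => /andP[h1 h2] [_ /=].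
  by rewrite in_itv /= => /andP[h3 h4]; exfalso; lra.
have d2 : A1 `&` A0 = set0.
  apply/seteqP; split => // y [[_ /=]]; rewrite in_itv /= => /andP[h1 h2] [_ /=].
  by rewrite in_itv /= => /andP[h3 h4]; exfalso; lra.
have mB1 := shift_meas t A1 mA1; have mB0 := shift_meas (t - 1) A0 mA0.
have m1 := measureU lam mB1 mB0 d1; have m2 := measureU lam mA1 mA0 d2.
apply: (etrans m1); apply: (etrans _ (esym m2)).
by congr (_ + _)%E; apply: lebesgue_measure_shift.
Qed.

Fixpoint diff (j : nat) (s : nat -> R) : nat -> R :=
  if j is j'.+1 then diff j' (fun n => s n.+1 - s n) else s.

Lemma diffD j s t n : diff j (fun n => s n + t n) n = diff j s n + diff j t n.
Proof.
elim: j s t => //= j IH s t; rewrite -IH; congr (diff j _ n).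
by apply/funext => m; ring.
Qed.

Lemma diff_int j (z : nat -> int) n : exists m : int, diff j (fun n => (z n)%:~R) n = m%:~R.
Proof.
elim: j z => [|j IH] z /=; first by exists (z n).
have [m Hm] := IH (fun n => z n.+1 - z n); exists m; rewrite -Hm.
by congr (diff j _ n); apply/funext => i; rewrite intrB.
Qed.

(* A skew product over the previous system by a circle rotation turns the phase
   [g] into the difference of the new phase. *)
Lemma polynomial_system (alpha : R) (j : nat) :
  exists (d : measure_display) (X : measurableType d) (mu : probability X R)
    (T : X -> X) (g : X -> R),
  [/\ measure_preserving mu T, measurable_fun [set: X] g &
  forall x n, exists z : int, diff j (fun n => g (iter n T x)) n = alpha + z%:~R].
Proof.
elim: j => [|j [d [X [mu [T [g [[mT muT] mg Hg]]]]]]].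
  exists _, (measurableTypeR R), circle, id, (fun=> alpha); split.
  - by split=> [|A _ //]; apply: measurable_id.
  - exact: measurable_cst.
  - by move=> x n; exists 0; rewrite /= addr0.
pose S (z : X * measurableTypeR R) : X * measurableTypeR R := (T z.1, frac (z.2 + g z.1)).
have mS : measurable_fun setT S.
  apply/measurable_fun_pairP; split.
    exact: (measurableT_comp mT measurable_fst).
  apply: (measurableT_comp measurable_frac).
  by apply: measurable_funD; [exact: measurable_snd | exact: (measurableT_comp mg measurable_fst)].
exists _, (X * measurableTypeR R)%type, (mu \x circle)%E, S, (fun z => z.2); split.
- split=> // A mA.
  rewrite /product_measure1 /=.
  (* The section over x of the preimage of A is the section of A over T x, rotated by g x;
     invariance of [circle] acts fibrewise and that of [mu] on the base. *)
  transitivity (\int[mu]_x (circle \o xsection A) (T x))%E.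
    apply: eq_integral => x _ /=.
    rewrite -(circle_rotation (g x) (measurable_xsection (T x) mA)).
    by congr circle.
  have mphi : measurable_fun setT (circle \o xsection A) by apply: measurable_fun_xsection.
  rewrite -(@ge0_integral_pushforward _ _ X X R T mT mu setT (circle \o xsection A)) //.
  by apply: eq_measure_integral => B mB _; apply: muT.
- exact: measurable_snd.
move=> [x y] n.
have Sx m : (iter m S (x, y)).1 = iter m T x by elim: m => //= m ->.
have /choice[z Hz] : forall m, exists z : int,
    (iter m.+1 S (x, y)).2 - (iter m S (x, y)).2 = g (iter m T x) + z%:~R.
  move=> m; exists (- Num.floor ((iter m S (x, y)).2 + g (iter m T x))).
  by rewrite /= Sx /frac mulrNz; ring.
have [z1 Hz1] := Hg x n; have [z2 Hz2] := diff_int j z n.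
exists (z1 + z2); rewrite /= (_ : (fun m => _) = (fun m => g (iter m T x) + (z m)%:~R)).
  by rewrite diffD Hz1 Hz2 intrD addrA.
by apply/funext => m; rewrite -Hz.
Qed.

End CircleMeasure.

(** * Differences of step n *)

Section Differences.
Variable R : realType.

Fixpoint diffn (n j : nat) (s : nat -> R) (m : nat) : R :=
  if j is j'.+1 then diffn n j' (fun m => s (m + n)%N - s m) m else s m.

(** The same integers serve every step n, so the functions e(c_i g) can be fixed before n. The
    recursion is that of signed binomial coefficients. *)
Lemma diffn_coef j : exists c : nat -> int, forall n s m,
  diffn n j s m = \sum_(i < j.+1) (c i)%:~R * s (m + i * n)%N.
Proof.
elim: j => [|j [c IH]].
  by exists (fun=> 1) => n s m; rewrite big_ord1 /= mul0n addn0 mul1r.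
pose c1 i : int := if i is i'.+1 then c i' else 0.
pose c2 i : int := if (i < j.+1)%N then c i else 0.
exists (fun i => c1 i - c2 i) => n s m; rewrite /= IH.
under [RHS]eq_bigr do rewrite intrB mulrBl.
rewrite sumrB [X in _ = X - _]big_ord_recl [X in _ = _ - X]big_ord_recr /=.
rewrite /c2 ltnn !mul0r add0r addr0 -sumrB; apply: eq_bigr => i _.
by rewrite ltn_ord mulrBr /bump /= add1n mulSn [(n + _)%N]addnC addnA.
Qed.

Lemma diffn_sum n j q (t : nat -> nat -> R) m :
  diffn n j (fun m => \sum_(r < q) t r m) m = \sum_(r < q) diffn n j (t r) m.
Proof.
elim: j t m => //= j IH t m; rewrite -(IH (fun r m => t r (m+n)%N - t r m)); congr (diffn n j _ m).
by apply/funext => i; rewrite sumrB.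
Qed.

Lemma diff_shift j s r m : diff j (fun n => s (n + r)%N) m = diff j s (m + r) :> R.
Proof.
elim: j s => //= j IH s; rewrite -(IH (fun n => s n.+1 - s n)).
by congr (diff j _ m); apply/funext => i; rewrite addSn.
Qed.

(** A difference of step n is the sum of n shifted unit differences, so each of the j differences
    multiplies the constant by n, while integer errors stay integers. *)
Lemma diffn_diff n j (alpha : R) (s : nat -> R) :
  (forall m, exists z : int, diff j s m = alpha + z%:~R) ->
  forall m, exists z : int, diffn n j s m = n%:R ^+ j * alpha + z%:~R.
Proof.
elim: j s => [|j IH] s H m; first by have [z Hz] := H m; exists z; rewrite expr0 mul1r.
have tel i : s (i + n)%N - s i = \sum_(r < n) (s (i + r).+1 - s (i + r)%N).
  rewrite -(big_mkord xpredT (fun r => s (i + r).+1 - s (i + r)%N)).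
  under eq_bigr do rewrite -addnS.
  by rewrite (telescope_sumr (fun r => s (i + r)%N)) // addn0.
rewrite /= (_ : (fun i => _) = (fun i => \sum_(r < n) (s (i + r).+1 - s (i + r)%N))); last first.
  by apply/funext => i; exact: tel.
rewrite (diffn_sum n j n (fun r i => s (i + r).+1 - s (i + r)%N)).
have /choice[z Hz] : forall r, exists z : int,
    diffn n j (fun i => s (i + r).+1 - s (i + r)%N) m = n%:R ^+ j * alpha + z%:~R.
  move=> r; apply: (IH (fun i => s (i + r).+1 - s (i + r)%N)) => i.
  have [z Hz] := H (i + r)%N; exists z; rewrite -Hz /=.
  exact: (diff_shift j (fun i => s i.+1 - s i)).
exists (\sum_(r < n) z r); rewrite (eq_bigr _ (fun (r : 'I_n) _ => Hz r)).
rewrite big_split /= sumr_const card_ord -[_ *+ n]mulr_natl mulrA -exprS; congr (_ + _).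
by rewrite (big_morph _ (intrD R) (erefl _)).
Qed.

End Differences.

(** * Unimodular functions *)

Section UnitCircle.
Variable R : realType.

Definition ec (t : R) : R[i] := (cyc t +i* syc t)%C.

Lemma ecD s t : ec (s + t) = ec s * ec t.
Proof.
apply/eqP; rewrite eq_complex /= /cyc /syc mulrDr cosD sinD.
by apply/andP; split; apply/eqP; ring.
Qed.

Lemma ec_int t (z : int) : ec (t + z%:~R) = ec t.
Proof. by rewrite /ec cycDint sycDint. Qed.

Lemma csq_ec t : csq (ec t) = 1.
Proof. exact: cyc_sq. Qed.

Lemma ec_sum (I : Type) (r : seq I) (F : I -> R) :
  ec (\sum_(i <- r) F i) = \prod_(i <- r) ec (F i).
Proof.
elim: r => [|i r IH]; last by rewrite !big_cons ecD IH.
by rewrite !big_nil /ec /cyc /syc mulr0 cos0 sin0.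
Qed.

Context (d : measure_display) (X : measurableType d) (mu : probability X R).

Lemma cmeasurable_ec (g : X -> R) (r : R) : measurable_fun [set: X] g ->
  cmeasurable (fun x => ec (r * g x)).
Proof.
move=> mg.
have mh : measurable_fun [set: X] (fun x => pi *+ 2 * (r * g x)).
  by apply: measurable_funM; [|apply: measurable_funM => //]; exact: measurable_cst.
have mc : measurable_fun [set: R] (@cos R).
  by apply: continuous_measurable_fun => x; exact: continuous_cos.
have ms : measurable_fun [set: R] (@sin R).
  by apply: continuous_measurable_fun => x; exact: continuous_sin.
by split; [exact: (measurableT_comp mc mh) | exact: (measurableT_comp ms mh)].
Qed.

Lemma cLfun_ec (g : X -> R) (r : R) : measurable_fun [set: X] g ->
  cLfun mu +oo%E (fun x => ec (r * g x)).
Proof.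
move=> mg; split; first exact: cmeasurable_ec.
rewrite /cLnorm unlock; case: ifP => // _.
apply: (@le_lt_trans _ _ 1%:E); last exact: ltry.
have -> : @cmod R \o (fun x => ec (r * g x)) = cst 1.
  by apply/funext => x; rewrite [LHS]/comp cmod_csq csq_ec sqrtr1.
apply/ess_supP; apply: aeW => x /=.
by rewrite lee_fin normr1.
Qed.

(** Since |ph| = 1, at every x the distance of s N and s M is that of ph s N and ph s M; integrating
    the triangle inequality through the limit function gives the claim. *)
Lemma csq_scalar_cauchy (ph : X -> R[i]) (s : nat -> R[i]) :
  cmeasurable ph -> (forall x, csq (ph x) = 1) ->
  converges_in_L2 mu (fun N x => ph x * s N) ->
  forall e, 0 < e -> exists N0, forall N M, (N0 <= N)%N -> (N0 <= M)%N ->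
  csq (s N - s M) <= e.
Proof.
move=> mph ph1 [G [mG _] cvG] e e0.
pose F N x := ph x * s N - G x.
have mF N : cmeasurable (F N).
  apply: cmeasurableD; first by apply: cmeasurableM => //; exact: cmeasurable_cst.
  rewrite (_ : (fun x => - G x) = (fun x => -1 * G x)).
    by apply: cmeasurableM; [exact: cmeasurable_cst | exact: mG].
  by apply/funext => x; rewrite mulN1r.
pose h := Num.sqrt (e / 4).
have h0 : 0 < h by rewrite sqrtr_gt0 divr_gt0.
have [N0 HN] : exists N0, forall N, (N0 <= N)%N -> (cLnorm mu 2%:E (F N) <= h%:E)%E.
  have /fine_cvgP[[N1 _ H1] /cvgrPdist_le /(_ h h0) [N2 _ H2]] := cvG.
  exists (maxn N1 N2) => N; rewrite geq_max => /andP[n1 n2].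
  have f1 := H1 N n1; have := H2 N n2 => /=.
  rewrite sub0r normrN -lee_fin => /(le_trans _) H.
  rewrite -(fineK f1); apply: H; rewrite lee_fin; exact: ler_norm.
have int N : (N0 <= N)%N -> ((\int[mu]_x (csq (F N x))%:E) <= (e / 4)%:E)%E.
  move=> /HN; rewrite cLnorm2E => H.
  have i0 : (0 <= \int[mu]_x (csq (F N x))%:E)%E.
    by apply: integral_ge0 => x _; rewrite lee_fin csq_ge0.
  apply: (@le_trans _ _ ((\int[mu]_x (csq (F N x))%:E) `^ 2^-1 `^ 2)%E).
    by rewrite -poweRrM mulVf // poweRe1.
  apply: le_trans (gt0_ler_poweR _ _ _ H) _ => //.
  - by rewrite in_itv /= leey andbT poweR_ge0.
  - by rewrite in_itv /= leey andbT lee_fin ltW.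
  have e4 : 0 <= e / 4 by apply: divr_ge0 => //; exact: ltW.
  rewrite poweR_EFin lee_fin powR_mulrn ?(ltW h0) // sqr_sqrtr; [exact: lexx|exact: e4].
exists N0 => N M nN nM.
have mcsq K : measurable_fun [set: X] (fun x => (csq (F K x))%:E).
  by apply/measurable_EFinP; exact: cmeasurable_csq.
have pw x : csq (s N - s M) <= 2 * csq (F N x) + 2 * csq (F M x).
  have -> : csq (s N - s M) = csq (F N x - F M x).
    rewrite -[LHS]mul1r -(ph1 x) -csqM; congr csq; rewrite /F; ring.
  rewrite /csq; case: (F N x) (F M x) => [a b] [a' b'] /=.
  have := sqr_ge0 (a + a'); have := sqr_ge0 (b + b'); lra.
rewrite -lee_fin.
have -> : (csq (s N - s M))%:E = (\int[mu]_x (cst (csq (s N - s M))%:E x))%E.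
  rewrite integral_cst // -[LHS]mule1; congr (_ * _)%E.
  exact/esym/(probability_setT mu).
apply: (@le_trans _ _ (\int[mu]_x (2%:E * (csq (F N x))%:E + 2%:E * (csq (F M x))%:E))%E).
  apply: ge0_le_integral => //.
  - by move=> x _; rewrite lee_fin csq_ge0.
  - by apply: emeasurable_funD; apply: measurable_funeM.
  - by move=> x _; rewrite -!EFinM -EFinD lee_fin.
rewrite ge0_integralD //; last 4 first.
- by move=> x _; rewrite -EFinM lee_fin mulr_ge0 ?csq_ge0.
- exact: measurable_funeM.
- by move=> x _; rewrite -EFinM lee_fin mulr_ge0 ?csq_ge0.
- exact: measurable_funeM.
rewrite !ge0_integralZl //; try by move=> x _; rewrite lee_fin csq_ge0.
have -> : e%:E = (2%:E * (e / 4)%:E + 2%:E * (e / 4)%:E)%E.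
  by rewrite -!EFinM -EFinD; congr (_%:E); field.
by apply: leeD; apply: lee_wpmul2l => //; apply: int.
Qed.

End UnitCircle.

(** * Oscillation of the averages of the phases *)

(** If the averages at both ends of a block are within e of w > 0, the block sum d Y' - c Y is at
    least (d - c) w - (c + d) e, with d - c >= 7/100 p and c + d <= 33/100 p. As it is at most 2 <=
    2 p e, this gives 7 w <= 233 e. *)
Lemma dyadic_block_bound (R : realType) (p e c d w Y Y' : R) : 0 < e -> 1 <= p * e ->
  9 / 100 * p <= c <= 11 / 100 * p -> 18 / 100 * p <= d <= 22 / 100 * p ->
  `|Y - w| <= e -> `|Y' - w| <= e -> d * Y' - c * Y <= 2 -> w <= 34 * e.
Proof.
move=> e0 pe /andP[c1 c2] /andP[d1 d2] /ler_normlP[y1 y2] /ler_normlP[z1 z2] ub.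
have p0 : 0 < p by rewrite -(pmulr_lgt0 _ e0) (lt_le_trans ltr01).
have u1 : d * (w - e) <= d * Y' by apply: ler_wpM2l; lra.
have u2 : c * Y <= c * (w + e) by apply: ler_wpM2l; lra.
have u3 : (c + d) * e <= 33 / 100 * p * e by apply: ler_wpM2r; lra.
rewrite leNgt; apply/negP => we.
have u4 : 7 / 100 * p * w <= (d - c) * w by apply: ler_wpM2r; lra.
have : p * (34 * e) < p * w by rewrite ltr_pM2l.
clear -pe u1 u2 u3 u4 ub; lra.
Qed.

Lemma dyadic_range j (m : 'I_(2 * 2 ^ j - 2 ^ j)) : (2 ^ j <= 2 ^ j + m < 2 ^ j.+1)%N.
Proof.
case: m => m; rewrite /= leq_addr expnS mulSn mul1n addnK => mP.
by rewrite ltn_add2l.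
Qed.

Section Oscillation.
Variables (R : realType) (k : nat) (alpha : R).
Hypotheses (k0 : (0 < k)%N) (ia : irrational alpha).

Let chi n : R := (`[< S_set k alpha n >])%:R.
Let t n : R := syc (n%:R ^+ k * alpha).
Let count N : R := \sum_(n < N) chi n.

Lemma syc_frac (y : R) : syc y = syc (frac y).
Proof. by rewrite /frac -mulrNz sycDint. Qed.

Lemma syc_tenth : 0 < syc (1 / 10 : R).
Proof. by have p0 := pi_gt0 R; apply: sin_gt0_pi; apply/andP; split; lra. Qed.

Lemma syc_rise (y : R) : 1 / 10 <= frac y <= 2 / 10 -> syc (1 / 10) <= syc y.
Proof.
have sE x : syc x = cyc (1 / 4 - x) :> R by rewrite syc_cyc /cyc -cosN -mulrN opprB.
by rewrite (syc_frac y) !sE => /andP[h1 h2]; rewrite le_cyc; lra.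
Qed.

Lemma syc_neg (y : R) : 5 / 10 <= frac y <= 6 / 10 -> syc y <= 0.
Proof.
rewrite (syc_frac y) => /andP[h1 h2].
have -> : 0 = syc (1 / 2) :> R.
  by rewrite /syc (_ : pi *+ 2 * _ = pi) ?sinpi //; lra.
by rewrite !syc_cyc le_cyc; lra.
Qed.

(** At n = 2^j membership may come from the preceding even block, where the sine is positive; the
    delta absorbs this term. *)
Lemma odd_block j n : odd j -> (2 ^ j <= n < 2 ^ j.+1)%N ->
  chi n * t n <= (n == 2 ^ j)%N%:R.
Proof.
move=> oj /andP[n1 n2]; rewrite /chi; case: asboolP => Sn; last by rewrite mul0r.
rewrite mul1r; case: eqP => e; first exact: le_trans (ler_norm _) (syc_le1 _).
have H := S_set_dyadic alpha k0 (ltac:(lia) : (2 ^ j < n < 2 ^ j.+1)%N).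
by move: Sn; rewrite H /I_set oj => -[_ /syc_neg].
Qed.

Lemma even_block j n : ~~ odd j -> (2 ^ j <= n < 2 ^ j.+1)%N ->
  syc (1 / 10) * chi n - 2 * (n == 2 ^ j)%N%:R <= chi n * t n.
Proof.
move=> oj /andP[n1 n2]; rewrite /chi; case: asboolP => Sn; last first.
  by rewrite mulr0 mul0r; case: (_ == _) => /=; rewrite ?mulr1n ?mulr0n; lra.
rewrite (_ : true%:R = 1) // [1 * t n]mul1r [_ * 1]mulr1; case: eqP => e.
  have /ler_normlP[_ s1] := syc_le1 (1 / 10 : R).
  have /ler_normlP[t1 _] := syc_le1 (n%:R ^+ k * alpha).
  by rewrite (_ : true%:R = 1) // /t; lra.
have H := S_set_dyadic alpha k0 (ltac:(lia) : (2 ^ j < n < 2 ^ j.+1)%N).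
by move: Sn; rewrite H /I_set (negbTE oj) mulr0 subr0 => -[_ /syc_rise].
Qed.

Lemma count_density e : 0 < e -> exists N0, forall N, (N0 <= N)%N ->
  `|count N - N%:R / 10| <= e * N%:R.
Proof.
move=> e0; have [N0 H] := wnull_scalar (Sweight_wnull k0 ia k0) e0.
exists (maxn 1 N0) => N; rewrite geq_max => /andP[N1 /H].
have a0 : 0 < N%:R :> R by rewrite ltr0n.
have -> : count N - N%:R / 10 = N%:R^-1 * (\sum_(n < N) Sweight k alpha n) * N%:R.
  rewrite sumrB sumr_const card_ord -[_ *+ N]mulr_natr -/(count N).
  by field; exact: lt0r_neq0.
by move=> h; rewrite normrM (gtr0_norm a0) ler_pM2r.
Qed.

Lemma S_set_unbounded m : exists n, (m <= n)%N && `[< S_set k alpha n >].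
Proof.
apply: contrapT => none.
have [N0 H] := @count_density (1 / 100) ltac:(lra).
pose N := maxn N0 (20 * m.+1).
have := H N (leq_maxl _ _); rewrite ler_norml => /andP[lo _].
have Nm : 20 * (m%:R + 1) <= N%:R :> R by rewrite natr1 -natrM ler_nat leq_maxr.
have m0 : 0 <= m%:R :> R by [].
suff : count N <= m%:R by move: lo; lra.
have mN : (m <= N)%N by rewrite /N; lia.
rewrite /count (sum_ord_split chi mN) [X in _ + X]big1 ?addr0 => [|i _].
  rewrite -[X in _ <= X]mulr_natl mulr1 -[X in _ <= X%:R]card_ord -sumr_const.
  by apply: ler_sum => i _; rewrite /chi; case: asbool; rewrite ?ler01.
rewrite /chi asboolF // => Si; apply: none; exists (m + i)%N.
by rewrite leq_addr; exact/asboolP.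
Qed.

Lemma block_sum_delta P : (0 < P)%N ->
  \sum_(m < 2 * P - P) ((P + m == P)%N)%:R = 1 :> R.
Proof.
move=> P0; have -> : (2 * P - P = P.-1.+1)%N by lia.
rewrite big_ord_recl /= addn0 eqxx big1 ?addr0 // => i _.
by rewrite /bump /=; case: eqP => //; lia.
Qed.

Section Enumeration.
Variable a : nat -> nat.
Hypothesis enum_a : increasing_enumeration (S_set k alpha) a.

Let y N : R := N%:R^-1 * \sum_(i < N) t (a i).

(** M is least with N <= a(M), so the elements below N are exactly the first M. *)
Lemma block_index N : exists M, forall u : nat -> R,
  \sum_(n < N) chi n * u n = \sum_(i < M) u (a i).
Proof.
have ex : exists M, (N <= a M)%N by exists N; exact: (enum_ge enum_a).
have [M hM minM] := ex_minnP ex; exists M => u.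
rewrite -(enum_sum k0 enum_a) (sum_ord_split (fun n => (`[< S_set k alpha n >])%:R * u n) hM).
rewrite [X in _ = _ + X]big1 ?addr0 // => i _; rewrite asboolF ?mul0r //.
apply: (enum_between enum_a (m := M)); last by have := ltn_ord i; lia.
by move=> r rM; apply/eqP => ar; have := minM r; rewrite ar; lia.
Qed.

Lemma block_average N : exists2 M : nat, count N = M%:R &
  \sum_(n < N) chi n * t n = count N * y M.
Proof.
have [M HM] := block_index N.
have cM : count N = M%:R.
  have := HM (fun=> 1); rewrite sumr_const card_ord => <-.
  by apply: eq_bigr => n _; rewrite mulr1.
exists M => //; rewrite HM cM /y; case: M {HM cM} => [|M].
  by rewrite big_ord0 mul0r.
by rewrite mulrA mulfV ?mul1r // pnatr_eq0.
Qed.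

(** Were the averages eventually within e = s / 100 of w = y N0, an odd block would give w <= 34 e
    and an even one, through s - y, would give s - w <= 34 e; hence s <= 68 e, against s = 100 e. *)
Lemma oscillation : exists2 e : R, 0 < e & forall N0, exists N M,
  [/\ (N0 <= N)%N, (N0 <= M)%N & e < `|y N - y M|].
Proof.
have s0 := syc_tenth; set s := syc (1 / 10) in s0 *.
exists (s / 100); first by rewrite divr_gt0.
set e := s / 100; have e0 : 0 < e by rewrite divr_gt0.
have es : s = 100 * e by rewrite /e; field.
apply: contrapT => nosc.
have [N0 H] : exists N0, forall N M, (N0 <= N)%N -> (N0 <= M)%N -> `|y N - y M| <= e.
  apply: contrapT => h; apply: nosc => N0; apply: contrapT => h'; apply: h.
  exists N0 => N M n1 n2; rewrite leNgt; apply/negP => h; apply: h'.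
  by exists N, M.
have [Nd Hd] := @count_density (1 / 100) ltac:(lra).
(* Beyond [B] the density estimate holds, at least 9/100 P >= N0 elements lie below P, and P e >=
   1. *)
pose B := maxn (maxn Nd (20 * N0)) (Num.truncn (e^-1)).+1.
have big P : (B <= P)%N -> [/\ (Nd <= P)%N, (20 * N0 <= P)%N & 1 <= P%:R * e].
  rewrite !geq_max => /andP[/andP[-> ->] h]; split => //.
  rewrite -ler_pdivrMr // mul1r; apply/ltW.
  apply: lt_le_trans (truncnS_gt _) _; by rewrite ler_nat.
have blk P : (B <= P)%N ->
    exists Y : R, exists Y' : R, [/\ `|Y - y N0| <= e, `|Y' - y N0| <= e,
    9 / 100 * P%:R <= count P <= 11 / 100 * P%:R,
    18 / 100 * P%:R <= count (2 * P) <= 22 / 100 * P%:R &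
    \sum_(m < 2 * P - P) chi (P + m) * t (P + m) = count (2 * P) * Y' - count P * Y].
  move=> /[dup] BP /big[P1 P2 P3].
  have := Hd (2 * P)%N; rewrite (_ : Nd <= 2 * P)%N => [/(_ isT)|]; last by lia.
  have := Hd P P1; rewrite natrM !ler_norml => /andP[c1 c2] /andP[d1 d2].
  have P0 : 20 * N0%:R <= P%:R :> R by rewrite -natrM ler_nat.
  have N00 : 0 <= N0%:R :> R by [].
  have [M cM ZM] := block_average P; have [M' cM' ZM'] := block_average (2 * P).
  exists (y M), (y M'); split.
  - by apply: H => //; rewrite -(ler_nat R) -cM; lra.
  - by apply: H => //; rewrite -(ler_nat R) -cM'; lra.
  - by apply/andP; split; lra.
  - by apply/andP; split; lra.
  - have := sum_ord_split (fun n => chi n * t n) (leq_pmull P (isT : 0 < 2)%N).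
    by rewrite ZM ZM' => ->; rewrite addrC addKr.
have bigj j : (B <= j)%N -> (B <= 2 ^ j)%N.
  by move=> h; apply: leq_trans h _; apply/ltnW/ltn_expl.
have cD P : \sum_(m < 2 * P - P) chi (P + m) = count (2 * P) - count P.
  by rewrite /count (sum_ord_split chi (leq_pmull P (isT : 0 < 2)%N)) addrC addKr.
have up : y N0 <= 34 * e.
  have BP := bigj (2 * B).+1 ltac:(lia).
  have [_ _ Pe] := big _ BP; have [Y [Y' [Yw Yw' c1 d1 Z]]] := blk _ BP.
  apply: (dyadic_block_bound e0 Pe c1 d1 Yw Yw'); rewrite -Z.
  apply: (@le_trans _ _ 1) => //; last by rewrite ler1n.
  rewrite -(@block_sum_delta (2 ^ (2 * B).+1)) ?expn_gt0 //; apply: ler_sum => m _.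
  by apply: odd_block (dyadic_range m); rewrite /= oddM.
have lo : s - y N0 <= 34 * e.
  have BP := bigj (2 * B)%N ltac:(lia).
  have [_ _ Pe] := big _ BP; have [Y [Y' [Yw Yw' c1 d1 Z]]] := blk _ BP.
  have sub x w : (s - x) - (s - w) = w - x by ring.
  apply: (dyadic_block_bound (Y := s - Y) (Y' := s - Y') e0 Pe c1 d1).
  - by rewrite sub distrC.
  - by rewrite sub distrC.
  set P := (2 ^ (2 * B))%N in Z *.
  have : s * (count (2 * P) - count P) - 2 <= \sum_(m < 2 * P - P) chi (P + m) * t (P + m).
    have -> : 2 = 2 * \sum_(m < 2 * P - P) ((P + m == P)%N)%:R :> R.
      by rewrite block_sum_delta ?mulr1 // expn_gt0.
    rewrite -cD !mulr_sumr -sumrB.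
    apply: ler_sum => m _.
    by apply: even_block (dyadic_range m); rewrite /= oddM.
  by rewrite Z; clear; lra.
by move: s0 up lo; clear -es; lra.
Qed.

End Enumeration.
End Oscillation.

Lemma unbounded_infinite (S : set nat) : (forall m, exists n, (m <= n)%N && `[< S n >]) ->
  infinite_set S.
Proof.
move=> Su /finite_seqP[s Ss]; have [n /andP[bn /asboolP]] := Su (\max_(i <- s) i).+1.
rewrite Ss /= => ns; have := @leq_bigmax_seq _ s xpredT id n ns isT.
by rewrite /= leqNgt bn.
Qed.

Lemma unbounded_enumeration (S : set nat) :
  (forall m, exists n, (m <= n)%N && `[< S n >]) -> exists a, increasing_enumeration S a.
Proof.
move=> Su; pose next m := ex_minn (Su m).
have nextP m : [/\ (m <= next m)%N, S (next m) &
    forall n, (m <= n)%N -> S n -> (next m <= n)%N].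
  rewrite /next; case: ex_minnP => n /andP[mn /asboolP Sn] min_n; split=> // r mr Sr.
  by apply: min_n; rewrite mr; exact/asboolP.
pose a := fix a n := if n is n'.+1 then next (a n').+1 else next 0.
have aS n : (a n < a n.+1)%N by have [] := nextP (a n).+1.
exists a; split.
  apply: (homo_ltn (r := fun x y => (x < y)%N)) => //; exact: ltn_trans.
apply/seteqP; split=> [_ [[|n] _ <-]|n Sn]; first by have [] := nextP 0.
  by have [] := nextP (a n).+1.
have an r : (r <= a r)%N.
  by elim: r => // r IH; exact: leq_ltn_trans IH (aS r).
have ex : exists r, (n <= a r)%N by exists n.
have [[|r] nr mr] := ex_minnP ex.
  exists 0 => //; apply/eqP; rewrite eqn_leq nr andbT.
  by have [_ _] := nextP 0; apply.
exists r.+1 => //; apply/eqP; rewrite eqn_leq nr andbT.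
have [_ _] := nextP (a r).+1; apply=> //.
by rewrite ltnNge; apply/negP => /mr; rewrite ltnn.
Qed.

Lemma S_set_nonconvergent (R : realType) (k : nat) (alpha : R) (a : nat -> nat) :
  (0 < k)%N -> irrational alpha -> increasing_enumeration (S_set k alpha) a ->
  exists (d : measure_display) (X : measurableType d) (mu : probability X R)
    (T : X -> X) (f : 'I_k -> X -> R[i]),
  [/\ measure_preserving mu T, forall i, cLfun mu +oo%E (f i) &
  ~ converges_in_L2 mu (multiple_average T a f)].
Proof.
move=> k0 ia enum_a.
have [d [X [mu [T [g [mT mg Hg]]]]]] := polynomial_system alpha k.
have [c Hc] := @diffn_coef R k.
exists d, X, mu, T, (fun i x => ec ((c i.+1)%:~R * g x)); split => //.
  by move=> i; exact: cLfun_ec.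
pose s N : R[i] := N%:R^-1 * \sum_(n < N) ec ((a n)%:R ^+ k * alpha).
(* The term i = 0 of the difference is taken at x itself and does not depend on n; moved to the
   other side it becomes the unimodular factor. *)
pose ph x := ec (- (c 0)%:~R * g x).
have term_eq n x : \prod_(i < k) ec ((c i.+1)%:~R * g (iter (i.+1 * n) T x)) =
    ph x * ec (n%:R ^+ k * alpha).
  have [z Hz] := @diffn_diff R n k alpha (fun m => g (iter m T x)) (Hg x) 0.
  rewrite -(ec_int _ z) -Hz Hc /ph -ecD big_ord_recl /=. rewrite mulNr addKr ec_sum.
  by apply: eq_bigr => i _; rewrite add0n.
have avg_eq : multiple_average T a (fun (i : 'I_k) x => ec ((c i.+1)%:~R * g x)) =
    (fun N x => ph x * s N).
  apply/funext => N; apply/funext => x; rewrite /multiple_average /s mulrCA; congr (_ * _).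
  by rewrite mulr_sumr; apply: eq_bigr => n _; rewrite term_eq.
rewrite avg_eq => /csq_scalar_cauchy cauchy.
have [e e0 osc] := oscillation k0 ia enum_a.
have [|||N0 H] := cauchy _ _ (e ^+ 2).
- exact: cmeasurable_ec.
- by move=> x; exact: csq_ec.
- by rewrite exprn_gt0.
have [N [M [N0N N0M]]] := osc N0; rewrite ltNge => /negP; apply.
(* Only imaginary parts are compared: they are the averages that oscillate, and [csq] dominates the
   square of their difference. *)
have ims K : complex.Im (s K) = K%:R^-1 * \sum_(i < K) syc ((a i)%:R ^+ k * alpha).
  have KV : K%:R^-1 = (K%:R^-1 : R)%:C%C by rewrite fmorphV rmorph_nat.
  by rewrite /s KV ImM Im_sum /= mul0r addr0.
rewrite -(ler_pXn2r (_ : 0 < 2)%N) ?nnegrE ?(ltW e0) // real_normK ?num_real //.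
apply: le_trans (H N M N0N N0M); rewrite -!ims /csq.
rewrite [X in _ <= _ + X ^+ 2](_ : _ = complex.Im (s N) - complex.Im (s M)); last first.
  by case: (s N) (s M) => [? ?] [? ?].
by rewrite lerDr sqr_ge0.
Qed.

Theorem theorem2 (R : realType) (k : nat) (hk : (2 <= k)%N) (alpha : R)
    (halpha : irrational alpha) :
  set_of_convergence R (k - 1) (S_set k alpha) /\
  ~ set_of_convergence R k (S_set k alpha).
Proof.
have k0 : (0 < k)%N by exact: ltnW.
have Su := S_set_unbounded k0 halpha.
split.
  split; first exact: unbounded_infinite.
    move=> n [j /= j1 /I_set_range/andP[h _]]; apply: leq_trans h.
    by rewrite expn_gt0.
  move=> a enum_a d X mu T mT f Lf.
  have k1 : (k - 1 < k)%N by rewrite subn1 prednK.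
  exact: (complex_convergence mT halpha k1 enum_a Lf).
have [a enum_a] := unbounded_enumeration Su.
have [d [X [mu [T [f [mT Lf ncv]]]]]] := S_set_nonconvergent k0 halpha enum_a.
by case=> _ _ /(_ a enum_a d X mu T mT f Lf).
Qed.
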